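(* Let $C$ be the classical Cesàro operator on $H^2$, given by $Ce_k=\sum_{j\ge k}\frac{1}{j+1}e_j$ for $k\ge 0$. Then $C$ belongs to the commutator ideal $\mathfrak C$ of the Toeplitz algebra $\mathcal T$. In particular, $C\in\mathfrak C\subset\mathcal T$.
   Context: $H^2$ is the Hardy space of the unit disc with orthonormal basis $e_n(z)=z^n$, $n\ge0$, viewed as a closed subspace of $L^2(\mathbb T)$, and $P:L^2(\mathbb T)\to H^2$ is the orthogonal projection. For $b\in L^\infty(\mathbb T)$ the Toeplitz operator is $T_b=PM_b|_{H^2}$, where $M_b$ is multiplication by $b$. The Toeplitz algebra $\mathcal T$ is the norm-closed $C^*$-subalgebra of $B(H^2)$ generated by all $T_b$, $b\in L^\infty(\mathbb T)$. The commutator ideal $\mathfrak C$ is the closed two-sided ideal of $\mathcal T$ generated by all commutators $AB-BA$, $A,B\in\mathcal T$. (The Cesàro operator $C$ is a bounded operator on $H^2$.) *)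

(* Defs.v *)
From HB Require Import structures.
From mathcomp Require Import all_boot all_order all_algebra.
From mathcomp Require Import generic_quotient ring_quotient sesquilinear.
From mathcomp Require Import complex ring lra.
From mathcomp Require Import all_classical all_reals all_analysis ess_sup_inf measurable_realfun.

Set Implicit Arguments.
Unset Strict Implicit.
Unset Printing Implicit Defensive.
Import Order.TTheory GRing.Theory Num.Theory.
Import numFieldNormedType.Exports.

Local Open Scope classical_set_scope.
Local Open Scope complex_scope.
Local Open Scope quotient_scope.
Local Open Scope ring_scope.

Section dot_norm.
Context (C : numClosedFieldType) (U : lmodType C) (form : {dot U for Num.conj}).

Definition dot_norm (u : U) : C := sqrtC (form u u).

Lemma dot_CauchySchwarz u v : `|form u v| <= dot_norm u * dot_norm v.
Proof.
rewrite -(sqrCK (normr_ge0 _)) -sqrtCM ?nnegrE ?dnorm_ge0//.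
rewrite ler_sqrtC ?nnegrE ?exprn_ge0 ?mulr_ge0 ?dnorm_ge0//.
have [-> | v0] := eqVneq v 0; first by rewrite !linear0r normr0 expr0n.
have vv : form v v != 0 by rewrite dnorm_eq0.
have [a [w wv ->]] : exists a, exists2 w, form w v = 0 & u = w + a *: v.
  exists (form u v / form v v), (u - form u v / form v v *: v); last by rewrite subrK.
  by rewrite linearBl linearZl_LR /= divfK ?subrr.
rewrite linearDl /= wv add0r linearZl_LR /= normrM (ger0_norm (dnorm_ge0 _ _)) exprMn.
rewrite hnormDd /=; last by rewrite linearZr_LR /= wv mulr0.
by rewrite dnormZ mulrDl [form v v ^+ 2]expr2 mulrA lerDr mulr_ge0// dnorm_ge0.
Qed.

Lemma dot_normD u v : dot_norm (u + v) <= dot_norm u + dot_norm v.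
Proof.
rewrite -ler_sqr ?nnegrE ?addr_ge0 ?sqrtC_ge0 ?dnorm_ge0//.
rewrite sqrrD !sqrtCK addrAC dnormD lerD2l -mulr_natr.
rewrite -[_ + _](divfK (negbT (pnatr_eq0 C 2))) -/('Re _) ler_pM2r//.
have [+ _] := leif_Re_Creal (form u v); rewrite ReE => /le_trans; apply.
exact: dot_CauchySchwarz.
Qed.

Lemma dot_normZ a u : dot_norm (a *: u) = `|a| * dot_norm u.
Proof.
by rewrite /dot_norm dnormZ sqrtCM ?nnegrE ?exprn_ge0 ?dnorm_ge0// sqrCK.
Qed.

Lemma dot_norm_eq0 u : dot_norm u = 0 -> u = 0.
Proof. by move/eqP; rewrite sqrt_dnorm_eq0 => /eqP. Qed.

End dot_norm.

Section complex_valued_functions.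
Context d (T : measurableType d) (R : realType).
Variable mu : {measure set T -> \bar R}.
Local Notation Re := (@complex.Re R).
Local Notation Im := (@complex.Im R).

(* |f| belongs to L^p iff Re f and Im f do. *)
Definition cLfun (p : \bar R) : {pred T -> R[i]} :=
  [pred f | (Re \o f \in Lfun mu p) && (Im \o f \in Lfun mu p)].

Definition cintegral (f : T -> R[i]) : R[i] :=
  (\int[mu]_x Re (f x)) +i* (\int[mu]_x Im (f x)).

Lemma Lfun2D (f g : T -> R) :
  f \in Lfun mu 2%:E -> g \in Lfun mu 2%:E -> (fun x => f x + g x) \in Lfun mu 2%:E.
Proof.
move=> f2 g2; have [_ /(_ 1 f g f2 g2)] := Lfun_submod_closed mu (lee1n 2).
by rewrite scale1r.
Qed.

Lemma Lfun2Z (a : R) (f : T -> R) :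
  f \in Lfun mu 2%:E -> (fun x => a * f x) \in Lfun mu 2%:E.
Proof.
move=> f2; have [z /(_ a f 0 f2 )] := Lfun_submod_closed mu (lee1n 2).
by move=> /(_ z); rewrite addr0.
Qed.

Lemma cLfun2_submod_closed : submod_closed (cLfun 2%:E).
Proof.
have [z _] := Lfun_submod_closed mu (lee1n 2).
split=> [|a f g /andP[f1 f2] /andP[g1 g2]]; first exact/andP.
apply/andP; split.
- rewrite [X in X \in _](_ : _ = fun x =>
    (complex.Re a * (Re \o f) x + (- complex.Im a) * (Im \o f) x) + (Re \o g) x); last first.
    apply/funext => x; rewrite /= -[(a *: f + g) x]/(a * f x + g x).
    by case: a (f x) (g x) => a b [u v] [w t]/=; rewrite mulNr.
  by rewrite Lfun2D// Lfun2D// Lfun2Z.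
- rewrite [X in X \in _](_ : _ = fun x =>
    (complex.Re a * (Im \o f) x + complex.Im a * (Re \o f) x) + (Im \o g) x); last first.
    apply/funext => x; rewrite /= -[(a *: f + g) x]/(a * f x + g x).
    by case: a (f x) (g x) => a b [u v] [w t]/=.
  by rewrite Lfun2D// Lfun2D// Lfun2Z.
Qed.

HB.instance Definition _ :=
  GRing.isSubmodClosed.Build R[i] (T -> R[i]) (cLfun 2%:E) cLfun2_submod_closed.

Record L2fun := { L2fun_val :> T -> R[i]; L2funP : L2fun_val \in cLfun 2%:E }.

HB.instance Definition _ := [isSub for L2fun_val].
HB.instance Definition _ := [Choice of L2fun by <:].
HB.instance Definition _ := [SubChoice_isSubLmodule of L2fun by <:].

Definition L2null : {pred L2fun} :=
  [pred f : L2fun | `[< {ae mu, forall x, f x = 0} >]].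

Lemma L2null_zmod_closed : zmod_closed L2null.
Proof.
split=> [|f g /asboolP f0 /asboolP g0]; first exact/asboolP/aeW.
apply/asboolP; apply: filterS2 f0 g0 => x f0 g0.
by rewrite -[LHS]/(f x - g x) f0 g0 subrr.
Qed.

HB.instance Definition _ := GRing.isZmodClosed.Build L2fun L2null L2null_zmod_closed.

Definition L2 : Type := Quotient.quot L2null.

HB.instance Definition _ := GRing.Zmodule.on L2.
HB.instance Definition _ := EqQuotient.on L2.

Lemma L2piP (f g : L2fun) :
  reflect {ae mu, forall x, f x = g x} (\pi_L2 f == \pi_L2 g).
Proof.
rewrite piE; apply: (iffP (asboolP _)); apply: filterS => x.
- by rewrite -[X in X = 0 -> _]/(f x - g x) => /eqP; rewrite subr_eq0 => /eqP.
- by rewrite -[X in _ -> X = 0]/(f x - g x) => ->; rewrite subrr.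
Qed.

Lemma L2reprP (f : L2fun) : {ae mu, forall x, repr (\pi_L2 f) x = f x}.
Proof. by apply/L2piP; rewrite reprK. Qed.

Definition L2scale (a : R[i]) := lift_op1 L2 ( *:%R a).

Lemma L2scale_pi a f : L2scale a (\pi_L2 f) = \pi_L2 (a *: f).
Proof.
unlock L2scale; apply/eqP/L2piP; apply: filterS (L2reprP f) => x fx.
by change (a * (repr (\pi_L2 f) x) = a * f x); rewrite fx.
Qed.

Lemma L2scaleA a b u : L2scale a (L2scale b u) = L2scale (a * b) u.
Proof. by elim/quotW: u => f; rewrite !L2scale_pi scalerA. Qed.

Lemma L2scale1 : left_id 1 L2scale.
Proof. by elim/quotW => f; rewrite L2scale_pi scale1r. Qed.

Lemma L2scaleDr : right_distributive L2scale +%R.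
Proof.
move=> a; elim/quotW => f; elim/quotW => g.
by rewrite !L2scale_pi -!raddfD/= L2scale_pi scalerDr raddfD.
Qed.

Lemma L2scaleDl u : {morph L2scale^~ u : a b / a + b}.
Proof. by move=> a b; elim/quotW: u => f; rewrite !L2scale_pi scalerDl raddfD. Qed.

HB.instance Definition _ :=
  GRing.Zmodule_isLmodule.Build R[i] L2
    L2scaleA L2scale1 L2scaleDr L2scaleDl.

Lemma L2pi_linear : linear (\pi_L2 : L2fun -> L2).
Proof. by move=> a f g; rewrite raddfD/= -L2scale_pi. Qed.

HB.instance Definition _ :=
  GRing.isLinear.Build R[i] L2fun L2 _ (\pi_L2) L2pi_linear.

Definition cintegrable (F : T -> R[i]) :=
  mu.-integrable setT (EFin \o (Re \o F)) /\ mu.-integrable setT (EFin \o (Im \o F)).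

Lemma cintegralP (a : R[i]) (F G : T -> R[i]) : cintegrable F -> cintegrable G ->
  cintegral (fun x => a * F x + G x) = a * cintegral F + cintegral G.
Proof.
move=> [F1 F2] [G1 G2]; case: a => a b.
have iZ c (f : T -> R) : mu.-integrable setT (EFin \o f) ->
    mu.-integrable setT (EFin \o (fun x => c * f x)).
  by move=> fi; have := integrableZl measurableT c fi; apply: eq_integrable.
have iD (f g : T -> R) : mu.-integrable setT (EFin \o f) ->
    mu.-integrable setT (EFin \o g) ->
    mu.-integrable setT (EFin \o (fun x => f x + g x)).
  by move=> fi gi; have := integrableD measurableT fi gi; apply: eq_integrable.
rewrite /cintegral; apply/eqP; rewrite eq_complex; apply/andP; split => /=; apply/eqP.
- rewrite [LHS](_ : _ = \int[mu]_x ((a * Re (F x) + (- b) * Im (F x)) + Re (G x))).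
    rewrite RintegralD//; [|exact/iD/iZ/F2/iZ/F1].
    rewrite RintegralD//; [|exact: iZ|exact: iZ].
    by rewrite !RintegralZl// mulNr.
  apply: eq_Rintegral => x _.
  by case: (F x) (G x) => ? ? [? ?]/=; rewrite mulNr.
- rewrite [LHS](_ : _ = \int[mu]_x ((a * Im (F x) + b * Re (F x)) + Im (G x))).
    rewrite RintegralD//; [|exact/iD/iZ/F1/iZ/F2].
    rewrite RintegralD//; [|exact: iZ|exact: iZ].
    by rewrite !RintegralZl.
  apply: eq_Rintegral => x _.
  by case: (F x) (G x) => ? ? [? ?]/=.
Qed.

Lemma eq_cintegral (F G : T -> R[i]) : cintegrable F -> cintegrable G ->
  {ae mu, forall x, F x = G x} -> cintegral F = cintegral G.
Proof.
move=> [F1 F2] [G1 G2] FG; rewrite /cintegral /Rintegral; congr (fine _ +i* fine _).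
- apply: ae_eq_integral => //; [exact: measurable_int F1|exact: measurable_int G1|].
  by apply: filterS FG => x /= ->.
- apply: ae_eq_integral => //; [exact: measurable_int F2|exact: measurable_int G2|].
  by apply: filterS FG => x /= ->.
Qed.

Definition L2fun_dot (f g : T -> R[i]) : R[i] := cintegral (fun x => f x * (g x)^*).

Lemma Re_mul_conj (z w : R[i]) : Re (z * w^*) = Re z * Re w + Im z * Im w.
Proof. by case: z w => ? ? [? ?] /=; rewrite mulrN opprK. Qed.

Lemma Im_mul_conj (z w : R[i]) : Im (z * w^*) = - (Re z * Im w) + Im z * Re w.
Proof. by case: z w => ? ? [? ?] /=; rewrite mulrN. Qed.

Lemma L2fun_dot_integrable (f g : L2fun) : cintegrable (fun x => f x * (g x)^*).
Proof.
have /andP[f1 f2] := L2funP f; have /andP[g1 g2] := L2funP g.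
split; apply/Lfun1_integrable.
- rewrite [X in X \in _](_ : _ = (Re \o f) \* (Re \o g) \+ (Im \o f) \* (Im \o g)).
    have [_ /(_ 1)] := Lfun_submod_closed mu (lexx 1%E).
    move=> /(_ _ _ (Lfun2_mul_Lfun1 f1 g1) (Lfun2_mul_Lfun1 f2 g2)).
    by rewrite scale1r.
  by apply/funext => x; rewrite /= Re_mul_conj.
- rewrite [X in X \in _](_ : _ = - ((Re \o f) \* (Im \o g)) \+ (Im \o f) \* (Re \o g)).
    have [_ /(_ (-1))] := Lfun_submod_closed mu (lexx 1%E).
    move=> /(_ _ _ (Lfun2_mul_Lfun1 f1 g2) (Lfun2_mul_Lfun1 f2 g1)).
    by rewrite scaleN1r.
  by apply/funext => x; rewrite /= Im_mul_conj.
Qed.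

Definition L2dot (u v : L2) : R[i] := L2fun_dot (repr u) (repr v).

Lemma L2dot_pi (f g : L2fun) : L2dot (\pi_L2 f) (\pi_L2 g) = L2fun_dot f g.
Proof.
apply: eq_cintegral; [exact: L2fun_dot_integrable..|].
by apply: filterS2 (L2reprP f) (L2reprP g) => x -> ->.
Qed.

Lemma L2dot_conj (u v : L2) : L2dot u v = (-1) ^+ false * (L2dot v u)^*.
Proof.
rewrite mul1r /L2dot /L2fun_dot /cintegral.
move: (L2fun_dot_integrable (repr v) (repr u)) => [_].
move: (repr u : T -> R[i]) (repr v : T -> R[i]) => f g fg.
apply/eqP; rewrite eq_complex /=; apply/andP; split; apply/eqP.
  by apply: eq_Rintegral => x _; rewrite !Re_mul_conj mulrC [X in _ + X]mulrC.
rewrite -mulN1r -RintegralZl//; apply: eq_Rintegral => x _.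
by rewrite !Im_mul_conj; ring.
Qed.

Lemma L2dotPl w : GRing.linear_for *%R (L2dot ^~ w).
Proof.
move=> a; elim/quotW => f; elim/quotW => g; elim/quotW: w => h.
rewrite -linearP !L2dot_pi -cintegralP; try exact: L2fun_dot_integrable.
by congr cintegral; apply/funext => x; rewrite mulrA -mulrDl.
Qed.

Lemma L2dotPr w : GRing.linear_for (Num.conj \; *%R) (L2dot w).
Proof.
move=> a f g; rewrite L2dot_conj L2dotPl [L2dot w f]L2dot_conj [L2dot w g]L2dot_conj.
by rewrite !mul1r rmorphD rmorphM.
Qed.

HB.instance Definition _ :=
  bilinear_isBilinear.Build R[i] L2 L2 R[i] *%R (Num.conj \; *%R) L2dot
    (L2dotPl, L2dotPr).

HB.instance Definition _ :=
  isHermitianSesquilinear.Build R[i] L2 false Num.conj L2dot L2dot_conj.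

Lemma L2dot_gt0 u : u != 0 -> 0 < L2dot u u.
Proof.
elim/quotW: u => f f0; rewrite L2dot_pi.
pose h x := Re (f x * (f x)^*).
have h0 x : 0 <= h x by rewrite /h Re_mul_conj -!expr2 addr_ge0 ?sqr_ge0.
have [hi _] : cintegrable (fun x => f x * (f x)^*) by exact: L2fun_dot_integrable.
rewrite /L2fun_dot /cintegral [X in _ +i* X](_ : _ = 0); last first.
  rewrite /Rintegral; under eq_integral do rewrite Im_mul_conj mulrC addNr.
  by rewrite integral0.
rewrite ltcR lt_def Rintegral_ge0 ?andbT => [|x _]; last exact: h0.
apply: contra_neq f0 => h_0.
rewrite -(linear0 (\pi_L2)); apply/eqP/L2piP.
have : (\int[mu]_x `|(h x)%:E| = 0)%E.
  under eq_integral do rewrite gee0_abs ?lee_fin//.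
  by rewrite -[LHS]fineK ?[fine _]h_0//; exact: integrable_fin_num hi.
move/(ae_eq_integral_abs mu measurableT (measurable_int mu hi)).
apply: filterS => x /(_ I) [] /eqP; rewrite Re_mul_conj -!expr2.
rewrite paddr_eq0 ?sqr_ge0// !sqrf_eq0 => /andP[/eqP re /eqP im].
by apply/eqP; rewrite eq_complex re im eqxx.
Qed.

HB.instance Definition _ := isDotProduct.Build R[i] L2 L2dot L2dot_gt0.

HB.instance Definition _ := Lmodule_isNormed.Build R[i] L2
  (dot_normD L2dot) (dot_normZ L2dot) (@dot_norm_eq0 _ _ L2dot).

Lemma Linfty_bounded (g : T -> R) : g \in Lfun mu +oo ->
  exists2 M, 0 <= M & {ae mu, forall x, `|g x| <= M}.
Proof.
move=> /andP[/[!inE] mg]; rewrite /= /finite_norm unlock.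
case: ifPn => [mu0 /ess_supr_bounded[M gM]|mu0 _].
  exists (Num.max M 0); first by rewrite le_max lexx orbT.
  by apply: filterS gM => x; rewrite le_max => ->.
exists 0 => //; exists [set: T]; split => //.
by apply/eqP; rewrite eq_le measure_ge0 andbT leNgt.
Qed.

Lemma Linfty_mul_Lfun2 (g f : T -> R) :
  g \in Lfun mu +oo -> f \in Lfun mu 2%:E -> (fun x => g x * f x) \in Lfun mu 2%:E.
Proof.
move=> gi f2; have [M M0 gM] := Linfty_bounded gi.
have /andP[/[!inE]/= mg _] := gi; have /andP[/[!inE]/= mf ff] := f2.
have /andP[/[!inE]/= _] := Lfun2Z M f2.
rewrite /finite_norm unlock /Lnorm => /lty_poweRy Mf.
apply/andP; rewrite !inE/=; split; first exact: measurable_funM.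
rewrite /finite_norm unlock /Lnorm poweR_lty//.
apply: le_lt_trans (Mf _) => //.
apply: ae_ge0_le_integral => //.
- by move=> x _; rewrite lee_fin powR_ge0.
- apply/measurable_EFinP/(measurableT_comp (measurable_powR _)) => //.
  by apply: measurableT_comp => //; exact: measurable_funM.
- by move=> x _; rewrite lee_fin powR_ge0.
- apply/measurable_EFinP/(measurableT_comp (measurable_powR _)) => //.
  by apply: measurableT_comp => //; exact: measurable_funM.
- apply: filterS gM => x gM _; rewrite lee_fin ge0_ler_powR ?nnegrE//.
  by rewrite !normrM ler_wpM2r// (ger0_norm M0).
Qed.

(* Essentially bounded functions rather than classes: L2mul below depends on b
   only up to almost everywhere equality. *)
Record Linfty := { Linfty_val :> T -> R[i]; LinftyP : Linfty_val \in cLfun +oo }.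

Lemma Linfty_mul_L2 (b : Linfty) (f : L2fun) : (fun x => b x * f x) \in cLfun 2%:E.
Proof.
have /andP[b1 b2] := LinftyP b; have /andP[f1 f2] := L2funP f.
apply/andP; split.
- rewrite [X in X \in _](_ : _ = fun x =>
    (Re \o b) x * (Re \o f) x + (- 1) * ((Im \o b) x * (Im \o f) x)).
    by apply: Lfun2D; [|apply: Lfun2Z]; exact: Linfty_mul_Lfun2.
  by apply/funext => x /=; case: (b x) (f x) => ? ? [? ?] /=; rewrite mulN1r.
- rewrite [X in X \in _](_ : _ = fun x =>
    (Re \o b) x * (Im \o f) x + ((Im \o b) x * (Re \o f) x)).
    by apply: Lfun2D; exact: Linfty_mul_Lfun2.
  by apply/funext => x /=; case: (b x) (f x) => ? ? [? ?] /=.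
Qed.

Definition L2mul (b : Linfty) (u : L2) : L2 :=
  \pi_L2 (Build_L2fun (Linfty_mul_L2 b (repr u))).

Lemma L2mul_pi b f : L2mul b (\pi_L2 f) = \pi_L2 (Build_L2fun (Linfty_mul_L2 b f)).
Proof. by apply/eqP/L2piP; apply: filterS (L2reprP f) => x /= ->. Qed.

End complex_valued_functions.

Section operators.
Context (R : realType) (V : normedModType R[i]) (dot : {dot V for Num.conj}).
Implicit Types (A B : V -> V) (S J : set (V -> V)).

Definition bounded_operator A :=
  linear A /\ exists M : R, forall u, `|A u| <= M%:C * `|u|.

(* Norms of vectors are elements of R[i]; Re recovers the real number. *)
Definition opnorm A : R := sup [set complex.Re `|A u| | u in [set u | `|u| <= 1]].

Definition norm_closed S := forall A, bounded_operator A ->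
  (forall e : R, 0 < e -> exists2 B, S B & opnorm (A \- B) < e) -> S A.

Definition adjoint A B := forall u v, dot (A u) v = dot u (B v).

Record cstar_subalgebra S : Prop := {
  cstar_bounded : forall A, S A -> bounded_operator A;
  cstar0 : S (fun=> 0);
  cstarD : forall A B, S A -> S B -> S (A \+ B);
  cstarZ : forall (c : R[i]) A, S A -> S (fun u => c *: A u);
  cstarM : forall A B, S A -> S B -> S (A \o B);
  cstar_adj : forall A B, S A -> bounded_operator B -> adjoint A B -> S B;
  cstar_closed : norm_closed S }.

Record closed_ideal S J : Prop := {
  ideal_sub : J `<=` S;
  ideal0 : J (fun=> 0);
  idealD : forall A B, J A -> J B -> J (A \+ B);
  idealZ : forall (c : R[i]) A, J A -> J (fun u => c *: A u);
  idealMl : forall A B, S A -> J B -> J (A \o B);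
  idealMr : forall A B, J A -> S B -> J (A \o B);
  ideal_closed : norm_closed J }.

Definition cstar_generated (G : set (V -> V)) : set (V -> V) :=
  \bigcap_(S in [set S | cstar_subalgebra S /\ G `<=` S]) S.

Definition commutator_ideal S : set (V -> V) :=
  \bigcap_(J in [set J | closed_ideal S J /\
    forall A B, S A -> S B -> J ((A \o B) \- (B \o A))]) J.

End operators.

Section hardy_space.
Context (R : realType).

Lemma pi2_gt0 : (0 : R) < 2 * pi.
Proof. by rewrite mulr_gt0// pi_gt0. Qed.

(* The circle is parametrised by t in [0, 2 pi], t standing for z = e^(it);
   this is normalised arc length. *)
Definition circle_measure : probability (measurableTypeR R) R :=
  uniform_prob pi2_gt0.

Local Notation L2T := (L2 circle_measure).

Definition expi (t : R) : R[i] := cos t +i* sin t.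

Lemma expiX n t : expi t ^+ n = expi (n%:R * t).
Proof.
elim: n => [|n IH]; first by rewrite expr0 mul0r /expi cos0 sin0.
rewrite exprS IH -natr1 mulrDl mul1r [in RHS]/expi cosD sinD /expi.
by apply/eqP; rewrite eq_complex /=; apply/andP; split; apply/eqP; ring.
Qed.

Lemma bounded_Linfty (f : R -> R) : continuous f -> (forall t, `|f t| <= 1) ->
  f \in Lfun circle_measure +oo.
Proof.
move=> cf f1; apply/andP; rewrite !inE; split; first exact: continuous_measurable_fun.
rewrite /= /finite_norm unlock; case: ifPn => // _.
apply: le_lt_trans (ltry 1); apply/ess_supP/aeW => t.
by rewrite lee_fin.
Qed.

Lemma expiX_Linfty n : (fun t : R => expi t ^+ n) \in cLfun circle_measure +oo.
Proof.
apply/andP; split.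
- rewrite [X in X \in _](_ : _ = fun t => cos (n%:R * t)); last first.
    by apply/funext => t; rewrite /= expiX.
  apply: bounded_Linfty => [t|t]; last exact: cos_max.
  apply: (@continuous_comp _ _ _ (fun t : R => n%:R * t)); last exact: continuous_cos.
  exact: mulrl_continuous.
- rewrite [X in X \in _](_ : _ = fun t => sin (n%:R * t)); last first.
    by apply/funext => t; rewrite /= expiX.
  apply: bounded_Linfty => [t|t]; last first.
    by rewrite ler_norml sin_geN1 sin_le1.
  apply: (@continuous_comp _ _ _ (fun t : R => n%:R * t)); last exact: continuous_sin.
  exact: mulrl_continuous.
Qed.

Lemma expiX_Lfun2 n : (fun t : R => expi t ^+ n) \in cLfun circle_measure 2%:E.
Proof.
have /andP[re im] := expiX_Linfty n.
by apply/andP; split; apply: (@Lfun_subset _ _ _ _ _ +oo); rewrite ?lee1n ?leey//;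
  exact: fin_num_measure.
Qed.

Definition L2monomial n : L2T := \pi_(L2T) (Build_L2fun (expiX_Lfun2 n)).

Definition analytic_polynomials : set L2T :=
  [set p | exists n (c : nat -> R[i]), p = \sum_(k < n) c k *: L2monomial k].

Definition hardy : {pred L2T} := mem (closure analytic_polynomials).

Lemma hardy_submod_closed : submod_closed hardy.
Proof.
have sub p : analytic_polynomials p -> p \in hardy.
  by move=> pP; rewrite inE; exact: subset_closure.
split=> [|a u v].
  by apply: sub; exists 0%N, (fun=> 0); rewrite big_ord0.
rewrite !inE => uP vP B auvB.
have cont : (a *: z.1 + z.2) @[z --> (u, v)] --> a *: u + v.
  by apply: cvgD; [apply: cvgZr; exact: cvg_fst|exact: cvg_snd].
have [[U V] [/= uU vV] UVB] := cont B auvB.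
have [p [[n [c pE]] Up]] := uP U uU; have [q [[m [e qE]] Vq]] := vP V vV.
exists (a *: p + q); split; last exact: (UVB (p, q)).
pose t k (f : nat -> R[i]) i := if (i < k)%N then f i else 0.
have ext k (f : nat -> R[i]) l : (k <= l)%N ->
    \sum_(i < k) f i *: L2monomial i = \sum_(i < l) t k f i *: L2monomial i.
  move=> kl; rewrite (big_ord_widen l (fun i => f i *: L2monomial i) kl) big_mkcond /=.
  by apply: eq_bigr => i _; rewrite /t; case: ifP => // _; rewrite scale0r.
exists (maxn n m), (fun i => a * t n c i + t m e i).
rewrite pE qE (ext n c _ (leq_maxl n m)) (ext m e _ (leq_maxr n m)).
rewrite scaler_sumr -big_split /=; apply: eq_bigr => i _.
by rewrite scalerDl scalerA.
Qed.

HB.instance Definition _ :=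
  GRing.isSubmodClosed.Build R[i] L2T hardy hardy_submod_closed.

Record H2 := { H2val :> L2T; H2P : H2val \in hardy }.

HB.instance Definition _ := [isSub for H2val].
HB.instance Definition _ := [Choice of H2 by <:].
HB.instance Definition _ := [SubChoice_isSubLmodule of H2 by <:].

Definition H2dot (f g : H2) : R[i] := L2dot (val f) (val g).

Lemma H2dotPl h : GRing.linear_for *%R (H2dot ^~ h).
Proof. by move=> a f g; rewrite /H2dot linearP linearPl. Qed.

Lemma H2dotPr h : GRing.linear_for (Num.conj \; *%R) (H2dot h).
Proof. by move=> a f g; rewrite /H2dot linearP linearPr. Qed.

HB.instance Definition _ :=
  bilinear_isBilinear.Build R[i] H2 H2 R[i] *%R (Num.conj \; *%R) H2dot
    (H2dotPl, H2dotPr).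

Lemma H2dot_conj f g : H2dot f g = (-1) ^+ false * (H2dot g f)^*.
Proof. exact: L2dot_conj. Qed.

HB.instance Definition _ :=
  isHermitianSesquilinear.Build R[i] H2 false Num.conj H2dot H2dot_conj.

Lemma H2dot_gt0 f : f != 0 -> 0 < H2dot f f.
Proof.
move=> f0; apply: neq0_dnorm_gt0; apply: contra_neq f0 => f0.
by apply/val_inj; rewrite linear0.
Qed.

HB.instance Definition _ := isDotProduct.Build R[i] H2 H2dot H2dot_gt0.

HB.instance Definition _ := Lmodule_isNormed.Build R[i] H2
  (dot_normD H2dot) (dot_normZ H2dot) (@dot_norm_eq0 _ _ H2dot).

Lemma H2monomial_subproof n : L2monomial n \in hardy.
Proof.
rewrite inE; apply: subset_closure; exists n.+1, (fun k => (k == n)%:R).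
rewrite big_ord_recr /= eqxx scale1r big1 ?add0r// => i _.
by rewrite ltn_eqF// scale0r.
Qed.

Definition H2monomial n : H2 := Build_H2 (H2monomial_subproof n).

(* The orthogonal projection of f on H2. The default value 0 of xget is never
   used: H2 is a closed subspace of the complete space L2, so that exactly one
   g has f - g orthogonal to H2. *)
Definition hardy_proj (f : L2T) : H2 :=
  xget 0 [set g : H2 | forall h : H2, L2dot (f - val g) (val h) = 0].

Definition toeplitz (b : Linfty circle_measure) (f : H2) : H2 :=
  hardy_proj (L2mul b (val f)).

Definition toeplitz_algebra : set (H2 -> H2) :=
  cstar_generated H2dot (range toeplitz).

Definition toeplitz_commutator_ideal : set (H2 -> H2) :=
  commutator_ideal toeplitz_algebra.

Definition is_cesaro (C : H2 -> H2) : Prop :=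
  bounded_operator C /\
  forall k, \sum_(k <= j < n) (j.+1%:R)^-1 *: H2monomial j @[n --> \oo]
    --> C (H2monomial k).

End hardy_space.

Arguments toeplitz_algebra R : clear implicits.
Arguments toeplitz_commutator_ideal R : clear implicits.

(* Main.v *)
(* If a closed ideal contains all commutators then it contains the finite matrices, by
   way of the commutator of the shift and its adjoint. It also contains the self-commutator
   of the Toeplitz operator with symbol (1 - z)^(i a), whose entries are, up to a constant
   and a square summable error, (exp (- i a s) - 1) / (j - k) with s = H_j - H_k a
   difference of harmonic numbers. Hence the kernels (p s - p 0) / (j - k) with p a
   trigonometric polynomial are in the ideal up to Hilbert-Schmidt operators, which are
   norm limits of finite matrices. As s is close to ln (j / k), the entry 1 / (j + 1) of
   the Cesaro operator on k <= j is close to f s / (j - k) with f s = 1 - exp (- s) for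
   s > 0 and f s = 0 otherwise, and f can be approximated by trigonometric polynomials
   well enough to make the error small in operator norm. *)
Require Import Defs.
From HB Require Import structures.
From mathcomp Require Import all_boot all_order all_algebra.
From mathcomp Require Import generic_quotient ring_quotient sesquilinear.
From mathcomp Require Import complex ring lra zify.
From mathcomp Require Import all_classical all_reals all_analysis ess_sup_inf measurable_realfun.
Set Implicit Arguments.
Unset Strict Implicit.
Unset Printing Implicit Defensive.
Import Order.TTheory GRing.Theory Num.Theory.
Import numFieldNormedType.Exports.
Local Open Scope classical_set_scope.
Local Open Scope complex_scope.
Local Open Scope quotient_scope.
Local Open Scope ring_scope.

(** * Real-valued norms *)

(** The number [j - k - i a] is constant along diagonals, and multiplication by it turns the
    products of coefficients of [(1 - z)^(i a)] that make up the self-commutator into differences of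
    products of their partial sums [w]. Both halves of the commutator thus telescope, and it remains
    to see that [w_(n+1)] behaves like a nonzero constant times [exp (- i a H_n)]. The constant is
    nonzero because the zeroth coefficient is, which is proved by testing the symbol against
    positive weights. The obstacle is that [f] is not almost periodic: it tends to 1 at one end and
    vanishes at the other, so no trigonometric polynomial is uniformly close to it. It is enough
    that [|p s| <= min 1 |s|] everywhere and that [p] is close to [f] for [e <= |s| <= S]. Near the
    diagonal, Schur's test shows that the band [|s| < e] has small norm. Far from it,
    [1 <= |s| / S], and the kernel [|s| / (max j k + 1)] is dominated by that of [C ^ 2] plus its
    transpose, so the boundedness of [C] itself makes this part [O(1 / S)]. *)

Section real_norm.
Context (R : realType).
Local Notation Re := (@complex.Re R).
Local Notation Im := (@complex.Im R).

(** Norms take values in [R[i]]; the real number is extracted so that suprema and linear arithmetic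
    over [R] apply. *)
Definition rnorm (V : normedZmodType R[i]) (u : V) : R := Re `|u|.

Lemma rnormE (V : normedZmodType R[i]) (u : V) : `|u| = (rnorm u)%:C.
Proof.
have := normr_ge0 u; rewrite /rnorm; case: `|u| => a b.
by rewrite lecE /= => /andP[/eqP -> _].
Qed.

Context (V : normedZmodType R[i]).
Implicit Types u v : V.

Lemma rnorm_ge0 u : 0 <= rnorm u.
Proof. by rewrite -lecR -rnormE normr_ge0. Qed.

Lemma rnormD u v : rnorm (u + v) <= rnorm u + rnorm v.
Proof. by rewrite -lecR rmorphD/= -!rnormE ler_normD. Qed.

Lemma rnorm0 : rnorm (0 : V) = 0.
Proof. by rewrite /rnorm normr0. Qed.

Lemma rnormN u : rnorm (- u) = rnorm u.
Proof. by rewrite /rnorm normrN. Qed.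

Lemma rnormBC u v : rnorm (u - v) = rnorm (v - u).
Proof. by rewrite -rnormN opprB. Qed.

Lemma rnormZ (W : normedModType R[i]) (a : R[i]) (u : W) : rnorm (a *: u) = rnorm a * rnorm u.
Proof. by apply/complexI; rewrite rmorphM/= -!rnormE normrZ. Qed.

Lemma rnorm_sum (I : Type) (r : seq I) (P : pred I) (F : I -> V) :
  rnorm (\sum_(i <- r | P i) F i) <= \sum_(i <- r | P i) rnorm (F i).
Proof.
apply: (big_ind2 (fun x y => rnorm x <= y)); rewrite ?rnorm0//.
by move=> x1 y1 x2 y2 h1 h2; rewrite (le_trans (rnormD _ _))// lerD.
Qed.

Lemma rnorm_eq0 u : rnorm u = 0 -> u = 0.
Proof. by move=> h; apply: normr0_eq0; rewrite rnormE h. Qed.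
End real_norm.

Section complex_modulus.
Context (R : realType).
Implicit Types z w : R[i].
Local Notation Re := (@complex.Re R).
Local Notation Im := (@complex.Im R).

Lemma cnormM z w : rnorm (z * w) = rnorm z * rnorm w.
Proof. by apply/complexI; rewrite rmorphM/= -!rnormE normrM. Qed.
Lemma cnormV z : rnorm (z^-1) = (rnorm z)^-1.
Proof. by apply/complexI; rewrite fmorphV/= -!rnormE normfV. Qed.
Lemma cnorm_conj z : rnorm (z^*) = rnorm z.
Proof. by rewrite /rnorm norm_conjC. Qed.
Lemma cnorm_real (x : R) : rnorm (x%:C) = `|x|.
Proof. by rewrite /rnorm normc_def /= expr0n addr0 sqrtr_sqr. Qed.
Lemma cnorm_i x : rnorm (0 +i* x : R[i]) = `|x|.
Proof. by rewrite /rnorm normc_def /= expr0n add0r sqrtr_sqr. Qed.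
Lemma cnormE2 z : rnorm z ^+ 2 = Re z ^+ 2 + Im z ^+ 2.
Proof. by rewrite /rnorm normc_def /= sqr_sqrtr ?addr_ge0 ?sqr_ge0. Qed.
Lemma cRe_le z : `|Re z| <= rnorm z.
Proof.
rewrite -(@ler_pXn2r _ 2)// ?nnegrE ?rnorm_ge0//.
by rewrite cnormE2 real_normK ?num_real// lerDl sqr_ge0.
Qed.
Lemma cIm_le z : `|Im z| <= rnorm z.
Proof.
rewrite -(@ler_pXn2r _ 2)// ?nnegrE ?rnorm_ge0//.
by rewrite cnormE2 [`|Im z| ^+ 2]real_normK ?num_real// lerDr sqr_ge0.
Qed.
End complex_modulus.

(** * Completeness of L2 *)

Lemma half_expn_small (R : realType) (e : R) : 0 < e -> exists m, 2^-1 ^+ m <= e.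
Proof.
move=> e0; have [m _ mP] := @near_infty_natSinv_lt R (PosNum e0).
exists m.+1; have := mP m (leqnn m); rewrite /= => h; apply/ltW/(le_lt_trans _ h).
rewrite exprVn lef_pV2 ?posrE ?exprn_gt0 ?ltr0n//.
by rewrite -natrX ler_nat ltnW// ltn_expl.
Qed.

Section riesz_fischer.
Context d (T : measurableType d) (R : realType).
Variable mu : {measure set T -> \bar R}.
Local Notation Re := (@complex.Re R).
Local Notation Im := (@complex.Im R).

Lemma Lfun2P (f : T -> R) : measurable_fun setT f ->
  (\int[mu]_x ((f x ^+ 2)%:E) < +oo)%E -> f \in Lfun mu 2%:E.
Proof.
move=> mf fi; apply/andP; rewrite !inE/=; split => //.
rewrite /finite_norm unlock /Lnorm poweR_lty//.
under eq_integral do rewrite /= powR_mulrn// real_normK ?num_real//.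
exact: fi.
Qed.

Lemma measurable_sqE (f g : T -> R) : measurable_fun setT f -> measurable_fun setT g ->
  measurable_fun setT (fun x => ((f x - g x) ^+ 2)%:E).
Proof.
move=> mf mg; have := measurable_funX 2 (measurable_funB mf mg).
by move=> /measurable_EFinP.
Qed.

Lemma ae_cvg_of_fast (f : nat -> T -> R) :
  (forall n, measurable_fun setT (f n)) ->
  (forall n, (\int[mu]_x ((f n.+1 x - f n x) ^+ 2)%:E <= (4^-1 ^+ n)%:E)%E) ->
  {ae mu, forall x, cvgn (f ^~ x)}.
Proof.
move=> mf df.
(* The weight 2^n meets two demands: the sum of the [h n] stays integrable because 2^n 4^-n = 2^-n,
   and |t| <= 2^-n + 2^n t^2 turns its finiteness into absolute convergence of the increments. *)
pose h n x : \bar R := (2 ^+ n * (f n.+1 x - f n x) ^+ 2)%:E.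
have h0 n x : (0 <= h n x)%E by rewrite lee_fin mulr_ge0 ?sqr_ge0 ?exprn_ge0.
have mh n : measurable_fun setT (h n).
  rewrite (_ : h n = fun x => (2 ^+ n)%:E * ((f n.+1 x - f n x) ^+ 2)%:E)%E //.
  apply: emeasurable_funM; [exact: measurable_cst|exact: measurable_sqE].
have ih n : (\int[mu]_x h n x <= (2^-1 ^+ n)%:E)%E.
  rewrite /h; under eq_integral do rewrite EFinM.
  rewrite ge0_integralZl_EFin ?exprn_ge0 ?ler0n//; first last.
    exact: measurable_sqE.
    by move=> x _; rewrite lee_fin sqr_ge0.
  apply: le_trans (lee_wpmul2l _ (df n)) _; first by rewrite lee_fin exprn_ge0.
  rewrite -EFinM lee_fin -exprMn.
  by rewrite (_ : 2 * 4^-1 = 2^-1)//; lra.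
have ihoo : (\int[mu]_x (\sum_(n <oo) h n x) < +oo)%E.
  rewrite integral_nneseries//.
  apply: (@le_lt_trans _ _ (\sum_(n <oo) (2^-1 ^+ n)%:E)%E).
    by apply: lee_nneseries => // n _ _; apply: integral_ge0 => x _; exact: h0.
  rewrite (_ : (fun n => _) = EFin \o series (geometric 1 (2^-1 : R))).
    rewrite EFin_lim ?ltry//; apply: is_cvg_geometric_series.
    by rewrite gtr0_norm; lra.
  by apply/funext => n /=; rewrite sumEFin /series/=; congr EFin; apply: eq_bigr => i _; rewrite mul1r.
have /integrable_ae : mu.-integrable setT (fun x => \sum_(n <oo) h n x)%E.
  apply/integrableP; split; first exact: ge0_emeasurable_sum.
  by under eq_integral do rewrite gee0_abs ?nneseries_ge0//.
move=> /(_ measurableT); apply: filterS => x /(_ I).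
have : (0 <= \sum_(n <oo) h n x)%E by exact: nneseries_ge0.
case E : (\sum_(n <oo) h n x)%E => [s| |]// _ _.
have cs : cvgn (series (fun n => 2 ^+ n * (f n.+1 x - f n x) ^+ 2)).
  apply: nondecreasing_is_cvgn.
    apply/nondecreasing_series => n _ _; rewrite mulr_ge0 ?sqr_ge0 ?exprn_ge0//.
  exists s => _ [n _ <-]; rewrite -lee_fin -E /series/= -sumEFin.
  apply: nneseries_lim_ge => *; exact: h0.
have cg : cvgn (series (fun n => 2^-1 ^+ n + 2 ^+ n * (f n.+1 x - f n x) ^+ 2)).
  apply: is_cvg_seriesD cs.
  have := @is_cvg_geometric_series R 1 2^-1.
  rewrite (_ : geometric _ _ = GRing.exp 2^-1); first by apply; rewrite gtr0_norm; lra.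
  by apply/funext => n; rewrite /= mul1r.
have cn : cvgn (series (telescope (f ^~ x))).
  apply: normed_cvg; apply: series_le_cvg cg => n //=.
  - by rewrite addr_ge0 ?exprn_ge0 ?invr_ge0// mulr_ge0 ?sqr_ge0 ?exprn_ge0.
  - rewrite /telescope /= -(real_normK (num_real (f n.+1 x - f n x))).
    set t := `|_|; have t0 : 0 <= t by exact: normr_ge0.
    have p : 0 < (2 : R) ^+ n by rewrite exprn_gt0.
    rewrite exprVn -(ler_pM2l p) mulrDr mulfV ?gt_eqF//.
    by move: (2 ^+ n) p => a a0; have := sqr_ge0 (a * t - 2^-1); nra.
rewrite (_ : f ^~ x = (fun n => f 0%N x + series (telescope (f ^~ x)) n)).
  by apply: is_cvgD => //; exact: is_cvg_cst.
by apply/funext => n; exact: (eq_sum_telescope (f ^~ x)).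
Qed.

(** Fatou's lemma along the shifted sequence [f (n + m)], since the bound is only given from [m]
    on. *)
Lemma fatou_sqr (f : nat -> T -> R) (F : T -> R) (g : T -> R) (B : R) m :
  (forall n, measurable_fun setT (f n)) -> measurable_fun setT g ->
  measurable_fun setT F -> {ae mu, forall x, f ^~ x @ \oo --> F x} ->
  (forall n, (m <= n)%N -> (\int[mu]_x ((f n x - g x) ^+ 2)%:E <= B%:E)%E) ->
  (\int[mu]_x ((F x - g x) ^+ 2)%:E <= B%:E)%E.
Proof.
move=> mf mg mF fF fB.
pose h n x : \bar R := ((f (n + m)%N x - g x) ^+ 2)%:E.
have mh n : measurable_fun setT (h n).
  exact: measurable_sqE.
have h0 n x : setT x -> (0 <= h n x)%E by rewrite lee_fin sqr_ge0.
rewrite (_ : integral _ _ _ = \int[mu]_x (limn_einf (h ^~ x)))%E; last first.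
  apply: ae_eq_integral => //.
  - exact: measurable_sqE.
  - rewrite (_ : (fun x => limn_einf _) = (fun x => - limn_esup (fun n => - h n x)))%E//.
    apply: measurableT_comp => //; apply: measurable_fun_limn_esup => n.
    exact: measurableT_comp.
  apply: filterS fF => x fx _.
  have hx : h ^~ x @ \oo --> ((F x - g x) ^+ 2)%:E.
    apply: cvg_EFin; first by near=> n.
    rewrite /= /h [X in X @ _](_ : _ = fun n => (f (n + m)%N x - g x) * (f (n + m)%N x - g x));
      last first.
      by apply/funext => n /=; rewrite expr2.
    have c : (f (n + m)%N x - g x) @[n --> \oo] --> F x - g x.
      by apply: cvgB; [rewrite (cvg_shiftn m (f ^~ x)) | exact: cvg_cst].
    by rewrite expr2; exact: (cvgM c c).
  by rewrite is_cvg_limn_einfE; [exact/esym/cvg_lim|apply/cvg_ex; eexists; exact: hx].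
apply: le_trans (fatou mu measurableT mh h0) _.
rewrite limn_einf_lim; apply: lime_le; first exact: is_cvg_einfs.
near=> n; apply: le_trans (fB (n + m)%N (leq_addl _ _)).
by apply: ereal_inf_lbound; exists n => /=.
Unshelve. all: by end_near. Qed.

Lemma Lfun2_measurable (f : T -> R) : f \in Lfun mu 2%:E -> measurable_fun setT f.
Proof. by move=> /andP[/[!inE]]. Qed.

Lemma L2norm_sqr (u : L2 mu) : `|u| ^+ 2 = L2dot u u.
Proof. by rewrite [`|u|](_ : _ = sqrtC (L2dot u u)) // sqrtCK. Qed.

Lemma sqr_rnorm_pi (f : L2fun mu) :
  ((rnorm (\pi_(L2 mu) f) ^+ 2)%:E =
   \int[mu]_x ((Re (f x) ^+ 2)%:E) + \int[mu]_x ((Im (f x) ^+ 2)%:E))%E.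
Proof.
have /andP[f1 f2] := L2funP f.
have i1 := Lfun2_integrable_sqr f1; have i2 := Lfun2_integrable_sqr f2.
have -> : rnorm (\pi_(L2 mu) f) ^+ 2 = Re (L2dot (\pi_(L2 mu) f) (\pi_(L2 mu) f)).
  by rewrite -L2norm_sqr rnormE -rmorphXn.
rewrite L2dot_pi /L2fun_dot /cintegral /=.
have := integralD measurableT i1 i2.
rewrite /= => <-.
rewrite /Rintegral fineK.
  by apply: eq_integral => x _; rewrite Re_mul_conj -!expr2 EFinD.
apply: integrable_fin_num => //; have := integrableD measurableT i1 i2.
by apply: eq_integrable => // x _; rewrite /= Re_mul_conj -!expr2 EFinD.
Qed.


Lemma Lfun2_limit (f : nat -> T -> R) : (forall n, f n \in Lfun mu 2%:E) ->
  (forall m n, (m <= n)%N ->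
    (\int[mu]_x ((f n x - f m x) ^+ 2)%:E <= (4^-1 ^+ m)%:E)%E) ->
  exists2 F, F \in Lfun mu 2%:E &
    forall m, (\int[mu]_x ((F x - f m x) ^+ 2)%:E <= (4^-1 ^+ m)%:E)%E.
Proof.
move=> f2 fm; have mf n := Lfun2_measurable (f2 n).
have [N [mN N0 fN]] := ae_cvg_of_fast mf (fun n => fm n n.+1 (leqnSn n)).
(* Set to zero on the null set [N], the sequence converges everywhere, which makes its pointwise
   limit measurable. *)
pose h n x := f n x * \1_(~` N) x.
have mh n : measurable_fun setT (h n).
  by apply: measurable_funM => //; apply: measurable_indic; exact: measurableC.
have ch x : cvgn (h ^~ x).
  have [xN|xN] := pselect (N x).
    rewrite (_ : h ^~ x = cst 0); first exact: is_cvg_cst.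
    by apply/funext => n; rewrite /h indicE memNset ?mulr0// => /(_ xN).
  rewrite (_ : h ^~ x = f ^~ x).
    by apply: contrapT => c; exact/xN/fN.
  by apply/funext => n; rewrite /h indicE mem_set ?mulr1.
pose F x := limn (h ^~ x).
have mF : measurable_fun setT F.
  by apply: (@measurable_fun_cvg _ _ _ _ h) => // x _; exact: ch.
have fF : {ae mu, forall x, f ^~ x @ \oo --> F x}.
  exists N; split => // x /=; apply: contra_notP => xN.
  rewrite (_ : f ^~ x = h ^~ x); first exact: ch.
  by apply/funext => n; rewrite /h indicE mem_set ?mulr1.
have FB m : (\int[mu]_x ((F x - f m x) ^+ 2)%:E <= (4^-1 ^+ m)%:E)%E.
  exact: (fatou_sqr mf (mf m) mF fF (fm m)).
exists F => //.
have F0 : (fun x => F x - f 0%N x) \in Lfun mu 2%:E.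
  by apply: Lfun2P; [exact: measurable_funB|apply: le_lt_trans (FB 0%N) _; exact: ltry].
rewrite (_ : F = fun x => (F x - f 0%N x) + f 0%N x); first exact: Lfun2D.
by apply/funext => x; rewrite subrK.
Qed.

Lemma repr_L2_sub (u v : L2 mu) : u - v = \pi_(L2 mu) (repr u - repr v).
Proof. by rewrite raddfB /= !reprK. Qed.

Lemma sqr_rnorm_bounds (u v : L2 mu) (B : R) : rnorm (u - v) ^+ 2 <= B ->
  (\int[mu]_x (((Re \o repr u) x - (Re \o repr v) x) ^+ 2)%:E <= B%:E)%E /\
  (\int[mu]_x (((Im \o repr u) x - (Im \o repr v) x) ^+ 2)%:E <= B%:E)%E.
Proof.
rewrite repr_L2_sub -lee_fin sqr_rnorm_pi => uvB.
split; apply: le_trans uvB.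
- rewrite [leLHS](_ : _ = \int[mu]_x (Re ((repr u - repr v) x) ^+ 2)%:E)%E.
    by rewrite leeDl//; apply: integral_ge0 => x _; rewrite lee_fin sqr_ge0.
  by apply: eq_integral => x _; rewrite -[(repr u - repr v) x]/(repr u x - repr v x) raddfB.
- rewrite [leLHS](_ : _ = \int[mu]_x (Im ((repr u - repr v) x) ^+ 2)%:E)%E.
    by rewrite leeDr//; apply: integral_ge0 => x _; rewrite lee_fin sqr_ge0.
  by apply: eq_integral => x _; rewrite -[(repr u - repr v) x]/(repr u x - repr v x) raddfB.
Qed.

Lemma L2_complete (u : nat -> L2 mu) :
  (forall e : R, 0 < e -> exists N, forall m n, (N <= m)%N -> (N <= n)%N ->
    rnorm (u m - u n) <= e) ->
  exists v : L2 mu, forall e : R, 0 < e -> exists N, forall n, (N <= n)%N ->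
    rnorm (u n - v) <= e.
Proof.
move=> uC.
have e0 k : 0 < (2^-1 : R) ^+ k by rewrite exprn_gt0.
have [Nk NkP] := choice (fun k => uC _ (e0 k)).
(* A sum of the moduli of convergence rather than the modulus itself, so that [phi] is nondecreasing
   and still dominates [Nk]. *)
pose phi k := (\sum_(i < k.+1) Nk i)%N.
have Nphi k : (Nk k <= phi k)%N by rewrite /phi big_ord_recr leq_addl.
have phile m n : (m <= n)%N -> (phi m <= phi n)%N.
  move=> mn; rewrite /phi -!(big_mkord xpredT).
  by rewrite (@big_cat_nat _ _ _ m.+1 0 n.+1) //= leq_addr.
have uphi m n : (phi m <= n)%N -> rnorm (u n - u (phi m)) <= 2^-1 ^+ m.
  by move=> mn; apply: NkP; [exact: leq_trans mn|].
pose f k : L2fun mu := repr (u (phi k)).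
have B m n : (m <= n)%N -> rnorm (u (phi n) - u (phi m)) ^+ 2 <= 4^-1 ^+ m.
  move=> mn; rewrite (_ : (4^-1 : R) = 2^-1 ^+ 2); last by rewrite expr2; lra.
  by rewrite exprAC ler_pXn2r ?nnegrE ?rnorm_ge0 ?exprn_ge0//; exact/uphi/phile.
have [F1 F12 F1B] : exists2 F, F \in Lfun mu 2%:E &
    forall m, (\int[mu]_x ((F x - (Re \o f m) x) ^+ 2)%:E <= (4^-1 ^+ m)%:E)%E.
  apply: Lfun2_limit => [n|m n /B /sqr_rnorm_bounds[]//].
  by have /andP[] := L2funP (f n).
have [F2 F22 F2B] : exists2 F, F \in Lfun mu 2%:E &
    forall m, (\int[mu]_x ((F x - (Im \o f m) x) ^+ 2)%:E <= (4^-1 ^+ m)%:E)%E.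
  apply: Lfun2_limit => [n|m n /B /sqr_rnorm_bounds[]//].
  by have /andP[] := L2funP (f n).
have FP : (fun x => F1 x +i* F2 x) \in cLfun mu 2%:E by apply/andP.
pose F := Build_L2fun FP.
exists (\pi_(L2 mu) F) => e e_gt0.
have vB m : rnorm (\pi_(L2 mu) F - u (phi m)) <= 2 * 2^-1 ^+ m.
  rewrite -(@ler_pXn2r _ 2)// ?nnegrE ?rnorm_ge0 ?mulr_ge0 ?exprn_ge0//.
  rewrite -[u _]reprK -raddfB -lee_fin sqr_rnorm_pi.
  rewrite (_ : ((2 * 2^-1 ^+ m) ^+ 2)%:E = (2 * 4^-1 ^+ m)%:E + (2 * 4^-1 ^+ m)%:E)%E; last first.
    rewrite -EFinD exprMn -exprM mulnC exprM (_ : (2^-1 : R) ^+ 2 = 4^-1); last by rewrite expr2; lra.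
    by congr EFin; lra.
  have h0 : ((4^-1 ^+ m)%:E <= (2 * (4^-1 : R) ^+ m)%:E)%E.
    by rewrite lee_fin ler_peMl ?exprn_ge0//; lra.
  apply: leeD.
  - apply: le_trans h0; apply: le_trans (F1B m).
    by rewrite le_eqVlt; apply/orP; left; apply/eqP; apply: eq_integral => x _;
      rewrite -[(F - f m) x]/(F x - f m x) raddfB.
  - apply: le_trans h0; apply: le_trans (F2B m).
    by rewrite le_eqVlt; apply/orP; left; apply/eqP; apply: eq_integral => x _;
      rewrite -[(F - f m) x]/(F x - f m x) raddfB.
have [m mP] := half_expn_small (divr_gt0 e_gt0 (ltr0n R 3)).
exists (phi m) => n mn.
rewrite -(subrK (u (phi m)) (u n)) -addrA.
apply: le_trans (rnormD _ _) _; have := uphi _ _ mn; have := vB m; rewrite rnormBC.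
by move: (rnorm _) (rnorm _) => *; lra.
Qed.
End riesz_fischer.

(** * Integration on the circle *)

Section circle_integral.
Context (R : realType).
Local Notation Re := (@complex.Re R).
Local Notation Im := (@complex.Im R).
Local Notation leb := (@lebesgue_measure R).

Lemma bounded_integrable (f : R -> R) (M : R) : measurable_fun setT f ->
  (forall t, `|f t| <= M) -> (circle_measure R).-integrable setT (EFin \o f).
Proof.
move=> mf fM; apply: measurable_bounded_integrable => //.
  by rewrite (le_lt_trans (probability_le1 _ _)) ?ltry.
exists M; split; first exact: num_real.
by move=> N MN x _; apply: le_trans (fM x) (ltW MN).
Qed.

Lemma bounded_integrable_itv (f : R -> R) (M a b : R) : measurable_fun setT f ->
  (forall t, `|f t| <= M) -> leb.-integrable `[a, b] (EFin \o f).
Proof.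
move=> mf fM; apply: measurable_bounded_integrable.
- exact: measurable_itv.
- by rewrite /= lebesgue_measure_itv /=; case: ifP => _; rewrite ?ltry.
- exact: measurable_funTS.
exists M; split; first exact: num_real.
by move=> N MN x _; apply: le_trans (fM x) (ltW MN).
Qed.

Lemma circle_RintegralE (f : R -> R) (M : R) : measurable_fun setT f ->
  (forall t, `|f t| <= M) ->
  \int[circle_measure R]_x f x = (2 * pi)^-1 * \int[leb]_(x in `[0, 2 * pi]) f x.
Proof.
move=> mf fM; have p0 := pi2_gt0 R.
have iM : (circle_measure R).-integrable setT (EFin \o cst M).
  by apply: (@bounded_integrable _ `|M|) => // t; exact: measurable_cst.
have iM' : leb.-integrable `[0, 2 * pi] (EFin \o cst M).
  by apply: (@bounded_integrable_itv _ `|M|) => // t; exact: measurable_cst.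
have fM0 x : (0 <= (f x + M)%:E)%E.
  by rewrite lee_fin; have := fM x; rewrite ler_norml => /andP[]; lra.
(* The passage to Lebesgue measure is made for the nonnegative function [f x + M]; the constant is
   cancelled at the end. *)
have : \int[circle_measure R]_x (f x + M) =
    (2 * pi)^-1 * \int[leb]_(x in `[0, 2 * pi]) (f x + M).
  rewrite /Rintegral integral_uniform//; last first.
    by apply/measurable_EFinP/measurable_funD => //; exact: measurable_cst.
  rewrite fineM ?subr0//.
  apply: integrable_fin_num => //.
  have iD : leb.-integrable `[0, 2 * pi] ((EFin \o f) \+ (EFin \o cst M))%E.
    by apply: integrableD => //; exact: bounded_integrable_itv fM.
  by apply: eq_integrable iD.
rewrite RintegralD//; last exact: bounded_integrable fM.
rewrite RintegralD//; last exact: bounded_integrable_itv fM.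
rewrite !Rintegral_cst// mulrDr.
have -> : fine ((circle_measure R : set _ -> \bar R) setT) = 1.
  by rewrite (@probability_setT _ _ _ (circle_measure R)).
rewrite /= lebesgue_measure_itv/= lte_fin p0 -EFinD /= subr0.
rewrite [X in _ = _ + X](_ : _ = M); last by rewrite mulrCA mulVf ?mulr1// gt_eqF.
by rewrite mulr1; exact: addIr.
Qed.

(** One-sided limits at the end points suffice, since [F] minus the primitive of [f] is constant
    inside by the mean value theorem. This matters for the symbols below, whose phase has a
    logarithmic singularity at both ends. *)
Lemma circle_FTC (F f : R -> R) (M a b : R) : measurable_fun setT f ->
  (forall t, `|f t| <= M) ->
  (forall t, 0 < t < 2 * pi -> is_derive t 1 F (f t) /\ {for t, continuous f}) ->
  F x @[x --> 0^'+] --> a -> F x @[x --> (2 * pi)^'-] --> b ->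
  \int[circle_measure R]_x f x = (b - a) / (2 * pi).
Proof.
move=> mf fM dF Fa Fb; have p0 := pi2_gt0 R.
rewrite (circle_RintegralE mf fM) mulrC; congr (_ / _).
have intf := bounded_integrable_itv 0 (2 * pi) mf fM.
pose G x := \int[leb]_(t in `[0, x]) f t.
have dH t : 0 < t < 2 * pi -> is_derive t 1 (F \- G) 0.
  move=> t02; have [dFt ct] := dF t t02; have /andP[t0 t2] := t02.
  have [dG dGE] := continuous_FTC1_closed t2 intf t0 ct.
  have dGt : is_derive t 1 G (f t) by apply: (DeriveDef dG); rewrite -derive1E; exact: dGE.
  by have := is_deriveB dFt dGt; rewrite subrr.
have ppi : 0 < (pi : R) < 2 * pi by have := pi_gt0 R; move=> *; apply/andP; split; lra.
have cH x y : 0 < x < 2 * pi -> 0 < y < 2 * pi -> x < y -> F x - G x = F y - G y.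
  move=> x0 y0 xy.
  have sub z : z \in `[x, y] -> 0 < z < 2 * pi.
    by rewrite in_itv/= => /andP[? ?]; apply/andP; split; lra.
  have [| |z zxy] := @MVT _ (F \- G) (fun=> 0) x y xy.
  - by move=> z zxy; apply/dH/sub; exact: subset_itv_oo_cc zxy.
  - apply: derivable_within_continuous => z zxy.
    by have := dH z (sub z zxy) => -[].
  - by rewrite mul0r => /eqP; rewrite subr_eq0 => /eqP /esym.
have HE x : 0 < x < 2 * pi -> F x - G x = F pi - G pi.
  move=> x0; have [xp|xp|->//] := ltgtP x pi; first exact: cH.
  by apply/esym/cH.
have G0 : G x @[x --> 0^'+] --> 0.
  by apply: cvg_at_right_filter; exact: (parameterized_integral_cvg_left p0 intf).
have G1 : G x @[x --> (2 * pi)^'-] --> G (2 * pi).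
  exact: (parameterized_integral_cvg_at_left p0 intf).
have e1 : F pi - G pi = a - 0.
  have c : F x - G x @[x --> 0^'+] --> a - 0 by exact: cvgB.
  apply: (cvg_unique _ _ c) => //; apply: cvg_near_cst; near=> x.
  by apply/HE/andP; split.
have e2 : F pi - G pi = b - G (2 * pi).
  have c : F x - G x @[x --> (2 * pi)^'-] --> b - G (2 * pi) by exact: cvgB.
  apply: (cvg_unique _ _ c) => //; apply: cvg_near_cst; near=> x.
  by apply/HE/andP; split.
by move: e1 e2; rewrite -/(G (2 * pi)); lra.
Unshelve. all: by end_near. Qed.
End circle_integral.

(** * Orthonormality of the monomials *)

Section fourier_basis.
Context (R : realType).
Local Notation Re := (@complex.Re R).
Local Notation Im := (@complex.Im R).
Local Notation mu := (circle_measure R).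
Local Notation L2T := (L2 mu).
Implicit Types (u v w : L2T) (f g h : H2 R).

Lemma expiD (a b : R) : expi (a + b) = expi a * expi b.
Proof.
rewrite /expi cosD sinD; apply/eqP; rewrite eq_complex /=.
by apply/andP; split; apply/eqP; ring.
Qed.

Lemma expi0 : expi (0 : R) = 1.
Proof. by rewrite /expi cos0 sin0. Qed.

Lemma expiN (a : R) : expi (- a) = (expi a)^*.
Proof. by rewrite /expi cosN sinN; apply/eqP; rewrite eq_complex /= !eqxx. Qed.

Lemma expi_norm (a : R) : rnorm (expi a) = 1.
Proof.
apply/eqP; rewrite -(@eqrXn2 _ 2) ?rnorm_ge0//.
by rewrite cnormE2 /= cos2Dsin2 expr1n.
Qed.

Lemma expi_mul_conj (t : R) (k j : nat) :
  expi t ^+ k * (expi t ^+ j)^* = expi ((k%:R - j%:R) * t).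
Proof. by rewrite !expiX -expiN -expiD -mulNr -mulrDl. Qed.

Lemma expi_2pi_nat (n : nat) : expi (n%:R * (2 * pi)) = 1 :> R[i].
Proof.
rewrite -expiX (_ : expi (2 * pi) = 1) ?expr1n//.
by rewrite /expi mulrC mulr_natr cos2pi sin2pi.
Qed.

Lemma cos_sin_bound (x : R) : (`|cos x| <= 1) /\ (`|sin x| <= 1).
Proof. by rewrite cos_max ler_norml sin_geN1 sin_le1. Qed.

Lemma cintegral_expi (nu : R) : nu != 0 -> expi (nu * (2 * pi)) = 1 ->
  cintegral mu (fun t => expi (nu * t)) = 0.
Proof.
move=> nu0 [c1 s0].
have dm (t : R) : is_derive t 1 (fun t : R => nu * t) nu.
  by have := is_deriveZ nu (is_derive_id t (1 : R)); rewrite /GRing.scale /= mulr1.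
have cm : continuous (fun t : R => nu * t) by exact: mulrl_continuous.
have cc : continuous (fun t => cos (nu * t)).
  by move=> t; apply: (@continuous_comp _ _ _ (fun t : R => nu * t)); [exact: cm|exact: continuous_cos].
have cs : continuous (fun t => sin (nu * t)).
  by move=> t; apply: (@continuous_comp _ _ _ (fun t : R => nu * t)); [exact: cm|exact: continuous_sin].
rewrite /cintegral /expi /=.
rewrite (@circle_FTC _ (fun t => nu^-1 * sin (nu * t)) _ 1 0 0); first last.
- apply: cvg_at_left_filter; rewrite [X in _ --> X](_ : _ = nu^-1 * sin (nu * (2 * pi)));
  last by rewrite s0 mulr0.
  by apply: cvgMr; exact: cs.
- apply: cvg_at_right_filter; rewrite [X in _ --> X](_ : _ = nu^-1 * sin (nu * 0));
  last by rewrite mulr0 sin0 mulr0.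
  by apply: cvgMr; exact: cs.
- move=> t _; split; last exact: cc.
  have := is_deriveZ nu^-1 (is_derive1_comp (is_derive_sin (nu * t)) (dm t)).
  by rewrite /GRing.scale /= [_ * nu]mulrC mulrA mulVf// mul1r.
- by move=> t; have [] := cos_sin_bound (nu * t).
- exact: continuous_measurable_fun.
rewrite (@circle_FTC _ (fun t => - nu^-1 * cos (nu * t)) _ 1 (- nu^-1) (- nu^-1)); first last.
- apply: cvg_at_left_filter; rewrite [X in _ --> X](_ : _ = - nu^-1 * cos (nu * (2 * pi)));
  last by rewrite c1 mulr1.
  by apply: cvgMr; exact: cc.
- apply: cvg_at_right_filter; rewrite [X in _ --> X](_ : _ = - nu^-1 * cos (nu * 0));
  last by rewrite mulr0 cos0 mulr1.
  by apply: cvgMr; exact: cc.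
- move=> t _; split; last exact: cs.
  have := is_deriveZ (- nu^-1) (is_derive1_comp (is_derive_cos (nu * t)) (dm t)).
  rewrite /GRing.scale /= (_ : - nu^-1 * (- sin (nu * t) * nu) = sin (nu * t))//.
  by field.
- by move=> t; have [] := cos_sin_bound (nu * t).
- exact: continuous_measurable_fun.
by rewrite !subrr !mul0r.
Qed.

Lemma L2monomial_orthonormal (m n : nat) :
  L2dot (L2monomial R m) (L2monomial R n) = (m == n)%:R.
Proof.
rewrite L2dot_pi /L2fun_dot /=.
rewrite (_ : (fun x => _) = fun t => expi ((m%:R - n%:R) * t)); last first.
  by apply/funext => t; rewrite expi_mul_conj.
have [->|mn] := eqVneq m n.
  rewrite (_ : (fun x => _) = cst 1); last first.
    by apply/funext => t; rewrite subrr mul0r expi0.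
  rewrite /cintegral /=; apply/eqP; rewrite eq_complex /=; apply/andP.
  rewrite !Rintegral_cst//.
  have -> : fine ((mu : set _ -> \bar R) setT) = 1.
    by rewrite (@probability_setT _ _ _ mu).
  by rewrite mul1r mul0r !eqxx.
apply: cintegral_expi; first by rewrite subr_eq0 eqr_nat.
by rewrite mulrBl expiD expiN !expi_2pi_nat rmorph1 mulr1.
Qed.
End fourier_basis.

(** * Elementary estimates for sine, cosine and the complex exponential *)

Section trigonometric_bounds.
Context (R : realType).
Implicit Types x y : R.

Lemma abs_sin_le x : `|sin x| <= `|x|.
Proof.
wlog x0 : x / 0 <= x.
  move=> h; have [/h//|/ltW x0] := leP 0 x.
  by rewrite -normrN -sinN -[leRHS]normrN h ?oppr_ge0.
have [| c _] := @MVT_segment R sin cos 0 x x0 (fun z _ => is_derive_sin z).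
  exact/continuous_subspaceT/continuous_sin.
rewrite sin0 !subr0 => ->; rewrite normrM ler_piMl//; exact: cos_max.
Qed.

Lemma one_minus_cosE x : 1 - cos x = 2 * sin (x / 2) ^+ 2.
Proof.
rewrite {1}(_ : x = (x / 2) *+ 2); last by rewrite mulr2n; lra.
by rewrite cos_mulr2n cos2sin2; lra.
Qed.

Lemma one_minus_cos_le x : 1 - cos x <= x ^+ 2.
Proof.
rewrite one_minus_cosE -real_normK ?num_real// -[x ^+ 2]real_normK ?num_real//.
have := abs_sin_le (x / 2); rewrite normrM [`|2^-1|]ger0_norm//.
have := normr_ge0 (sin (x / 2)); have := normr_ge0 x; nra.
Qed.

Lemma one_minus_cos_le_abs x : 1 - cos x <= `|x|.
Proof.
rewrite one_minus_cosE -real_normK ?num_real//.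
have := abs_sin_le (x / 2); rewrite normrM [`|2^-1|]ger0_norm//.
have h : `|sin (x / 2)| <= 1 by rewrite ler_norml sin_geN1 sin_le1.
have := normr_ge0 (sin (x / 2)); have := normr_ge0 x; nra.
Qed.

Lemma abs_sin_sub_le x : `|sin x - x| <= x ^+ 2.
Proof.
wlog x0 : x / 0 <= x.
  move=> h; have [/h//|/ltW x0] := leP 0 x.
  have := h (- x); rewrite sinN opprK addrC -opprB normrN sqrrN; apply.
  by rewrite oppr_ge0.
have dd (z : R) : is_derive z 1 (fun z : R => sin z - z) (cos z - 1).
  exact: (is_deriveB (is_derive_sin z) (is_derive_id z (1 : R))).
have [| c /itvP cI] := @MVT_segment R (fun z => sin z - z) (fun z => cos z - 1) 0 x x0 (fun z _ => dd z).
  apply/continuous_subspaceT => z.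
  by apply/differentiable_continuous/derivable1_diffP; have [] := dd z.
rewrite sin0 !subr0 => ->; rewrite normrM (ger0_norm x0) expr2 ler_wpM2r//.
rewrite distrC ger0_norm ?subr_ge0 ?cos_le1//.
by apply: le_trans (one_minus_cos_le_abs c) _; rewrite ger0_norm cI.
Qed.

Lemma rnorm_le_abs (z : R[i]) : rnorm z <= `|complex.Re z| + `|complex.Im z|.
Proof.
rewrite -(@ler_pXn2r _ 2) ?nnegrE ?rnorm_ge0 ?addr_ge0// cnormE2.
rewrite -(real_normK (num_real (complex.Re z))) -(real_normK (num_real (complex.Im z))).
have := normr_ge0 (complex.Re z); have := normr_ge0 (complex.Im z).
by nra.
Qed.

Lemma rnorm_expi_sub1 x : rnorm (expi x - 1) <= `|x|.
Proof.
rewrite -(@ler_pXn2r _ 2) ?nnegrE ?rnorm_ge0// cnormE2 /= subr0.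
have -> : (cos x - 1) ^+ 2 + sin x ^+ 2 = 2 * (1 - cos x).
  by rewrite sin2cos2; ring.
rewrite one_minus_cosE -[sin _ ^+ 2]real_normK ?num_real//.
have := abs_sin_le (x / 2); rewrite normrM [`|2^-1|]ger0_norm//.
have := normr_ge0 (sin (x / 2)); have := normr_ge0 x; nra.
Qed.

(** A quadratic remainder is summable at [x = a / (n + 1)]; this is what makes the phase-corrected
    partial sums converge later. *)
Lemma rnorm_expi_sub_linear x : rnorm (expi x - (1 +i* x)) <= 2 * x ^+ 2.
Proof.
apply: le_trans (rnorm_le_abs _) _ => /=.
rewrite [X in _ <= X](_ : _ = x ^+ 2 + x ^+ 2); last by ring.
apply: lerD (abs_sin_sub_le x).
by rewrite distrC ger0_norm ?subr_ge0 ?cos_le1// one_minus_cos_le.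
Qed.
End trigonometric_bounds.

(** * The Hardy space and its projection *)

Section hilbert.
Context (R : realType).
Local Notation Re := (@complex.Re R).
Local Notation Im := (@complex.Im R).
Local Notation mu := (circle_measure R).
Local Notation L2T := (L2 mu).
Local Notation e := (L2monomial R).
Implicit Types (u v w : L2T) (f g h : H2 R).

Lemma rnorm_L2dot u v : rnorm (L2dot u v) <= rnorm u * rnorm v.
Proof.
rewrite -lecR rmorphM/= -!rnormE.
exact: (dot_CauchySchwarz (L2dot (R:=R) (mu:=mu)) u v).
Qed.

Lemma rnorm_sqr_L2 u : (rnorm u ^+ 2)%:C = L2dot u u.
Proof. by rewrite -L2norm_sqr rnormE -rmorphXn. Qed.

Lemma rnorm_H2 f : rnorm f = rnorm (val f).
Proof. by []. Qed.

Lemma L2dot_sum (N : nat) (x y : nat -> R[i]) :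
  L2dot (\sum_(k < N) x k *: e k) (\sum_(j < N) y j *: e j) =
  \sum_(k < N) x k * (y k)^*.
Proof.
rewrite linear_sumlz; apply: eq_bigr => k _; rewrite linearZl_LR /= linear_sumr.
congr (_ * _); rewrite (bigD1 k)//= linearZr_LR /= L2monomial_orthonormal eqxx mulr1.
rewrite big1 ?addr0// => j jk; rewrite linearZr_LR /= L2monomial_orthonormal.
by rewrite eq_sym -val_eqE in jk; rewrite (negbTE jk) mulr0.
Qed.

Lemma L2dot_suml (N : nat) (x : nat -> R[i]) j :
  L2dot (\sum_(k < N) x k *: e k) (e j) = if (j < N)%N then x j else 0.
Proof.
rewrite linear_sumlz /=; case: ifPn => jN.
  rewrite (bigD1 (Ordinal jN))//= linearZl_LR /= L2monomial_orthonormal eqxx mulr1.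
  rewrite big1 ?addr0// => k; rewrite -val_eqE /= => kj.
  by rewrite linearZl_LR /= L2monomial_orthonormal (negbTE kj) mulr0.
rewrite big1// => k _; rewrite linearZl_LR /= L2monomial_orthonormal.
by rewrite ltn_eqF ?mulr0// (leq_trans (ltn_ord k)) // leqNgt.
Qed.

Lemma rnorm_sqr_sum (N : nat) (x : nat -> R[i]) :
  rnorm (\sum_(k < N) x k *: e k) ^+ 2 = \sum_(k < N) rnorm (x k) ^+ 2.
Proof.
apply/complexI; rewrite rnorm_sqr_L2 L2dot_sum rmorph_sum/=; apply: eq_bigr => k _.
by rewrite -normCK rnormE -rmorphXn.
Qed.

Lemma pythagoras u v : L2dot u v = 0 ->
  rnorm (u + v) ^+ 2 = rnorm u ^+ 2 + rnorm v ^+ 2.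
Proof.
move=> uv; apply/complexI; rewrite rmorphD/= !rnorm_sqr_L2 hnormDd//.
Qed.

Lemma hardyP u : reflect (forall r : R, 0 < r ->
    exists2 p, analytic_polynomials p & rnorm (u - p) <= r) (u \in @hardy R).
Proof.
apply: (iffP idP); rewrite inE.
- move=> uH r r0.
  have rC : 0 < r%:C by rewrite ltcR.
  have [p [pP /=]] := uH _ (nbhsx_ballx u (r%:C) rC).
  rewrite -ball_normE /= => up; exists p => //; apply/ltW.
  by rewrite -ltcR -rnormE.
- move=> uP B /nbhs_ballP[r /= r0 rB].
  have rE : r = (Re r)%:C by move: r0; case: r {rB} => a b; rewrite ltcE /= => /andP[/eqP ->].
  have r0' : 0 < Re r by rewrite -ltcR -rE.
  have [|p pP up] := uP (Re r / 2); first by rewrite divr_gt0.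
  exists p; split => //; apply: rB; rewrite -ball_normE /= rE rnormE ltcR.
  by apply: le_lt_trans up _; rewrite ltr_pdivrMr// mulr_natr mulr2n ltrDl.
Qed.

Lemma small_eq0 (a b : R) : 0 <= b -> (forall r, 0 < r -> a <= b * r) -> a <= 0.
Proof.
move=> b0 h; rewrite leNgt; apply/negP => a0.
have := h (a / (2 * (b + 1))); rewrite divr_gt0 ?mulr_gt0 ?ltr_wpDl// => /(_ isT).
have b1 : 0 < b + 1 by lra.
rewrite mulrA ler_pdivlMr ?mulr_gt0//; nra.
Qed.

Lemma rnorm_le0 (z : R[i]) : rnorm z <= 0 -> z = 0.
Proof. by move=> z0; apply/rnorm_eq0/eqP; rewrite eq_le z0 rnorm_ge0. Qed.

Lemma dot_hardy_eq0 u : (forall k, L2dot u (e k) = 0) ->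
  forall h, L2dot u (val h) = 0.
Proof.
move=> ue h; apply: rnorm_le0.
apply: (@small_eq0 _ (rnorm u)); first exact: rnorm_ge0.
move=> r r0; have [p [N [c pE]] hp] := (hardyP (val h) (H2P h)) r r0.
have -> : L2dot u (val h) = L2dot u (val h - p).
  rewrite linearBr /= [L2dot u p](_ : _ = 0) ?subr0// pE linear_sumr big1// => k _.
  by rewrite linearZr_LR /= ue mulr0.
by apply: le_trans (rnorm_L2dot _ _) _; rewrite ler_wpM2l ?rnorm_ge0.
Qed.

Lemma bessel u N : \sum_(k < N) rnorm (L2dot u (e k)) ^+ 2 <= rnorm u ^+ 2.
Proof.
pose S := \sum_(k < N) L2dot u (e k) *: e k.
have uS : L2dot (u - S) S = 0.
  rewrite {2}/S linear_sumr big1// => k _; rewrite linearZr_LR /= linearBl /=.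
  by rewrite (L2dot_suml N (fun k => L2dot u (e k))) ltn_ord subrr mulr0.
by rewrite -{2}(subrK S u) pythagoras// (rnorm_sqr_sum N (fun k => L2dot u (e k))) lerDr sqr_ge0.
Qed.

(** The partial Fourier sums of [u] are Cauchy by Bessel's inequality and converge by completeness;
    the limit lies in the closed space [H2], and orthogonality to the monomials extends to [H2] by
    density. *)
Lemma hardy_projP u h : L2dot (u - val (hardy_proj u)) (val h) = 0.
Proof.
move: h; apply: (@xgetPex _ 0 [set g : H2 R | forall h : H2 R, L2dot (u - val g) (val h) = 0]).
pose c k := L2dot u (e k).
pose S N := \sum_(k < N) c k *: e k.
pose Tn N := \sum_(k < N) rnorm (c k) ^+ 2.
have STE m n : (m <= n)%N -> rnorm (S n - S m) ^+ 2 = Tn n - Tn m.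
  move=> mn; have -> : S n - S m = \sum_(k < n) (if (k < m)%N then 0 else c k) *: e k.
    rewrite /S (big_ord_widen n (fun k => c k *: e k) mn) [in X in _ - X]big_mkcond/= -sumrB.
    by apply: eq_bigr => k _; case: ifP => _; rewrite ?subrr ?scale0r ?subr0.
  rewrite (rnorm_sqr_sum n (fun k => if (k < m)%N then 0 else c k)).
  rewrite /Tn (big_ord_widen n (fun k => rnorm (c k) ^+ 2) mn) [in X in _ - X]big_mkcond/= -sumrB.
  by apply: eq_bigr => k _; case: ifP => _; rewrite ?subrr ?rnorm0 ?expr0n ?subr0.
have SC r : 0 < r -> exists N, forall m n, (N <= m)%N -> (N <= n)%N -> rnorm (S m - S n) <= r.
  move=> r0.
  have hs : has_sup (range Tn).
    split; first by exists (Tn 0%N), 0%N.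
    by exists (rnorm u ^+ 2) => _ [N _ <-]; exact: bessel.
  have [_ [N _ <-] TN] := sup_adherent (exprn_gt0 2 (divr_gt0 r0 (ltr0n R 2))) hs.
  have SN m : (N <= m)%N -> rnorm (S m - S N) <= r / 2.
    move=> Nm; rewrite -(@ler_pXn2r _ 2)// ?nnegrE ?rnorm_ge0 ?divr_ge0 ?(ltW r0)//.
    rewrite STE//; have : Tn m <= sup (range Tn) by apply: ub_le_sup; [exact: hs.2|exists m].
    by move: (sup _) TN => s; lra.
  exists N => m n Nm Nn; rewrite -(subrK (S N) (S m)) -addrA.
  apply: le_trans (rnormD _ _) _; rewrite [leRHS](_ : r = r / 2 + r / 2); last by lra.
  by apply: lerD; [exact: SN|rewrite rnormBC; exact: SN].
have [v vP] := L2_complete SC.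
have vH : v \in @hardy R.
  apply/hardyP => r r0; have [N NP] := vP r r0.
  by exists (S N); [exists N, c|rewrite rnormBC; exact: NP].
exists (Build_H2 vH); apply: dot_hardy_eq0 => k /=.
apply: rnorm_le0.
apply: (@small_eq0 _ (rnorm (e k))); first exact: rnorm_ge0.
move=> r r0; have [N NP] := vP r r0.
(* Past [k] the partial sum has the same k-th coefficient as [u], so that only [S M - v] remains,
   which is small because [N <= M]. *)
pose M := maxn N k.+1.
rewrite -(subrK (S M) u) -addrA linearDl /= linearBl /= (L2dot_suml M c) leq_maxr subrr add0r.
apply: le_trans (rnorm_L2dot _ _) _; rewrite mulrC ler_wpM2l ?rnorm_ge0//.
by apply: NP; exact: leq_maxl.
Qed.
End hilbert.

(** * Toeplitz operators *)

Section toeplitz_operators.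
Context (R : realType).
Local Notation Re := (@complex.Re R).
Local Notation Im := (@complex.Im R).
Local Notation mu := (circle_measure R).
Local Notation L2T := (L2 mu).
Local Notation e := (H2monomial R).
Implicit Types (u v w : L2T) (f g h : H2 R) (b : Linfty mu).

Lemma H2dot_ext f g : (forall k, H2dot f (e k) = H2dot g (e k)) -> f = g.
Proof.
move=> fg; apply/eqP; rewrite -subr_eq0 -(dnorm_eq0 (H2dot (R:=R))); apply/eqP.
rewrite /H2dot /=; apply: dot_hardy_eq0 => k.
by have := fg k; rewrite /H2dot /= linearBl /= => ->; rewrite subrr.
Qed.

Lemma toeplitzE b f h : H2dot (toeplitz b f) h = L2dot (L2mul b (val f)) (val h).
Proof.
by apply/esym/eqP; rewrite -subr_eq0 /H2dot -linearBl /= hardy_projP.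
Qed.

Lemma L2mul_linear b : linear (L2mul b).
Proof.
move=> a; elim/quotW => f; elim/quotW => g.
rewrite -linearP !L2mul_pi -linearP; congr \pi; apply/val_inj/funext => x /=.
by change (b x * (a * f x + g x) = a * (b x * f x) + b x * g x); ring.
Qed.

Lemma toeplitz_linear b : linear (toeplitz b).
Proof.
move=> a f g; apply: H2dot_ext => k.
rewrite toeplitzE [RHS]linearDl linearZl_LR /= (toeplitzE b f) (toeplitzE b g).
by rewrite -linearZl_LR -linearDl -L2mul_linear.
Qed.

Lemma sqr_rnorm_piE (f : L2fun mu) :
  ((rnorm (\pi_(L2 mu) f) ^+ 2)%:E = \int[mu]_x ((rnorm (f x) ^+ 2)%:E))%E.
Proof.
rewrite sqr_rnorm_pi; have /andP[f1 f2] := L2funP f.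
have i1 := Lfun2_integrable_sqr f1; have i2 := Lfun2_integrable_sqr f2.
rewrite -(integralD measurableT i1 i2).
by apply: eq_integral => x _; rewrite /= -EFinD cnormE2.
Qed.

Lemma measurable_rnorm_sqr (f : L2fun mu) :
  measurable_fun setT (fun x => (rnorm (f x) ^+ 2)%:E).
Proof.
have /andP[/Lfun2_measurable f1 /Lfun2_measurable f2] := L2funP f.
have := measurable_funD (measurable_funX 2 f1) (measurable_funX 2 f2).
move=> /measurable_EFinP; congr measurable_fun; apply/funext => x /=.
by rewrite cnormE2.
Qed.

Lemma Linfty_rnorm_bounded b : exists2 M : R, 0 <= M & {ae mu, forall x, rnorm (b x) <= M}.
Proof.
have /andP[/Linfty_bounded[M1 M10 b1] /Linfty_bounded[M2 M20 b2]] := LinftyP b.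
exists (M1 + M2); first exact: addr_ge0.
apply: filterS2 b1 b2 => x /= b1 b2.
rewrite -(@ler_pXn2r _ 2) ?nnegrE ?rnorm_ge0 ?addr_ge0//.
rewrite cnormE2 -(real_normK (num_real (Re _))) -(real_normK (num_real (Im _))).
have := normr_ge0 (Re (b x)); have := normr_ge0 (Im (b x)).
by nra.
Qed.

Lemma L2mul_bounded b : exists2 M : R, 0 <= M & forall u, rnorm (L2mul b u) <= M * rnorm u.
Proof.
have [M M0 bM] := Linfty_rnorm_bounded b; exists M => //; elim/quotW => f.
rewrite L2mul_pi -(@ler_pXn2r _ 2) ?nnegrE ?mulr_ge0 ?rnorm_ge0//.
rewrite exprMn -lee_fin [(M ^+ 2 * _)%:E]EFinM !sqr_rnorm_piE -ge0_integralZl_EFin ?sqr_ge0//;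
  first last.
- exact: measurable_rnorm_sqr.
- by move=> x _; rewrite lee_fin sqr_ge0.
apply: ae_ge0_le_integral => //.
- by move=> x _; rewrite lee_fin sqr_ge0.
- exact: (measurable_rnorm_sqr (Build_L2fun (Linfty_mul_L2 b f))).
- by move=> x _; rewrite -EFinM lee_fin mulr_ge0 ?sqr_ge0.
- by apply: emeasurable_funM; [exact: measurable_cst|exact: measurable_rnorm_sqr].
apply: filterS bM => x bM _; rewrite -EFinM lee_fin /= cnormM exprMn.
by rewrite ler_wpM2r ?sqr_ge0// ler_pXn2r ?nnegrE ?rnorm_ge0.
Qed.

Lemma rnorm_sqr_H2 f : (rnorm f ^+ 2)%:C = H2dot f f.
Proof. by rewrite rnorm_H2 rnorm_sqr_L2. Qed.

Lemma rnorm_H2dot f g : rnorm (H2dot f g) <= rnorm f * rnorm g.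
Proof. exact: rnorm_L2dot. Qed.

Lemma boundedP (A : H2 R -> H2 R) : linear A ->
  (exists2 M : R, 0 <= M & forall f, rnorm (A f) <= M * rnorm f) <-> bounded_operator A.
Proof.
move=> lA; split=> [[M M0 AM]|[_ [M AM]]].
  by split=> //; exists M => f; rewrite !rnormE -rmorphM lecR.
exists `|M| => // f; apply: le_trans (_ : M * rnorm f <= _).
  by rewrite -lecR rmorphM/= -!rnormE.
by rewrite ler_wpM2r ?rnorm_ge0 ?ler_norm.
Qed.

Lemma toeplitz_bounded b : bounded_operator (toeplitz b).
Proof.
apply/boundedP; first exact: toeplitz_linear.
have [M M0 bM] := L2mul_bounded b; exists M => // f.
have [->|T0] := eqVneq (rnorm (toeplitz b f)) 0; first by rewrite mulr_ge0 ?rnorm_ge0.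
have Tp : 0 < rnorm (toeplitz b f) by rewrite lt_def T0 rnorm_ge0.
rewrite -(ler_pM2r Tp) -expr2.
have -> : rnorm (toeplitz b f) ^+ 2 = rnorm (H2dot (toeplitz b f) (toeplitz b f)).
  by rewrite -rnorm_sqr_H2 cnorm_real ger0_norm ?sqr_ge0.
rewrite toeplitzE; apply: le_trans (rnorm_L2dot _ _) _.
by rewrite ler_wpM2r ?rnorm_ge0.
Qed.

Lemma conj_Linfty b : (fun x => Num.conj (b x)) \in cLfun mu +oo.
Proof.
have /andP[b1 b2] := LinftyP b; apply/andP; split.
  by rewrite (_ : _ \o _ = Re \o b)//; apply/funext => x /=; case: (b x).
rewrite (_ : _ \o _ = - (Im \o b)) ?rpredN//.
by apply/funext => x /=; rewrite -[(- _) x]/(- Im (b x)); case: (b x).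
Qed.

Definition Linfty_conj b : Linfty mu := Build_Linfty (conj_Linfty b).

Lemma L2mul_adj b u v : L2dot (L2mul b u) v = L2dot u (L2mul (Linfty_conj b) v).
Proof.
elim/quotW: u => f; elim/quotW: v => g; rewrite !L2mul_pi !L2dot_pi /L2fun_dot /=.
congr cintegral; apply/funext => x; rewrite rmorphM.
by rewrite /= conjCK mulrCA mulrA.
Qed.

Lemma toeplitz_adj b f g :
  H2dot (toeplitz b f) g = H2dot f (toeplitz (Linfty_conj b) g).
Proof.
rewrite toeplitzE L2mul_adj -[RHS]/(H2dot _ _).
rewrite [RHS](H2dot_conj) mul1r toeplitzE.
by rewrite L2dot_conj mul1r.
Qed.

Lemma toeplitz_entry b k j :
  H2dot (toeplitz b (e k)) (e j) =
  cintegral mu (fun t => b t * expi ((k%:R - j%:R) * t)).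
Proof.
rewrite toeplitzE /= L2mul_pi L2dot_pi /L2fun_dot /=.
by congr cintegral; apply/funext => t; rewrite -mulrA expi_mul_conj.
Qed.
End toeplitz_operators.

(** * Finite matrices in the ideal *)

Section toeplitz_algebra_theory.
Context (R : realType).
Local Notation T := (toeplitz_algebra R).
Implicit Types A B : H2 R -> H2 R.

Lemma toeplitz_in_algebra b : T (toeplitz b).
Proof. by move=> S [_]; apply; exists b. Qed.

Lemma toeplitz_algebra0 : T (fun=> 0).
Proof. by move=> S [/cstar0]. Qed.

Lemma toeplitz_algebraD A B : T A -> T B -> T (A \+ B).
Proof. by move=> TA TB S SP; apply: (cstarD SP.1); [exact: TA|exact: TB]. Qed.

Lemma toeplitz_algebraZ (c : R[i]) A : T A -> T (fun u => c *: A u).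
Proof. by move=> TA S SP; apply: (cstarZ SP.1); exact: TA. Qed.

Lemma toeplitz_algebraM A B : T A -> T B -> T (A \o B).
Proof. by move=> TA TB S SP; apply: (cstarM SP.1); [exact: TA|exact: TB]. Qed.

Lemma toeplitz_algebra_closed : norm_closed T.
Proof.
move=> A bA AP S SP; apply: (cstar_closed SP.1) => // r r0.
by have [B TB AB] := AP r r0; exists B => //; exact: TB.
Qed.

Lemma toeplitz_algebra_commutator A B : T A -> T B -> T ((A \o B) \- (B \o A)).
Proof.
move=> TA TB.
rewrite (_ : _ \- _ = (A \o B) \+ (fun u => (-1) *: (B \o A) u)).
  by apply: toeplitz_algebraD; [|apply: toeplitz_algebraZ]; exact: toeplitz_algebraM.
by apply/funext => u /=; rewrite scaleN1r.
Qed.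

(** The algebra is itself one of the closed ideals that are intersected. *)
Lemma commutator_ideal_sub : toeplitz_commutator_ideal R `<=` T.
Proof.
move=> A; apply; split; last exact: toeplitz_algebra_commutator.
split => //.
- exact: toeplitz_algebra0.
- exact: toeplitz_algebraD.
- exact: toeplitz_algebraZ.
- exact: toeplitz_algebraM.
- exact: toeplitz_algebraM.
- exact: toeplitz_algebra_closed.
Qed.
End toeplitz_algebra_theory.

Section shift.
Context (R : realType).
Local Notation mu := (circle_measure R).
Local Notation e := (H2monomial R).
Implicit Types f g : H2 R.

Lemma H2dot_monomial j k : H2dot (e j) (e k) = (j == k)%:R.
Proof. by rewrite /H2dot /= L2monomial_orthonormal. Qed.

Definition zsym : Linfty mu := Build_Linfty (expiX_Linfty R 1).
Definition shift := toeplitz zsym.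
Definition bshift := toeplitz (Linfty_conj zsym).

Lemma shift_monomial k : shift (e k) = e k.+1.
Proof.
apply: H2dot_ext => j; rewrite toeplitzE /H2dot /=; congr L2dot.
rewrite L2mul_pi; congr \pi; apply/val_inj/funext => t /=.
by rewrite expr1 -exprS.
Qed.

Lemma bshift_adj f g : H2dot (bshift f) g = H2dot f (shift g).
Proof. by rewrite H2dot_conj mul1r -toeplitz_adj -[in RHS]/(H2dot _ _) [RHS]H2dot_conj mul1r. Qed.

Lemma bshift_coef f j : H2dot (bshift f) (e j) = H2dot f (e j.+1).
Proof. by rewrite bshift_adj shift_monomial. Qed.

Lemma bshift_monomial0 : bshift (e 0%N) = 0.
Proof. by apply: H2dot_ext => j; rewrite bshift_coef H2dot_monomial linear0l. Qed.

Lemma bshift_monomialS k : bshift (e k.+1) = e k.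
Proof. by apply: H2dot_ext => j; rewrite bshift_coef !H2dot_monomial eqSS. Qed.

Lemma shift_coef f j : H2dot (shift f) (e j) = if j is i.+1 then H2dot f (e i) else 0.
Proof.
rewrite toeplitz_adj -/bshift; case: j => [|i]; last by rewrite bshift_monomialS.
by rewrite bshift_monomial0 linear0r.
Qed.

(** Collects the properties that the ideal argument uses, so that the symbols and their integrals
    stay hidden. *)
Lemma shift_pair : exists S S' : H2 R -> H2 R,
  [/\ toeplitz_algebra R S, toeplitz_algebra R S', linear S,
      (forall k, S (e k) = e k.+1) &
      (forall f j, H2dot (S' f) (e j) = H2dot f (e j.+1)) /\
      (forall f j, H2dot (S f) (e j) = if j is i.+1 then H2dot f (e i) else 0)].
Proof.
exists shift, bshift; split.
- exact: toeplitz_in_algebra.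
- exact: toeplitz_in_algebra.
- exact: toeplitz_linear.
- exact: shift_monomial.
- by split; [exact: bshift_coef|exact: shift_coef].
Qed.

Definition rank_one j k f : H2 R := H2dot f (e k) *: e j.

Lemma rank_one_dot j k f g : H2dot (rank_one j k f) g = H2dot f (e k) * H2dot (e j) g.
Proof. by rewrite /rank_one linearZl_LR. Qed.

Lemma rank_one_comp (A : H2 R -> H2 R) j k : linear A -> forall f,
  A (rank_one j k f) = H2dot f (e k) *: A (e j).
Proof.
move=> lA f; have A0 : A 0 = 0.
  by have := lA 0 0 0; rewrite !scale0r !add0r => h; have := lA (-1) 0 0;
    rewrite scaler0 addr0 scaleN1r addNr.
by have := lA (H2dot f (e k)) (e j) 0; rewrite !addr0 A0 addr0.
Qed.

Lemma linear_rank_one j k : linear (rank_one j k).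
Proof.
move=> c f g; rewrite /rank_one linearDl linearZl_LR /=.
by rewrite scalerDl scalerA.
Qed.

Context (J : set (H2 R -> H2 R)).
Hypothesis J_ideal : closed_ideal (toeplitz_algebra R) J.
Hypothesis J_comm : forall A B, toeplitz_algebra R A -> toeplitz_algebra R B ->
  J ((A \o B) \- (B \o A)).

(** The commutator of the backward shift and the shift is the projection on the constants, which is
    the case 0, 0. Multiplying by the shift on the left raises [j]; multiplying by the backward
    shift on the right raises [k]. *)
Lemma ideal_rank_one j k : J (rank_one j k).
Proof.
have [S [S' [TS TS' lS Se [S'c Sc]]]] := shift_pair.
elim: j k => [|j IH] => [k|k]; last first.
  rewrite (_ : rank_one j.+1 k = S \o rank_one j k).
    exact: (Defs.idealMl J_ideal).
  by apply/funext => f; rewrite /comp (rank_one_comp _ _ lS) Se.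
elim: k => [|k IH]; last first.
  rewrite (_ : rank_one 0%N k.+1 = rank_one 0%N k \o S').
    exact: (Defs.idealMr J_ideal IH TS').
  by apply/funext => f; rewrite /comp /rank_one S'c.
rewrite (_ : rank_one 0%N 0%N = (S' \o S) \- (S \o S')); first exact: J_comm.
apply/funext => f; apply: H2dot_ext => j; rewrite [LHS]rank_one_dot H2dot_monomial.
have -> : H2dot (((S' \o S) \- (S \o S')) f) (e j) =
    H2dot (S' (S f)) (e j) - H2dot (S (S' f)) (e j) by rewrite -linearBl.
by rewrite S'c !Sc; case: j => [|i]; rewrite ?subr0 ?mulr1// S'c subrr mulr0.
Qed.

Lemma ideal_sum (I : Type) (r : seq I) (F : I -> H2 R -> H2 R) :
  (forall i, J (F i)) -> J (fun f => \sum_(i <- r) F i f).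
Proof.
move=> JF; elim: r => [|i r IH].
  rewrite (_ : (fun=> _) = fun=> 0); first exact: (ideal0 J_ideal).
  by apply/funext => f; rewrite big_nil.
rewrite (_ : (fun=> _) = F i \+ (fun f => \sum_(i <- r) F i f)).
  by apply: (idealD J_ideal).
by apply/funext => f; rewrite big_cons.
Qed.

Definition finite_matrix N (a : nat -> nat -> R[i]) f : H2 R :=
  \sum_(j < N) \sum_(k < N) a j k *: rank_one j k f.

Lemma ideal_finite_matrix N a : J (finite_matrix N a).
Proof.
apply: ideal_sum => j; apply: ideal_sum => k.
apply: (idealZ J_ideal); exact: ideal_rank_one.
Qed.

Lemma finite_matrix_entry N a j k : H2dot (finite_matrix N a (e k)) (e j) =
  if (j < N)%N && (k < N)%N then a j k else 0.
Proof.
rewrite /finite_matrix linear_sumlz.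
under eq_bigr => j' _ do rewrite linear_sumlz /=.
have E (j' k' : 'I_N) : H2dot (a j' k' *: rank_one j' k' (e k)) (e j) =
    a j' k' * ((k == k')%:R * (j' == j :> nat)%:R).
  by rewrite linearZl_LR /= rank_one_dot !H2dot_monomial.
under eq_bigr => j' _ do under eq_bigr => k' _ do rewrite E.
case: ifPn => [/andP[jN kN]|].
  rewrite (bigD1 (Ordinal jN))//= (bigD1 (Ordinal kN))//= !eqxx !mulr1.
  rewrite big1 ?addr0; last first.
    by move=> k'; rewrite -val_eqE /= eq_sym => /negbTE ->; rewrite mul0r mulr0.
  rewrite big1 ?addr0// => j'; rewrite -val_eqE /= => /negbTE ->.
  by rewrite big1// => k' _; rewrite !mulr0.
rewrite negb_and => jkN; apply: big1 => j' _; apply: big1 => k' _.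
case/orP: jkN; rewrite -leqNgt => le; [rewrite (ltn_eqF (leq_trans (ltn_ord j') le))|].
  by rewrite !mulr0.
by rewrite gtn_eqF ?mul0r ?mulr0// (leq_trans (ltn_ord k')).
Qed.

End shift.

(** * Norm bounds from matrix entries *)

Section kernel_forms.
Context (R : realType).
Implicit Types (a b : nat -> nat -> R) (x y : nat -> R).

Definition l2sum (N : nat) x : R := Num.sqrt (\sum_(k < N) x k ^+ 2).

(** Finite sections are tested on nonnegative vectors: such bounds are monotone in the kernel, and
    they pass to bounded operators whose entries are dominated in modulus by [a]. *)
Definition form_bound a (M : R) := forall N x y,
  (forall k, 0 <= x k) -> (forall k, 0 <= y k) ->
  \sum_(j < N) \sum_(k < N) a j k * x k * y j <= M * (l2sum N x * l2sum N y).

Lemma l2sum_ge0 N x : 0 <= l2sum N x.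
Proof. exact: sqrtr_ge0. Qed.

Lemma sqr_l2sum N x : l2sum N x ^+ 2 = \sum_(k < N) x k ^+ 2.
Proof. by rewrite sqr_sqrtr// sumr_ge0// => k _; exact: sqr_ge0. Qed.

Lemma form_boundD a b (M K : R) : form_bound a M -> form_bound b K ->
  form_bound (fun j k => a j k + b j k) (M + K).
Proof.
move=> aM bK N x y x0 y0; rewrite mulrDl.
apply: le_trans (lerD (aM N x y x0 y0) (bK N x y x0 y0)).
rewrite -big_split/=; apply: ler_sum => j _; rewrite -big_split/=; apply: ler_sum => k _.
by rewrite !mulrDl.
Qed.

Lemma form_boundZ a (M c : R) : 0 <= c -> form_bound a M ->
  form_bound (fun j k => c * a j k) (c * M).
Proof.
move=> c0 aM N x y x0 y0; rewrite -mulrA; apply: le_trans (ler_wpM2l c0 (aM N x y x0 y0)).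
rewrite mulr_sumr; apply: ler_sum => j _; rewrite mulr_sumr; apply: ler_sum => k _.
by rewrite !mulrA.
Qed.

Lemma form_bound_le a b (M K : R) : (forall j k, a j k <= b j k) -> M <= K ->
  form_bound b M -> form_bound a K.
Proof.
move=> ab MK bM N x y x0 y0.
apply: le_trans (_ : M * (l2sum N x * l2sum N y) <= _); last first.
  by rewrite ler_wpM2r// mulr_ge0// l2sum_ge0.
apply: le_trans (bM N x y x0 y0); apply: ler_sum => j _; apply: ler_sum => k _.
by rewrite !ler_wpM2r.
Qed.

Lemma form_boundT a M : form_bound a M -> form_bound (fun j k => a k j) M.
Proof.
move=> aM N x y x0 y0; rewrite exchange_big/= (mulrC (l2sum N x)).
apply: le_trans (aM N y x y0 x0); apply: ler_sum => j _; apply: ler_sum => k _.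
by rewrite mulrAC.
Qed.

Lemma cauchy_schwarz_sum (I : finType) (f g : I -> R) :
  (\sum_i f i * g i) ^+ 2 <= (\sum_i f i ^+ 2) * (\sum_i g i ^+ 2).
Proof.
set A := \sum_i f i ^+ 2; set B := \sum_i g i ^+ 2; set P := \sum_i f i * g i.
have A0 : 0 <= A by apply: sumr_ge0 => i _; exact: sqr_ge0.
have h (s t : R) : 0 <= s ^+ 2 * A - 2 * s * t * P + t ^+ 2 * B.
  rewrite (_ : _ + _ = \sum_i (s * f i - t * g i) ^+ 2); first by apply: sumr_ge0 => i _; exact: sqr_ge0.
  rewrite /A /B /P !mulr_sumr -sumrB -big_split/=; apply: eq_bigr => i _.
  by ring.
have [A_0|A_0] := eqVneq A 0.
  have [->|P0] := eqVneq P 0; first by rewrite A_0 mul0r expr0n.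
  (* When A = 0 the form at t = 1 is [B - 2 s P], and this [s] makes it equal to -1. *)
  have := h ((B + 1) / (2 * P)) 1; rewrite A_0.
  rewrite (_ : _ + _ = -1) ?oppr_ge0 ?ler10// -/P; field.
  by rewrite P0.
have Ap : 0 < A by rewrite lt_def A_0.
have := h P A.
rewrite (_ : _ + _ = A * (A * B - P ^+ 2)); last by ring.
by rewrite pmulr_rge0// subr_ge0.
Qed.

Lemma form_bound_HS a (M : R) : 0 <= M ->
  (forall N, \sum_(j < N) \sum_(k < N) a j k ^+ 2 <= M ^+ 2) -> form_bound a M.
Proof.
move=> M0 aM N x y x0 y0.
apply: le_trans (ler_norm _) _.
rewrite -(@ler_pXn2r _ 2)// ?nnegrE ?mulr_ge0 ?l2sum_ge0//.
rewrite real_normK ?num_real// !exprMn !sqr_l2sum.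
rewrite pair_big/=; under eq_bigr => p _ do rewrite -mulrA.
apply: le_trans (cauchy_schwarz_sum _ _) _; apply: ler_pM => //.
- by apply: sumr_ge0 => p _; exact: sqr_ge0.
- by apply: sumr_ge0 => p _; exact: sqr_ge0.
- by rewrite -(pair_bigA _ (fun j k : 'I_N => a j k ^+ 2)); exact: aM.
rewrite -(pair_bigA _ (fun j k : 'I_N => (x k * y j) ^+ 2))/= exchange_big/= mulr_suml.
apply: ler_sum => k _; rewrite mulr_sumr; apply: ler_sum => j _.
by rewrite exprMn.
Qed.

(** Each product x_k y_j is split by the arithmetic-geometric mean inequality, weighted by the ratio
    of the two norms. As the norms may vanish, strictly positive upper bounds [s] and [t] stand in
    for them and are then let down to the norms. *)
Lemma form_bound_schur a (M : R) : (forall j k, 0 <= a j k) ->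
  (forall N j, \sum_(k < N) a j k <= M) -> (forall N k, \sum_(j < N) a j k <= M) ->
  form_bound a M.
Proof.
move=> a0 aM aM' N x y x0 y0.
have M0 : 0 <= M by have := aM 0%N 0%N; rewrite big_ord0.
have key (s t : R) : 0 < s -> 0 < t -> l2sum N x <= s -> l2sum N y <= t ->
    \sum_(j < N) \sum_(k < N) a j k * x k * y j <= M * (s * t).
  move=> s0 t0 xs yt.
  have h : \sum_(j < N) \sum_(k < N) a j k * x k * y j <=
      t / (2 * s) * (\sum_(k < N) \sum_(j < N) a j k * x k ^+ 2)
      + s / (2 * t) * (\sum_(j < N) \sum_(k < N) a j k * y j ^+ 2).
    rewrite [X in _ / _ * X + _]exchange_big/= !mulr_sumr -big_split/=.
    apply: ler_sum => j _; rewrite !mulr_sumr -big_split/=; apply: ler_sum => k _.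
    rewrite -mulrA !(mulrCA _ (a j k)) -mulrDr ler_wpM2l//.
    rewrite -subr_ge0 (_ : _ - _ = (2 * s * t)^-1 * (t * x k - s * y j) ^+ 2).
      by rewrite mulr_ge0 ?sqr_ge0// invr_ge0 !mulr_ge0 ?ltW.
    by field; rewrite !gt_eqF.
  apply: le_trans h _.
  have h1 : \sum_(k < N) \sum_(j < N) a j k * x k ^+ 2 <= M * s ^+ 2.
    apply: le_trans (_ : M * (\sum_(k < N) x k ^+ 2) <= _).
      by rewrite mulr_sumr; apply: ler_sum => k _; rewrite -mulr_suml ler_wpM2r ?sqr_ge0// aM'.
    by rewrite ler_wpM2l// -sqr_l2sum ler_pXn2r ?nnegrE ?l2sum_ge0 ?(ltW s0) ?(ltW t0).
  have h2 : \sum_(j < N) \sum_(k < N) a j k * y j ^+ 2 <= M * t ^+ 2.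
    apply: le_trans (_ : M * (\sum_(j < N) y j ^+ 2) <= _).
      by rewrite mulr_sumr; apply: ler_sum => k _; rewrite -mulr_suml ler_wpM2r ?sqr_ge0// aM.
    by rewrite ler_wpM2l// -sqr_l2sum ler_pXn2r ?nnegrE ?l2sum_ge0 ?(ltW s0) ?(ltW t0).
  have s2 : 0 <= t / (2 * s) by rewrite divr_ge0 ?mulr_ge0 ?ltW.
  have t2 : 0 <= s / (2 * t) by rewrite divr_ge0 ?mulr_ge0 ?ltW.
  apply: le_trans (lerD (ler_wpM2l s2 h1) (ler_wpM2l t2 h2)) _.
  rewrite le_eqVlt; apply/orP; left; apply/eqP; field; rewrite !gt_eqF//.
apply/ler_addgt0Pl => r r0.
have X0 := l2sum_ge0 N x; have Y0 := l2sum_ge0 N y.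
move: key; set X := l2sum N x; set Y := l2sum N y => key.
pose d := Num.min 1 (r / (M * (X + Y + 1) + 1)).
have den : 0 < M * (X + Y + 1) + 1 by rewrite ltr_wpDl// mulr_ge0// !addr_ge0.
have d0 : 0 < d by rewrite lt_min ltr01 divr_gt0.
have d1 : d <= 1 by rewrite ge_min lexx.
have d2 : d * (M * (X + Y + 1) + 1) <= r by rewrite -ler_pdivlMr// ge_min lexx orbT.
have XX : X <= X + d by rewrite lerDl ltW.
have YY : Y <= Y + d by rewrite lerDl ltW.
apply: le_trans (key (X + d) (Y + d) (ltr_wpDl X0 d0) (ltr_wpDl Y0 d0) XX YY) _.
have -> : M * ((X + d) * (Y + d)) = M * (X * Y) + d * (M * (X + Y + d)) by ring.
rewrite addrC lerD2r; apply: le_trans d2; rewrite ler_wpM2l ?(ltW d0)//.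
by apply: (@le_trans _ _ (M * (X + Y + 1))); rewrite ?lerDl// ler_wpM2l// lerD2l.
Qed.

End kernel_forms.

Section operator_kernels.
Context (R : realType).
Local Notation e := (H2monomial R).
Implicit Types (f g h : H2 R) (A B : H2 R -> H2 R) (x y : nat -> R[i]).

Definition entry A j k : R[i] := H2dot (A (e k)) (e j).

Definition hsum N x : H2 R := \sum_(k < N) x k *: e k.

Lemma val_hsum N x : val (hsum N x) = \sum_(k < N) x k *: L2monomial R k.
Proof. by rewrite /hsum raddf_sum; apply: eq_bigr. Qed.

Lemma rnorm_hsum N x : rnorm (hsum N x) = l2sum N (fun k => rnorm (x k)).
Proof.
apply/eqP; rewrite -(@eqrXn2 _ 2) ?rnorm_ge0 ?l2sum_ge0//.
by rewrite rnorm_H2 val_hsum rnorm_sqr_sum sqr_l2sum.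
Qed.

Lemma hsum_dense f (r : R) : 0 < r -> exists N x, rnorm (f - hsum N x) <= r.
Proof.
move=> r0; have [p [N [c pE]] fp] := (hardyP (val f) (H2P f)) r r0.
by exists N, c; rewrite rnorm_H2 raddfB/= val_hsum -pE.
Qed.

Lemma linear_hsum A N x : linear A -> A (hsum N x) = \sum_(k < N) x k *: A (e k).
Proof.
move=> lA; have A0 : A 0 = 0.
  by have := lA (-1) 0 0; rewrite scaler0 addr0 scaleN1r addNr.
elim: N => [|N IH]; first by rewrite /hsum !big_ord0.
rewrite /hsum !big_ord_recr /= -/(hsum N x) [LHS](_ : _ = A (x N *: e N + hsum N x)).
  by rewrite lA IH addrC.
by rewrite addrC.
Qed.

Lemma dot_hsum A N x y : linear A ->
  H2dot (A (hsum N x)) (hsum N y) =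
  \sum_(j < N) \sum_(k < N) entry A j k * x k * (y j)^*.
Proof.
move=> lA; rewrite (linear_hsum _ _ lA) {1}/hsum linear_sumr; apply: eq_bigr => j _.
rewrite linearZr_LR /= linear_sumlz mulr_sumr; apply: eq_bigr => k _.
by rewrite linearZl_LR /= /entry mulrC (mulrC (x k)).
Qed.

(** The form bound gives the estimate on finite sums of monomials. The a priori bound [K] of [A]
    carries it to limits in the first argument, and then [A f] itself is approximated in the
    second. *)
Lemma rnorm_le_form A (a : nat -> nat -> R) (M : R) : bounded_operator A ->
  (forall j k, rnorm (entry A j k) <= a j k) -> 0 <= M -> form_bound a M ->
  forall f, rnorm (A f) <= M * rnorm f.
Proof.
move=> bA Aa M0 aM.
have lA := bA.1; have [K K0 AK] := (boundedP lA).2 bA.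
have h N x y : rnorm (H2dot (A (hsum N x)) (hsum N y)) <= M * (rnorm (hsum N x) * rnorm (hsum N y)).
  rewrite (dot_hsum _ _ _ lA) !rnorm_hsum.
  apply: le_trans (aM N _ _ (fun k => rnorm_ge0 (x k)) (fun k => rnorm_ge0 (y k))).
  apply: le_trans (rnorm_sum _ _ _) _; apply: ler_sum => j _.
  apply: le_trans (rnorm_sum _ _ _) _; apply: ler_sum => k _.
  rewrite !cnormM cnorm_conj; do 2 (apply: ler_wpM2r; first exact: rnorm_ge0).
  exact: Aa.
have pad N N' x : (N <= N')%N -> hsum N x = hsum N' (fun k => if (k < N)%N then x k else 0).
  move=> NN'; rewrite /hsum (big_ord_widen N' (fun k => x k *: e k) NN') big_mkcond/=.
  by apply: eq_bigr => k _; case: ifP => // _; rewrite scale0r.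
have h2 N N' x y : rnorm (H2dot (A (hsum N x)) (hsum N' y)) <= M * (rnorm (hsum N x) * rnorm
  (hsum N' y)).
  by rewrite (pad N (maxn N N')) ?leq_maxl// (pad N' (maxn N N')) ?leq_maxr.
have lim (p q c : R) : 0 <= c -> (forall r, 0 < r -> r <= 1 -> p <= q + c * r) -> p <= q.
  move=> c0 hr; rewrite leNgt; apply/negP => qp.
  pose r := Num.min 1 ((p - q) / (2 * (c + 1))).
  have c1 : 0 < 2 * (c + 1) by lra.
  have r0 : 0 < r by rewrite lt_min ltr01 divr_gt0 ?subr_gt0.
  have := hr r r0; rewrite ge_min lexx => /(_ isT).
  have : r * (2 * (c + 1)) <= p - q by rewrite -ler_pdivlMr// ge_min lexx orbT.
  by nra.
have h3 f N' y : rnorm (H2dot (A f) (hsum N' y)) <= M * (rnorm f * rnorm (hsum N' y)).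
  set g := hsum N' y; have G0 := rnorm_ge0 g.
  apply: (lim _ _ ((K + M) * rnorm g)); first by rewrite mulr_ge0// addr_ge0.
  move=> r r0 r1; have [N [x fx]] := hsum_dense f r0.
  have AE : A f = A (f - hsum N x) + A (hsum N x).
    by have := lA 1 (f - hsum N x) (hsum N x); rewrite !scale1r subrK.
  rewrite AE linearDl /=; apply: le_trans (rnormD _ _) _.
  have e1 : rnorm (H2dot (A (f - hsum N x)) g) <= K * r * rnorm g.
    apply: le_trans (rnorm_H2dot _ _) _; rewrite ler_wpM2r//.
    by apply: le_trans (AK _) _; rewrite ler_wpM2l.
  have e2 : rnorm (hsum N x) <= rnorm f + r.
    rewrite -[hsum N x](subKr f); apply: le_trans (rnormD _ _) _.
    by rewrite rnormN lerD2l.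
  have e3 := h2 N N' x y; rewrite -/g in e3.
  have e4 : M * (rnorm (hsum N x) * rnorm g) <= M * ((rnorm f + r) * rnorm g).
    by rewrite ler_wpM2l// ler_wpM2r.
  move: e1 (le_trans e3 e4); move: (rnorm (H2dot _ _)) (rnorm (H2dot _ _)) => p q.
  by nra.
move=> f; have F0 := rnorm_ge0 f.
have key : rnorm (A f) ^+ 2 <= M * (rnorm f * rnorm (A f)).
  set g := A f; have G0 := rnorm_ge0 g.
  apply: (lim _ _ (rnorm g + M * rnorm f)); first by rewrite addr_ge0// mulr_ge0.
  move=> r r0 r1; have [N [x gx]] := hsum_dense g r0.
  have -> : rnorm g ^+ 2 = rnorm (H2dot g g).
    by rewrite -rnorm_sqr_H2 cnorm_real ger0_norm ?sqr_ge0.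
  have -> : H2dot g g = H2dot g (g - hsum N x) + H2dot g (hsum N x).
    by rewrite -linearDr subrK.
  apply: le_trans (rnormD _ _) _.
  have e1 : rnorm (H2dot g (g - hsum N x)) <= rnorm g * r.
    by apply: le_trans (rnorm_H2dot _ _) _; rewrite ler_wpM2l.
  have e2 : rnorm (hsum N x) <= rnorm g + r.
    rewrite -[hsum N x](subKr g); apply: le_trans (rnormD _ _) _.
    by rewrite rnormN lerD2l.
  have e3 := h3 f N x; rewrite -/g in e3.
  have e4 : M * (rnorm f * rnorm (hsum N x)) <= M * (rnorm f * (rnorm g + r)).
    by rewrite ler_wpM2l// ler_wpM2l.
  move: e1 (le_trans e3 e4); move: (rnorm (H2dot _ _)) (rnorm (H2dot _ _)) => p q.
  by nra.
have [->|A0] := eqVneq (rnorm (A f)) 0; first by rewrite mulr_ge0.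
have Ap : 0 < rnorm (A f) by rewrite lt_def A0 rnorm_ge0.
by rewrite -(ler_pM2r Ap) -expr2 -mulrA.
Qed.

Lemma opnorm_le A (M : R) : 0 <= M -> (forall f, rnorm (A f) <= M * rnorm f) ->
  opnorm A <= M.
Proof.
move=> M0 AM; apply: ge_sup.
  by exists (rnorm (A 0)), 0 => //=; rewrite normr0 ler01.
move=> _ [f /= f1 <-]; rewrite -/(rnorm _); apply: le_trans (AM f) _.
rewrite ler_piMr// -lecR -rnormE.
by rewrite (le_trans f1).
Qed.

Lemma bounded_operatorB A B : bounded_operator A -> bounded_operator B ->
  bounded_operator (A \- B).
Proof.
move=> bA bB; have lA := bA.1; have lB := bB.1.
have lAB : linear (A \- B).
  by move=> c f g /=; rewrite lA lB scalerBr opprD addrACA.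
have [M M0 AM] := (boundedP lA).2 bA; have [K K0 BK] := (boundedP lB).2 bB.
apply/boundedP => //; exists (M + K); first exact: addr_ge0.
move=> f; rewrite mulrDl; apply: le_trans (rnormD _ _) _.
by rewrite rnormN lerD.
Qed.

Lemma bounded_operatorD A B : bounded_operator A -> bounded_operator B ->
  bounded_operator (A \+ B).
Proof.
move=> bA bB; have lA := bA.1; have lB := bB.1.
have lAB : linear (A \+ B).
  by move=> c f g /=; rewrite lA lB scalerDr addrACA.
have [M M0 AM] := (boundedP lA).2 bA; have [K K0 BK] := (boundedP lB).2 bB.
apply/boundedP => //; exists (M + K); first exact: addr_ge0.
move=> f; rewrite mulrDl; apply: le_trans (rnormD _ _) _.
by rewrite lerD.
Qed.

Lemma bounded_operatorZ (c : R[i]) A : bounded_operator A ->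
  bounded_operator (fun f => c *: A f).
Proof.
move=> bA; have lA := bA.1; have [M M0 AM] := (boundedP lA).2 bA.
apply/boundedP.
  by move=> d f g; rewrite lA scalerDr !scalerA mulrC.
exists (rnorm c * M); first by rewrite mulr_ge0// rnorm_ge0.
by move=> f; rewrite rnormZ -mulrA ler_wpM2l// rnorm_ge0.
Qed.

Lemma bounded_operatorM A B : bounded_operator A -> bounded_operator B ->
  bounded_operator (A \o B).
Proof.
move=> bA bB; have lA := bA.1; have lB := bB.1.
have [M M0 AM] := (boundedP lA).2 bA; have [K K0 BK] := (boundedP lB).2 bB.
apply/boundedP; first by move=> c f g /=; rewrite lB lA.
exists (M * K); first exact: mulr_ge0.
by move=> f; apply: le_trans (AM _) _; rewrite -mulrA ler_wpM2l.
Qed.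

Lemma bounded_rank_one j k : bounded_operator (rank_one (R:=R) j k).
Proof.
apply/boundedP; first exact: linear_rank_one.
exists (rnorm (e k) * rnorm (e j)); first by rewrite mulr_ge0// rnorm_ge0.
move=> f; rewrite /rank_one rnormZ mulrAC ler_wpM2r ?rnorm_ge0// [leRHS]mulrC.
exact: rnorm_H2dot.
Qed.

Lemma bounded_finite_matrix N a : bounded_operator (finite_matrix (R:=R) N a).
Proof.
have b0 : bounded_operator (fun _ : H2 R => 0 : H2 R).
  apply/boundedP; first by move=> c f g; rewrite scaler0 addr0.
  by exists 0 => // f; rewrite rnorm0 mul0r.
have bs (I : Type) (r : seq I) (F : I -> H2 R -> H2 R) :
    (forall i, bounded_operator (F i)) -> bounded_operator (fun f => \sum_(i <- r) F i f).
  move=> bF; elim: r => [|i r IH].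
    by rewrite (_ : (fun=> _) = fun=> 0)//; apply/funext => f; rewrite big_nil.
  rewrite (_ : (fun=> _) = F i \+ (fun f => \sum_(i <- r) F i f)).
    exact: bounded_operatorD.
  by apply/funext => f; rewrite big_cons.
by apply: (bs) => j; apply: (bs) => k; apply: bounded_operatorZ; exact: bounded_rank_one.
Qed.

End operator_kernels.

(** * Hilbert-Schmidt errors *)

Section error_kernel.
Context (R : realType).

(* Square summable, so that an operator with entries dominated by rho is Hilbert-Schmidt. *)
Definition rho (j k : nat) : R :=
  ((maxn j k - minn j k).+1%:R * (minn j k).+1%:R)^-1.

Lemma rho_ge0 j k : 0 <= rho j k.
Proof. by rewrite invr_ge0 mulr_ge0. Qed.

Let q (n : nat) : R := n.+1%:R^-1 ^+ 2.

Lemma sum_inv_sqr N : \sum_(n < N) q n <= 2.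
Proof.
(* For N + 1 terms the induction runs on the sharper bound 2 - 1 / (N + 1), hence the separate
   treatment of the empty sum. *)
case: N => [|N]; first by rewrite big_ord0.
apply: (@le_trans _ _ (2 - N.+1%:R^-1)); last by rewrite gerBl invr_ge0.
elim: N => [|N IH].
  by rewrite big_ord1 /q invr1 expr1n; lra.
rewrite big_ord_recr /=; apply: le_trans (lerD IH (lexx _)) _.
rewrite /q -subr_ge0.
rewrite (_ : _ - _ = (N.+1%:R * N.+2%:R ^+ 2)^-1).
  by rewrite invr_ge0 mulr_ge0 ?exprn_ge0.
have h : N.+2%:R = N.+1%:R + 1 :> R by rewrite -natr1.
have n0 : N.+1%:R != 0 :> R by rewrite pnatr_eq0.
have n1 : N.+2%:R != 0 :> R by rewrite pnatr_eq0.
by rewrite h in n1 *; move: (N.+1%:R) n0 n1 => x x0 x1; field; rewrite x0 x1.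
Qed.

Let q_ge0 n : 0 <= q n. Proof. exact: sqr_ge0. Qed.

Lemma sum_shifted_inv_sqr N k : \sum_(j < N | (k <= j)%N) q (j - k) <= 2.
Proof.
have [kN|Nk] := leqP k N; last first.
  rewrite big_pred0// => j; apply/negbTE; rewrite -ltnNge.
  exact: leq_trans (ltn_ord j) (ltnW Nk).
have -> : \sum_(j < N | (k <= j)%N) q (j - k) = \sum_(i < N - k) q i.
  rewrite -(big_mkord (fun j => (k <= j)%N) (fun j => q (j - k))).
  rewrite (@big_cat_nat _ _ _ k 0 N)//= big_nat_cond big_pred0 ?add0r; last first.
    by move=> j; apply/negbTE; rewrite -andbA negb_and; case: ltnP => //=; rewrite orbC.
  rewrite big_nat_cond (eq_bigl (fun j => (k <= j < N)%N && true)); last first.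
    by move=> j; rewrite andbT; case: (k <= j)%N; rewrite ?andbF ?andbT.
  rewrite -big_nat_cond -{1}[k]add0n big_addn big_mkord.
  by apply: eq_bigr => i _; rewrite addnK.
exact: sum_inv_sqr.
Qed.

Lemma sum_rho_sqr N : \sum_(j < N) \sum_(k < N) rho j k ^+ 2 <= 8.
Proof.
have h N' : \sum_(k < N') \sum_(j < N' | (k <= j)%N) q (j - k) * q k <= 4.
  apply: le_trans (_ : \sum_(k < N') 2 * q k <= _).
    by apply: ler_sum => k _; rewrite -mulr_suml ler_wpM2r// sum_shifted_inv_sqr.
  by rewrite -mulr_sumr; have := sum_inv_sqr N'; lra.
(* Both triangles contain the diagonal, which only enlarges the sum; each contributes at most 2 *
   2. *)
apply: le_trans (_ : \sum_(k < N) \sum_(j < N | (k <= j)%N) q (j - k) * q k +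
    \sum_(k < N) \sum_(j < N | (k <= j)%N) q (j - k) * q k <= _); last first.
  by have := h N; lra.
under [X in _ <= X + _]eq_bigr do rewrite big_mkcond/=.
under [X in _ <= _ + X]eq_bigr do rewrite big_mkcond/=.
rewrite [X in _ <= X + _]exchange_big/= -big_split/=; apply: ler_sum => j _.
rewrite -big_split/=; apply: ler_sum => k _.
rewrite /rho /q; case: (leqP j k) => jk.
  rewrite invfM exprMn; case: ifP => _; rewrite ?add0r ?lerDr//.
by rewrite invfM exprMn (ltnW jk) addr0.
Qed.

Lemma rho_tail (d : R) : 0 < d -> exists N, form_bound
  (fun j k => if (j < N)%N && (k < N)%N then 0 else rho j k) d.
Proof.
move=> d0; pose Tn N := \sum_(j < N) \sum_(k < N) rho j k ^+ 2.
have hs : has_sup (range Tn).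
  split; first by exists (Tn 0%N), 0%N.
  by exists 8 => _ [N _ <-]; exact: sum_rho_sqr.
have [_ [N _ <-] TN] := sup_adherent (exprn_gt0 2 d0) hs.
exists N; apply: form_bound_HS; first exact: ltW.
move=> M.
apply: le_trans (_ : Tn (maxn M N) - Tn N <= _); last first.
  have : Tn (maxn M N) <= sup (range Tn) by apply: ub_le_sup; [exact: hs.2|exists (maxn M N)].
  by move: (sup _) TN => s; lra.
set P := maxn M N; have NP : (N <= P)%N by exact: leq_maxr.
have MP : (M <= P)%N by exact: leq_maxl.
have TNE : Tn N = \sum_(j < P) \sum_(k < P) (if (j < N)%N && (k < N)%N then rho j k ^+ 2 else 0).
  rewrite /Tn (big_ord_widen P (fun j => \sum_(k < N) rho j k ^+ 2) NP) big_mkcond/=.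
  apply: eq_bigr => j _; case: ifP => jN /=; last by rewrite big1.
  by rewrite (big_ord_widen P (fun k => rho j k ^+ 2) NP) big_mkcond.
have -> : Tn P - Tn N = \sum_(j < P) \sum_(k < P)
    (if (j < N)%N && (k < N)%N then 0 else rho j k) ^+ 2.
  rewrite TNE /Tn -sumrB; apply: eq_bigr => j _; rewrite -sumrB; apply: eq_bigr => k _.
  by case: ifP => _; rewrite ?subrr ?expr0n ?subr0.
pose F (j k : nat) := (if (j < N)%N && (k < N)%N then 0 else rho j k) ^+ 2.
have F0 j k : 0 <= F j k by exact: sqr_ge0.
rewrite -/(\sum_(j < M) \sum_(k < M) F j k).
have mono (G : nat -> R) : (forall j, 0 <= G j) -> \sum_(j < M) G j <= \sum_(j < P) G j.
  move=> G0; rewrite (big_ord_widen P G MP) big_mkcond/=; apply: ler_sum => j _.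
  by case: ifP.
apply: le_trans (mono (fun j => \sum_(k < M) F j k) _) _.
  by move=> j; apply: sumr_ge0.
by apply: ler_sum => j _; exact: (mono (F j)).
Qed.
End error_kernel.

(** * A criterion for membership in the ideal *)

Section ideal_criterion.
Context (R : realType) (J : set (H2 R -> H2 R)).
Hypothesis J_ideal : closed_ideal (toeplitz_algebra R) J.
Hypothesis J_comm : forall A B, toeplitz_algebra R A -> toeplitz_algebra R B ->
  J ((A \o B) \- (B \o A)).

(** [K] may depend on [d]: once [B] is fixed, a finite section of [C - B] is added to it, so large
    that what is left of [K * rho] has form bound d / 4. With [a] bounded by d / 4, the remaining
    operator has norm at most d / 2. *)
Lemma ideal_approx (C : H2 R -> H2 R) : bounded_operator C ->
  (forall d : R, 0 < d -> exists (B : H2 R -> H2 R) (a : nat -> nat -> R) (K : R),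
    [/\ J B, bounded_operator B, forall j k, 0 <= a j k, form_bound a d &
      forall j k, rnorm (entry C j k - entry B j k) <= a j k + K * rho R j k]) ->
  J C.
Proof.
move=> bC CP; apply: (ideal_closed J_ideal) => // d d0.
have d3 : 0 < d / 4 by rewrite divr_gt0.
have [B [a [K [JB bB a0 aB CB]]]] := CP _ d3.
have K0 : 0 < `|K| + 1 by rewrite ltr_wpDl.
have [N NP] := rho_tail (divr_gt0 d3 K0).
pose F := finite_matrix N (fun j k => entry C j k - entry B j k).
exists (B \+ F).
  by apply: (idealD J_ideal) => //; exact: ideal_finite_matrix.
have bF : bounded_operator F by exact: bounded_finite_matrix.
have bR : bounded_operator (C \- (B \+ F)).
  by apply: bounded_operatorB => //; exact: bounded_operatorD.
apply: (@le_lt_trans _ _ (d / 4 + (`|K| + 1) * (d / 4 / (`|K| + 1)))); last first.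
  by rewrite mulrCA mulfV ?mulr1 ?gt_eqF//; lra.
have M0 : 0 <= d / 4 + (`|K| + 1) * (d / 4 / (`|K| + 1)).
  by rewrite mulrCA mulfV ?mulr1 ?gt_eqF//; lra.
apply: opnorm_le => //; apply: rnorm_le_form => //; last first.
  by apply: form_boundD aB _; apply: form_boundZ NP; exact: ltW.
move=> j k.
have -> : entry (C \- (B \+ F)) j k = entry C j k - entry B j k - entry F j k.
  have -> : entry (C \- (B \+ F)) j k = H2dot (C (H2monomial R k) - (B (H2monomial R k) + F
    (H2monomial R k))) (H2monomial R j) by [].
  by rewrite opprD addrA !linearBl.
rewrite {3}/entry finite_matrix_entry; case: ifP => _.
  by rewrite subrr rnorm0 mulr0 addr0.
rewrite subr0; apply: le_trans (CB j k) _; rewrite lerD2l ler_wpM2r ?rho_ge0//.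
by apply: le_trans (ler_norm _) _; rewrite lerDl.
Qed.
End ideal_criterion.

(** * Fourier coefficients of (1 - z)^(i a) *)

Section outer_symbol.
Context (R : realType) (a : R).
Local Notation mu := (circle_measure R).
Local Notation I := [set` `]0, 2 * (pi : R)[].

Let amp (t : R) : R := expR (- a / 2 * (t - pi)).
Let arg (t : R) : R := a * ln (2 * sin (t / 2)).
(** [amp] is an exponential on the whole line; the cut to one period makes the symbol bounded
    everywhere. *)
Let cut (t : R) : R := \1_I t.
Let B := expR (`|a| * pi).

(* For z = expi t with 0 < t < 2 pi this is (1 - z)^(i a), since |1 - z| = 2 sin (t / 2)
   and 1 - z has argument (t - pi) / 2. *)
Definition outer_sym (t : R) : R[i] := (amp t * cut t)%:C * expi (arg t).

Let phase (m t : R) : R := arg t + m * t.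

Let inI (t : R) : t \in I = (0 < t < 2 * pi).
Proof. by apply/idP/idP; rewrite inE /= in_itv. Qed.

Let cutE (t : R) : cut t = if 0 < t < 2 * pi then 1 else 0.
Proof. by rewrite /cut indicE inI; case: ifP. Qed.

Let amp_cut_bound (t : R) : 0 <= amp t * cut t <= B.
Proof.
rewrite cutE; case: ifP => h; rewrite ?mulr0 ?mulr1 ?lexx ?expR_ge0//=.
rewrite ler_expR; have p0 := pi_gt0 R; move: h => /andP[t0 t2].
have : `|t - pi| <= pi by rewrite ler_norml; lra.
have := ler_norm (- (a * (t - pi))); rewrite normrN normrM => h1 h2.
have := normr_ge0 a; have := normr_ge0 (t - pi); nra.
Qed.

Let sin_half_gt0 (t : R) : 0 < t < 2 * pi -> 0 < sin (t / 2).
Proof. by move=> /andP[t0 t2]; apply: sin_gt0_pi; lra. Qed.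

Let is_derive_lin (c t : R) : is_derive t 1 (fun t : R => c * t) c.
Proof. by have := is_deriveZ c (is_derive_id t (1 : R)); rewrite /GRing.scale /= mulr1. Qed.

Let is_derive_amp (t : R) : is_derive t 1 amp (- a / 2 * amp t).
Proof.
have d1 : is_derive t 1 (fun t => - a / 2 * (t - pi)) (- a / 2).
  have := is_deriveD (is_derive_lin (- a / 2) t) (is_derive_cst (- a / 2 * - pi) t (1 : R)).
  rewrite addr0 (_ : _ + cst _ = fun t => - a / 2 * (t - pi))//.
  by apply/funext => x /=; rewrite -[LHS]/(_ + _) -mulrDr.
rewrite [- a / 2 * amp t]mulrC.
exact: (is_derive1_comp (is_derive_expR _) d1).
Qed.

Let is_derive_arg (t : R) : 0 < t < 2 * pi ->
  is_derive t 1 arg (a * (cos (t / 2) / (2 * sin (t / 2)))).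
Proof.
move=> tI; have s0 := sin_half_gt0 tI.
pose half (x : R) := x / 2; have d1 : is_derive t 1 half (2^-1).
  by have := is_derive_lin 2^-1 t; congr is_derive; apply/funext => x; rewrite mulrC.
have d2 : is_derive t 1 (fun t => 2 * sin (t / 2)) (cos (t / 2)).
  have := is_deriveZ 2 (is_derive1_comp (is_derive_sin (half t)) d1).
  by rewrite /GRing.scale /= mulrCA mulfV ?mulr1.
pose h (x : R) := 2 * sin (x / 2); have p0 : 0 < h t by rewrite mulr_gt0.
have := is_deriveZ a (is_derive1_comp (is_derive1_ln p0) d2).
by rewrite /GRing.scale /= [_^-1 * _]mulrC.
Qed.

Let is_derive_phase (m t : R) : 0 < t < 2 * pi ->
  is_derive t 1 (phase m) (a * (cos (t / 2) / (2 * sin (t / 2))) + m).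
Proof. by move=> tI; exact: (is_deriveD (is_derive_arg tI) (is_derive_lin m t)). Qed.

Let fC (m t : R) := amp t * cut t * cos (phase m t).
Let fS (m t : R) := amp t * cut t * sin (phase m t).

Let measurable_phase (m : R) : measurable_fun setT (phase m).
Proof.
apply: measurable_funD; apply: measurable_funM; try exact: measurable_cst; last exact: measurable_id.
apply: (measurableT_comp (@measurable_ln R)).
apply: measurable_funM; first exact: measurable_cst.
apply: (measurableT_comp (continuous_measurable_fun (@continuous_sin R))).
by apply: measurable_funM; [exact: measurable_id|exact: measurable_cst].
Qed.

Let measurable_amp_cut : measurable_fun setT (fun t => amp t * cut t).
Proof.
apply: measurable_funM; last exact: measurable_indic.
apply: (measurableT_comp (@measurable_expR R)).
apply: measurable_funM; first exact: measurable_cst.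
by apply: measurable_funB; [exact: measurable_id|exact: measurable_cst].
Qed.

Let measurable_fC (m : R) : measurable_fun setT (fC m).
Proof.
apply: measurable_funM => //.
exact: (measurableT_comp (continuous_measurable_fun (@continuous_cos R))).
Qed.

Let measurable_fS (m : R) : measurable_fun setT (fS m).
Proof.
apply: measurable_funM => //.
exact: (measurableT_comp (continuous_measurable_fun (@continuous_sin R))).
Qed.

Let fC_bound (m t : R) : `|fC m t| <= B.
Proof.
have /andP[b0 b1] := amp_cut_bound t; rewrite /fC normrM (ger0_norm b0).
apply: le_trans b1; rewrite ler_piMr//; exact: (cos_sin_bound _).1.
Qed.

Let fS_bound (m t : R) : `|fS m t| <= B.
Proof.
have /andP[b0 b1] := amp_cut_bound t; rewrite /fS normrM (ger0_norm b0).
apply: le_trans b1; rewrite ler_piMr//; exact: (cos_sin_bound _).2.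
Qed.

Let near_cut (t : R) : 0 < t < 2 * pi -> \forall x \near t, 0 < x < 2 * pi.
Proof.
move=> /andP[t0 t2]; near=> x; apply/andP; split; near: x.
- exact: lt_nbhsr.
- exact: lt_nbhsl.
Unshelve. all: by end_near. Qed.

Let continuous_phase (m t : R) : 0 < t < 2 * pi -> {for t, continuous (phase m)}.
Proof.
move=> tI; apply: differentiable_continuous; apply/derivable1_diffP.
by have [] := is_derive_phase m tI.
Qed.

Let continuous_fC (m t : R) : 0 < t < 2 * pi -> {for t, continuous (fC m)}.
Proof.
move=> tI.
have c : {for t, continuous (fun x => amp x * cos (phase m x))}.
  apply: (@continuousM R R).
    apply: differentiable_continuous; apply/derivable1_diffP.
    by have [] := is_derive_amp t.
  by apply: continuous_comp; [exact: continuous_phase|exact: continuous_cos].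
rewrite /prop_for /continuous_at.
have e x : 0 < x < 2 * pi -> amp x * cos (phase m x) = fC m x.
  by move=> xI; rewrite /fC cutE xI mulr1.
have h : {near t, (fun x => amp x * cos (phase m x)) =1 fC m}.
  by apply: filterS (near_cut tI) => x; exact: e.
rewrite -(e t tI); exact: (cvg_trans (near_eq_cvg h) c).
Qed.

Let continuous_fS (m t : R) : 0 < t < 2 * pi -> {for t, continuous (fS m)}.
Proof.
move=> tI.
have c : {for t, continuous (fun x => amp x * sin (phase m x))}.
  apply: (@continuousM R R).
    apply: differentiable_continuous; apply/derivable1_diffP.
    by have [] := is_derive_amp t.
  by apply: continuous_comp; [exact: continuous_phase|exact: continuous_sin].
rewrite /prop_for /continuous_at.
have e x : 0 < x < 2 * pi -> amp x * sin (phase m x) = fS m x.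
  by move=> xI; rewrite /fS cutE xI mulr1.
have h : {near t, (fun x => amp x * sin (phase m x)) =1 fS m}.
  by apply: filterS (near_cut tI) => x; exact: e.
rewrite -(e t tI); exact: (cvg_trans (near_eq_cvg h) c).
Qed.

Let continuous_amp : continuous amp.
Proof.
move=> t; apply: differentiable_continuous; apply/derivable1_diffP.
by have [] := is_derive_amp t.
Qed.

(** On the open arc this is the modulus of [(1 - z)^(1 + i a)]. It vanishes at both ends, which
    removes the boundary terms although the logarithm in the phase diverges there. *)
Let env (t : R) := `|2 * amp t * sin (t / 2)|.

Let continuous_env : continuous env.
Proof.
have cs : continuous (fun x : R => sin (x / 2)).
  move=> x; apply: (@continuous_comp _ _ _ (fun t : R => t / 2)); last exact: continuous_sin.
  exact: mulrr_continuous.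
move=> t; apply: (@continuous_comp _ _ _ (fun t => 2 * amp t * sin (t / 2)) Num.norm);
  last exact: norm_continuous.
apply: (@continuousM R R).
  by apply: (@continuousM R R); [exact: cst_continuous|exact: continuous_amp].
exact: cs.
Qed.

Let env_squeeze (F : R -> R) : (forall t, `|F t| <= env t) ->
  F x @[x --> 0^'+] --> 0 /\ F x @[x --> (2 * pi : R)^'-] --> 0.
Proof.
move=> Fe.
have b t : - env t <= F t <= env t by rewrite -ler_norml.
have e0 : env 0 = 0 by rewrite /env mul0r sin0 mulr0 normr0.
have e1 : env (2 * pi) = 0 by rewrite /env (_ : 2 * pi / 2 = pi :> R) ?sinpi ?mulr0 ?normr0//; field.
split.
- have c : env x @[x --> 0^'+] --> 0.
    by rewrite -[X in _ --> X]e0; apply: cvg_at_right_filter; exact: continuous_env.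
  apply: (@squeeze_cvgr _ _ _ _ (fun x => - env x) env F _ 0) => //.
    by near=> x; exact: b.
  by rewrite -[X in _ --> X]oppr0; exact: cvgN.
- have c : env x @[x --> (2 * pi)^'-] --> 0.
    by rewrite -[X in _ --> X]e1; apply: cvg_at_left_filter; exact: continuous_env.
  apply: (@squeeze_cvgr _ _ _ _ (fun x => - env x) env F _ 0) => //.
    by near=> x; exact: b.
  by rewrite -[X in _ --> X]oppr0; exact: cvgN.
Unshelve. all: by end_near. Qed.

(** Centring the phase at m + 1/2 exposes the factor 2 sin (t / 2) of z^(m+1) - z^m. *)
Let phaseE (m t : R) : (phase (m + 1) t = phase (m + 2^-1) t + t / 2) *
  (phase m t = phase (m + 2^-1) t - t / 2).
Proof. by rewrite /phase; split; field. Qed.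

Let intC (m : R) := \int[mu]_t fC m t.
Let intS (m : R) := \int[mu]_t fS m t.

Let Rint_lin3 (f g h : R -> R) (x y z K : R) :
  measurable_fun setT f -> measurable_fun setT g -> measurable_fun setT h ->
  (forall t, `|f t| <= K) -> (forall t, `|g t| <= K) -> (forall t, `|h t| <= K) ->
  \int[mu]_t (x * f t + y * g t + z * h t) =
  x * \int[mu]_t f t + y * \int[mu]_t g t + z * \int[mu]_t h t.
Proof.
move=> mf mg mh fK gK hK.
have int_ (c : R) (k : R -> R) : measurable_fun setT k -> (forall t, `|k t| <= K) ->
    mu.-integrable setT (EFin \o (fun t => c * k t)).
  move=> mk kK; apply: (@bounded_integrable _ _ (`|c| * K)).
    by apply: measurable_funM => //; exact: measurable_cst.
  by move=> t; rewrite normrM ler_wpM2l.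
have i1 := int_ x f mf fK; have i2 := int_ y g mg gK; have i3 := int_ z h mh hK.
rewrite RintegralD//; last first.
  by have := integrableD measurableT i1 i2; exact: eq_integrable.
rewrite RintegralD//.
by rewrite !RintegralZl//; exact: bounded_integrable.
Qed.

Let norm_mulB (c x : R) : `|x| <= B -> `|c * x| <= `|c| * B.
Proof. by move=> xB; rewrite normrM ler_wpM2l. Qed.

Let Rint_lin2 (f g : R -> R) (x y K : R) :
  measurable_fun setT f -> measurable_fun setT g ->
  (forall t, `|f t| <= K) -> (forall t, `|g t| <= K) ->
  \int[mu]_t (x * f t + y * g t) = x * \int[mu]_t f t + y * \int[mu]_t g t.
Proof.
move=> mf mg fK gK; have := Rint_lin3 x y 0 mf mg mg fK gK gK.
by rewrite mul0r addr0 => <-; apply: eq_Rintegral => t _; rewrite mul0r addr0.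
Qed.

(** The derivative in t of [(z^(m+1) - z^m) (1 - z)^(i a)] is [i ((m + 1 + i a) z^(m+1) - m z^m) (1
    - z)^(i a)], and its integral vanishes. The imaginary part is taken here; [recS] takes the real
    part with opposite sign. *)
Let recC (m : R) : (1 + m) * intC (m + 1) - a * intS (m + 1) - m * intC m = 0.
Proof.
rewrite -!mulNr ?opprK -(@Rint_lin3 _ _ _ _ _ _ B)//.
pose F t := amp t * (sin (phase (m + 1) t) - sin (phase m t)).
pose f t := (1 + m) * fC (m + 1) t + (- a) * fS (m + 1) t + (- m) * fC m t.
have [F0 F1] : F x @[x --> 0^'+] --> 0 /\ F x @[x --> (2 * pi : R)^'-] --> 0.
  apply: env_squeeze => t; rewrite /F /env !(phaseE m t) sinD sinB.
  rewrite (_ : amp t * _ = 2 * amp t * sin (t / 2) * cos (phase (m + 2^-1) t)); last by ring.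
  by rewrite normrM ler_piMr// ?cos_max// ler_norml sin_geN1 sin_le1.
have mf : measurable_fun setT f.
  apply: measurable_funD; [apply: measurable_funD|]; apply: measurable_funM => //; exact: measurable_cst.
have fM t : `|f t| <= (`|(1 + m)| + `|(- a)| + `|(- m)|) * B.
  rewrite !mulrDl; apply: le_trans (ler_normD _ _) _; apply: lerD; last exact: norm_mulB.
  apply: le_trans (ler_normD _ _) _.
  by apply: lerD; exact: norm_mulB.
have dF t : 0 < t < 2 * pi -> is_derive t 1 F (f t) /\ {for t, continuous f}.
  move=> tI; split; last first.
    apply: (@continuousD R R); [apply: (@continuousD R R)|]; (apply: (@continuousM R R);
      first exact: cst_continuous).
    - exact: continuous_fC.
    - exact: continuous_fS.
    - exact: continuous_fC.
  have d1 := is_derive1_comp (is_derive_sin _) (is_derive_phase (m + 1) tI).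
  have d0 := is_derive1_comp (is_derive_sin _) (is_derive_phase m tI).
  have := is_deriveM (is_derive_amp t) (is_deriveB d1 d0).
  have s0 := sin_half_gt0 tI.
  rewrite /GRing.scale /=.
  set D := (X in is_derive _ _ _ X).
  rewrite (_ : D = f t)//.
  rewrite /D /f /fC /fS cutE tI mulr1 !fctE /= !(phaseE m t).
  move: (phase (m + 2^-1) t) => u; rewrite !sinD !cosD sinN cosN.
  by field; rewrite gt_eqF.
have := circle_FTC mf fM dF F0 F1.
by rewrite subrr mul0r.
Qed.

Let recS (m : R) : (1 + m) * intS (m + 1) + a * intC (m + 1) - m * intS m = 0.
Proof.
rewrite -!mulNr ?opprK -(@Rint_lin3 _ _ _ _ _ _ B)//.
pose F t := amp t * (cos (phase m t) - cos (phase (m + 1) t)).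
pose f t := (1 + m) * fS (m + 1) t + a * fC (m + 1) t + (- m) * fS m t.
have [F0 F1] : F x @[x --> 0^'+] --> 0 /\ F x @[x --> (2 * pi : R)^'-] --> 0.
  apply: env_squeeze => t; rewrite /F /env !(phaseE m t) cosB cosD.
  rewrite (_ : amp t * _ = 2 * amp t * sin (t / 2) * sin (phase (m + 2^-1) t)); last by ring.
  by rewrite normrM ler_piMr// ?cos_max// ler_norml sin_geN1 sin_le1.
have mf : measurable_fun setT f.
  apply: measurable_funD; [apply: measurable_funD|]; apply: measurable_funM => //; exact: measurable_cst.
have fM t : `|f t| <= (`|(1 + m)| + `|a| + `|(- m)|) * B.
  rewrite !mulrDl; apply: le_trans (ler_normD _ _) _; apply: lerD; last exact: norm_mulB.
  apply: le_trans (ler_normD _ _) _.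
  by apply: lerD; exact: norm_mulB.
have dF t : 0 < t < 2 * pi -> is_derive t 1 F (f t) /\ {for t, continuous f}.
  move=> tI; split; last first.
    apply: (@continuousD R R); [apply: (@continuousD R R)|]; (apply: (@continuousM R R);
      first exact: cst_continuous).
    - exact: continuous_fS.
    - exact: continuous_fC.
    - exact: continuous_fS.
  have d1 := is_derive1_comp (is_derive_cos _) (is_derive_phase (m + 1) tI).
  have d0 := is_derive1_comp (is_derive_cos _) (is_derive_phase m tI).
  have := is_deriveM (is_derive_amp t) (is_deriveB d0 d1).
  have s0 := sin_half_gt0 tI.
  rewrite /GRing.scale /=.
  set D := (X in is_derive _ _ _ X).
  rewrite (_ : D = f t)//.
  rewrite /D /f /fC /fS cutE tI mulr1 !fctE /= !(phaseE m t).
  move: (phase (m + 2^-1) t) => u; rewrite !sinD !cosD sinN cosN.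
  by field; rewrite gt_eqF.
have := circle_FTC mf fM dF F0 F1.
by rewrite subrr mul0r.
Qed.


(** * Nonvanishing of the zeroth coefficient *)

Let pow_s (N : nat) (t : R) : R := sin (t / 2) ^+ N.*2.

Let pow_s_ge0 N t : 0 <= pow_s N t.
Proof. by rewrite /pow_s -mul2n exprM exprn_ge0 ?sqr_ge0. Qed.

Let pow_s_le1 N t : pow_s N t <= 1.
Proof.
rewrite /pow_s -mul2n exprM exprn_ile1 ?sqr_ge0//.
Qed.

Let pow_sS N t : pow_s N.+1 t = pow_s N t * sin (t / 2) ^+ 2.
Proof. by rewrite /pow_s (_ : N.+1.*2 = N.*2 + 2)%N ?exprD// doubleS addn2. Qed.

Let continuous_sin_half : continuous (fun x : R => sin (x / 2)).
Proof.
move=> x; apply: (@continuous_comp _ _ _ (fun t : R => t / 2)); last exact: continuous_sin.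
exact: mulrr_continuous.
Qed.

Let measurable_pow_s N : measurable_fun setT (pow_s N).
Proof. by apply: measurable_funX; exact: continuous_measurable_fun. Qed.

Let continuous_pow_s N : continuous (pow_s N).
Proof.
move=> t; apply: (@continuous_comp _ _ _ (fun t : R => sin (t / 2)) (fun x => x ^+ N.*2)).
  exact: continuous_sin_half.
exact: exprn_continuous.
Qed.

Let is_derive_half (t : R) : is_derive t 1 (fun t : R => t / 2) 2^-1.
Proof.
by have := is_derive_lin 2^-1 t; congr is_derive; apply/funext => x; rewrite mulrC.
Qed.

Let W N : R := \int[mu]_t pow_s N t.

(** Wallis recursion: cos (t / 2) sin^(2 N + 1) (t / 2) vanishes at both ends, so its derivative
    integrates to 0. *)
Let W_rec N : W N.+1 = W N * ((2 * N%:R + 1) / (2 * N%:R + 2)).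
Proof.
have n0 : 0 <= N%:R :> R by [].
pose F (t : R) := cos (t / 2) * sin (t / 2) ^+ N.*2.+1.
pose f (t : R) := (2 * N%:R + 1) / 2 * pow_s N t + - (N%:R + 1) * pow_s N.+1 t.
have bs K t : `|pow_s K t| <= 1 by rewrite ger0_norm.
have mf : measurable_fun setT f.
  by apply: measurable_funD; apply: measurable_funM => //; exact: measurable_cst.
have c1 (c x : R) : `|x| <= 1 -> `|c * x| <= `|c| * 1 by move=> x1; rewrite normrM ler_wpM2l.
have fM t : `|f t| <= `|(2 * N%:R + 1) / 2| * 1 + `|- (N%:R + 1)| * 1.
  by apply: le_trans (ler_normD _ _) _; apply: lerD; exact: c1.
have dF t : 0 < t < 2 * pi -> is_derive t 1 F (f t) /\ {for t, continuous f}.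
  move=> tI; split; last first.
    apply: (@continuousD R R); (apply: (@continuousM R R); first exact: cst_continuous);
      exact: continuous_pow_s.
  have d1 := is_derive1_comp (is_derive_cos _) (is_derive_half t).
  have d0 := is_derive1_comp (is_derive_sin _) (is_derive_half t).
  have dd := is_deriveM d1 (is_deriveX N.*2.+1 d0).
  move: dd; rewrite !fctE /GRing.scale /=; set D := (X in is_derive _ _ _ X) => dd.
  have -> : f t = D; last exact: dd.
  rewrite /D /= /f pow_sS /pow_s /=. 
  rewrite [_ ^+ N.*2.+1]exprS -[N.*2.+1]addn1 natrD -mul2n natrM.
  have := cos2Dsin2 (t / 2); move: (sin (t / 2)) (cos (t / 2)) => x y xy.
  move: (x ^+ (2 * N)%N) => z; have xE : x ^+ 2 = 1 - y ^+ 2 by rewrite -xy; ring.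
  have -> : x * z * (- x / 2) = - (1 - y ^+ 2) * z / 2 by rewrite -xE; field.
  by rewrite xE; field.
have cF : continuous F.
  have k1 : continuous (fun x : R => cos (x / 2)).
    move=> x; apply: (@continuous_comp _ _ _ (fun t : R => t / 2)); last exact: continuous_cos.
    exact: mulrr_continuous.
  have k2 : continuous (fun x : R => sin (x / 2) ^+ N.*2.+1).
    move=> x; apply: (@continuous_comp _ _ _ (fun t : R => sin (t / 2)) (fun x => x ^+ N.*2.+1)).
      exact: continuous_sin_half.
    exact: exprn_continuous.
  by move=> t; exact: (continuousM (k1 t) (k2 t)).
have F0 : F x @[x --> 0^'+] --> F 0 by apply: cvg_at_right_filter; exact: cF.
have F1 : F x @[x --> (2 * pi : R)^'-] --> F (2 * pi) by apply: cvg_at_left_filter; exact: cF.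
have := circle_FTC mf fM dF F0 F1.
rewrite /F mul0r (_ : 2 * pi / 2 = pi :> R); last by field.
rewrite sin0 sinpi !expr0n /= !mulr0 subrr mul0r.
rewrite (@Rint_lin2 _ _ _ _ 1)// -/(W N) -/(W N.+1) => h.
have p : 2 * (N%:R : R) + 2 != 0 by rewrite gt_eqF//; lra.
by apply: (mulIf p); rewrite -mulrA divfK//; lra.
Qed.

Let W_gt0 N : 0 < W N.
Proof.
elim: N => [|N IH].
  have -> : W 0 = \int[mu]_t (cst 1 t) by apply: eq_Rintegral => t _; rewrite /pow_s expr0.
  rewrite Rintegral_cst// mul1r.
  have -> : fine ((mu : set _ -> \bar R) setT) = 1 by rewrite (@probability_setT _ _ _ mu).
  exact: ltr01.
by rewrite W_rec mulr_gt0// divr_gt0// ltr_wpDl// mulr_ge0.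
Qed.

(** The phase is compared with its value at t = pi in terms of 1 - sin^2 (t / 2), a factor that
    turns a weight [pow_s] into a difference of two consecutive ones. For s <= 1/2 the left side is
    at most 2, which 3 (1 - s^2) exceeds; otherwise |ln s| <= 1 / s - 1 <= 2 (1 - s^2). *)
Let log_sin_bound (t : R) : 0 < t < 2 * pi ->
  1 - cos (a * ln (sin (t / 2))) <= (2 * `|a| + 3) * (1 - sin (t / 2) ^+ 2).
Proof.
move=> tI; have s0 := sin_half_gt0 tI.
have s1 : sin (t / 2) <= 1 by exact: sin_le1.
move: (sin _) s0 s1 => s s0 s1; have A0 := normr_ge0 a.
have [sh|sh] := leP s 2^-1.
  have : -1 <= cos (a * ln s) by exact: cos_geN1.
  have s2 : s ^+ 2 <= 4^-1 by nra.
  have : 0 <= `|a| * (1 - s ^+ 2) by rewrite mulr_ge0//; lra.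
  by move: (s ^+ 2) s2 (cos _) (`|a|) A0 => q q4 c A A0 h1 h2; lra.
apply: le_trans (one_minus_cos_le_abs _) _; rewrite normrM.
have l0 : ln s <= 0 by rewrite -ln1 ler_ln ?posrE.
have l1 : `|ln s| <= s^-1 - 1.
  rewrite ler0_norm// -lnV ?posrE//.
  have := expR_ge1Dx (ln s^-1); rewrite lnK ?posrE ?invr_gt0//; lra.
have h : s^-1 - 1 <= 2 * (1 - s ^+ 2).
  rewrite -(ler_pM2l s0) mulrBr mulfV ?gt_eqF//; nra.
apply: le_trans (_ : `|a| * (2 * (1 - s ^+ 2)) <= _).
  by rewrite ler_wpM2l// (le_trans l1 h).
by rewrite mulrA [`|a| * 2]mulrC ler_wpM2r; nra.
Qed.

Let amp_bounds (t : R) : 0 < t < 2 * pi -> expR (- (`|a| * pi)) <= amp t <= B.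
Proof.
move=> tI; have /andP[_] := amp_cut_bound t; rewrite cutE tI mulr1 => ->; rewrite andbT.
rewrite ler_expR; have p0 := pi_gt0 R; move: tI => /andP[t0 t2].
have : `|t - pi| <= pi by rewrite ler_norml; lra.
have := ler_norm (a * (t - pi)); rewrite normrM => h1 h2.
have := normr_ge0 a; have := normr_ge0 (t - pi); nra.
Qed.

(** As sin^2 (t / 2) = 1/2 - (z + 1/z) / 4, each further factor shifts the frequency by one in both
    directions; [Z] is a set of frequencies stable under these shifts. *)
Let vanish (Z : R -> Prop) : (forall m, Z m -> Z (m + 1)) -> (forall m, Z m -> Z (m - 1)) ->
  (forall m, Z m -> intC m = 0 /\ intS m = 0) -> forall N m, Z m ->
  \int[mu]_t (fC m t * pow_s N t) = 0 /\ \int[mu]_t (fS m t * pow_s N t) = 0.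
Proof.
move=> Zp Zn Z0; elim=> [|N IH] m Zm.
  have [c0 s0] := Z0 m Zm; split; [rewrite -[RHS]c0|rewrite -[RHS]s0];
    by apply: eq_Rintegral => t _; rewrite /pow_s expr0 mulr1.
have [c0 s0] := IH m Zm; have [c1 s1] := IH _ (Zp m Zm); have [c2 s2] := IH _ (Zn m Zm).
have bd (f : R -> R) t : `|f t| <= B -> `|f t * pow_s N t| <= B.
  by move=> fB; rewrite normrM [`|pow_s N t|]ger0_norm// (le_trans _ fB)// ler_piMr.
have mm (f : R -> R) : measurable_fun setT f -> measurable_fun setT (fun t => f t * pow_s N t).
  by move=> mf; exact: measurable_funM.
have sE t : sin (t / 2) ^+ 2 = 1 / 2 - cos t / 2.
  by have := one_minus_cosE t; lra.
have p1 t : phase (m + 1) t = phase m t + t by rewrite /phase; ring.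
have p2 t : phase (m - 1) t = phase m t - t by rewrite /phase; ring.
split.
- have := @Rint_lin3 _ _ _ (1 / 2) (- (1 / 4)) (- (1 / 4)) B (mm _ (measurable_fC m)) (mm _
  (measurable_fC (m + 1))) (mm _ (measurable_fC (m - 1))) (fun t => bd _ t (fC_bound _ t))
    (fun t => bd _ t (fC_bound _ t)) (fun t => bd _ t (fC_bound _ t)).
  rewrite c0 c1 c2 !mulr0 !addr0 => <-; apply: eq_Rintegral => t _.
  by rewrite pow_sS sE /fC p1 p2 cosD cosB; field.
- have := @Rint_lin3 _ _ _ (1 / 2) (- (1 / 4)) (- (1 / 4)) B (mm _ (measurable_fS m)) (mm _
  (measurable_fS (m + 1))) (mm _ (measurable_fS (m - 1))) (fun t => bd _ t (fS_bound _ t))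
    (fun t => bd _ t (fS_bound _ t)) (fun t => bd _ t (fS_bound _ t)).
  rewrite s0 s1 s2 !mulr0 !addr0 => <-; apply: eq_Rintegral => t _.
  by rewrite pow_sS sE /fS p1 p2 sinD sinB; field.
Qed.

(* The weights sin^(2 N) (t / 2) concentrate at t = pi, where the symbol does not vanish. *)
Let nonvanish : ~ (forall N, \int[mu]_t (fC 0 t * pow_s N t) = 0 /\
  \int[mu]_t (fS 0 t * pow_s N t) = 0).
Proof.
move=> h.
pose K := 2 * `|a| + 3; pose b0 := expR (- (`|a| * pi)).
have K0 : 0 < K by rewrite /K ltr_wpDl ?mulr_ge0.
have B0 : 0 < B by exact: expR_gt0.
have b00 : 0 < b0 by exact: expR_gt0.
(* The symbol has phase a ln 2 at t = pi; after rotation by it, the real part is positive near that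
   point. *)
pose x0 := cos (a * ln 2); pose y0 := sin (a * ln 2).
pose hN N t := x0 * (fC 0 t * pow_s N t) + y0 * (fS 0 t * pow_s N t).
have bd N (f : R -> R) t : `|f t| <= B -> `|f t * pow_s N t| <= B.
  by move=> fB; rewrite normrM [`|pow_s N t|]ger0_norm// (le_trans _ fB)// ler_piMr.
have mm N (f : R -> R) : measurable_fun setT f -> measurable_fun setT (fun t => f t * pow_s N t).
  by move=> mf; exact: measurable_funM.
have h0 N : \int[mu]_t hN N t = 0.
  have := @Rint_lin2 _ _ x0 y0 B (mm N _ (measurable_fC 0)) (mm N _ (measurable_fS 0))
    (fun t => bd N _ t (fC_bound _ t)) (fun t => bd N _ t (fS_bound _ t)).
  by have [-> ->] := h N; rewrite !mulr0 addr0.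
have hE N t : hN N t = amp t * cut t * cos (arg t - a * ln 2) * pow_s N t.
  by rewrite /hN /fC /fS /phase !mul0r !addr0 cosB -/x0 -/y0; ring.
(* The weight starts at index N + 1 so that both sides vanish at the end points, where the cut makes
   the symbol 0. *)
have hlow N t : 0 <= t <= 2 * pi ->
    (b0 - B * K) * pow_s N.+1 t + B * K * pow_s N.+2 t <= hN N.+1 t.
  move=> tI; have [tI'|tI'] := boolP (0 < t < 2 * pi); last first.
    have t01 : t = 0 \/ t = 2 * pi.
      by move: tI tI'; rewrite !le_eqVlt => /andP[/orP[/eqP<-|->] /orP[/eqP->|->]]; [left|left|right|].
    rewrite hE cutE (negbTE tI') mulr0 !mul0r pow_sS pow_sS.
    have -> : sin (t / 2) = 0.
      by case: t01 => ->; rewrite ?mul0r ?sin0// (_ : 2 * pi / 2 = pi :> R) ?sinpi//; field.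
    by rewrite expr0n /= !mulr0 addr0.
  have s0 := sin_half_gt0 tI'.
  rewrite hE cutE tI' mulr1 [pow_s N.+2 t]pow_sS.
  have -> : arg t - a * ln 2 = a * ln (sin (t / 2)).
    by rewrite /arg lnM ?posrE//; ring.
  have := log_sin_bound tI'; rewrite -/K; have /andP[] := amp_bounds tI'.
  rewrite -/b0; have P0 := pow_s_ge0 N.+1 t.
  have q0 : 0 <= 1 - sin (t / 2) ^+ 2 by rewrite -cos2sin2 sqr_ge0.
  move: (pow_s _ _) (amp t) (cos _) (sin _ ^+ 2) P0 q0 => p A c q P0 q0 bA AB cq.
  rewrite -subr_ge0 (_ : _ - _ = p * (A * c - (b0 - B * K * (1 - q)))); last by ring.
  apply: mulr_ge0 => //.
  have : A * (1 - K * (1 - q)) <= A * c by rewrite ler_wpM2l; lra.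
  have : A * (K * (1 - q)) <= B * (K * (1 - q)) by rewrite ler_wpM2r// mulr_ge0// ltW.
  by nra.
have key N : (b0 - B * K) * W N.+1 + B * K * W N.+2 <= 0.
  have bs K' t : `|pow_s K' t| <= 1 by rewrite ger0_norm.
  rewrite -(@Rint_lin2 _ _ _ _ 1)// -[leRHS](h0 N.+1).
  have mh : measurable_fun setT (hN N.+1).
    apply: measurable_funD; apply: measurable_funM; try exact: measurable_cst; exact: mm.
  have mL : measurable_fun setT (fun t => (b0 - B * K) * pow_s N.+1 t + B * K * pow_s N.+2 t).
    by apply: measurable_funD; apply: measurable_funM => //; exact: measurable_cst.
  have hB t : `|hN N.+1 t| <= `|x0| * B + `|y0| * B.
    by apply: le_trans (ler_normD _ _) _; apply: lerD; apply: norm_mulB; apply: bd.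
  have lB t : `|(b0 - B * K) * pow_s N.+1 t + B * K * pow_s N.+2 t| <= `|b0 - B * K| * 1 + `|B * K| * 1.
    apply: le_trans (ler_normD _ _) _; apply: lerD; rewrite normrM ler_wpM2l//; exact: bs.
  rewrite (circle_RintegralE mh hB) (circle_RintegralE mL lB) ler_pM2l ?invr_gt0 ?pi2_gt0//.
  apply: le_Rintegral.
  - exact: measurable_itv.
  - exact: bounded_integrable_itv lB.
  - exact: bounded_integrable_itv hB.
  by move=> t /=; rewrite in_itv /=; exact: hlow.
(* By [W_rec], W_(N+2) = W_(N+1) (1 - 1 / (2 (N + 1) + 2)), so that [key] amounts to b0 (2 (N + 1) +
   2) <= B K, which fails for large N. *)
have [N NP] : exists N : nat, B * K < b0 * (2 * N.+1%:R + 2).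
  exists (Num.truncn (B * K / b0)); rewrite [b0 * _]mulrC -ltr_pdivrMr//.
  have := truncnS_gt (B * K / b0); set n := Num.truncn _.
  by rewrite -addn1 natrD; have : 0 <= (n%:R : R) by []; lra.
have := key N; rewrite [W N.+2]W_rec; have := W_gt0 N.+1.
have n0 : 0 <= (N.+1%:R : R) by [].
have d0 : 0 < 2 * (N.+1%:R : R) + 2 by lra.
move: (W _) => w w0; rewrite leNgt => /negP; apply.
rewrite (_ : _ + _ = w * (b0 * (2 * N.+1%:R + 2) - B * K) / (2 * N.+1%:R + 2)).
  by rewrite divr_gt0// mulr_gt0// subr_gt0.
by move: (N.+1%:R) d0 => n d0; field; rewrite gt_eqF.
Qed.

Let outer_mul_expi (m t : R) : outer_sym t * expi (m * t) = fC m t +i* fS m t.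
Proof.
rewrite /outer_sym -mulrA -expiD /fC /fS /phase /expi.
by apply/eqP; rewrite eq_complex /= !mul0r subr0 addr0 !eqxx.
Qed.

Let bounded_Lfun_infty (f : R -> R) (K : R) : measurable_fun setT f ->
  (forall t, `|f t| <= K) -> f \in Lfun mu +oo.
Proof.
move=> mf fK; apply/andP; rewrite !inE; split; first exact: mf.
rewrite /= /finite_norm unlock; case: ifPn => // _.
apply: le_lt_trans (ltry K); apply/ess_supP/aeW => t.
by rewrite lee_fin.
Qed.

Lemma outer_sym_Linfty : outer_sym \in cLfun mu +oo.
Proof.
have E t : outer_sym t = fC 0 t +i* fS 0 t.
  by rewrite -outer_mul_expi mul0r expi0 mulr1.
apply/andP; split.
- rewrite (_ : _ \o _ = fC 0); first exact: bounded_Lfun_infty (measurable_fC 0) (fC_bound 0).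
  by apply/funext => t; rewrite /comp E.
- rewrite (_ : _ \o _ = fS 0); first exact: bounded_Lfun_infty (measurable_fS 0) (fS_bound 0).
  by apply/funext => t; rewrite /comp E.
Qed.

Definition outer_coef (m : R) : R[i] :=
  cintegral mu (fun t => outer_sym t * expi (m * t)).

Let outer_coefE m : outer_coef m = intC m +i* intS m.
Proof.
rewrite /outer_coef /cintegral.
by congr (_ +i* _); apply: eq_Rintegral => t _; rewrite outer_mul_expi.
Qed.

Lemma outer_coef_rec (m : R) :
  ((1 + m) +i* a) * outer_coef (m + 1) = m%:C * outer_coef m.
Proof.
rewrite !outer_coefE; apply/eqP; rewrite eq_complex /= !mul0r subr0 addr0.
have := recC m; have := recS m => h1 h2.
by apply/andP; split; apply/eqP; lra.
Qed.

(** The factor [m] of the recursion vanishes at m = 0, which starts the induction. As [outer_coef m]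
    is the Fourier coefficient of index - m, this says that the symbol is analytic. *)
Lemma outer_coef_pos n : outer_coef n.+1%:R = 0.
Proof.
elim: n => [|n IH].
  have := outer_coef_rec 0; rewrite add0r addr0 mul0r => /eqP.
  by rewrite mulf_eq0 eq_complex /= oner_eq0 => /eqP.
have := outer_coef_rec n.+1%:R; rewrite IH mulr0 natr1 => /eqP.
rewrite mulf_eq0 eq_complex /= => /orP[/andP[/eqP h _]|/eqP //].
by exfalso; have : (0 : R) <= n%:R by []; move: h; rewrite -?natr1; lra.
Qed.

Lemma outer_coef_neg n : n.+1%:R * outer_coef (- n.+1%:R) =
  (n%:R -i* a) * outer_coef (- n%:R).
Proof.
have := outer_coef_rec (- n.+1%:R).
rewrite (_ : - n.+1%:R + 1 = - n%:R :> R); last by rewrite -natr1; ring.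
rewrite (_ : 1 + - n.+1%:R = - n%:R :> R); last by rewrite -natr1; ring.
move=> h; rewrite (_ : n.+1%:R = - (- n.+1%:R)%:C); last first.
  by rewrite rmorphN opprK rmorph_nat.
rewrite mulNr -h -mulNr; congr (_ * _).
by apply/eqP; rewrite eq_complex /= opprK !eqxx.
Qed.

(** Otherwise the recursion makes all coefficients of integer index vanish, hence by [vanish] all
    integrals against the weights, contrary to [nonvanish]. *)
Lemma outer_coef0_neq0 : outer_coef 0 != 0.
Proof.
apply/eqP => c0.
have cn n : outer_coef (- n%:R) = 0.
  elim: n => [|n IH]; first by rewrite oppr0.
  have := outer_coef_neg n; rewrite IH mulr0 => /eqP.
  by rewrite mulf_eq0 pnatr_eq0 /= => /eqP.
pose Z (m : R) := exists n : nat, m = n%:R \/ m = - n%:R.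
apply: nonvanish => N; apply: (@vanish Z).
- move=> m [[|n] [->|->]].
  + by exists 1%N; left; rewrite add0r.
  + by exists 1%N; left; rewrite oppr0 add0r.
  + by exists n.+2; left; rewrite natr1.
  + by exists n; right; rewrite -natr1; ring.
- move=> m [[|n] [->|->]].
  + by exists 1%N; right; rewrite add0r.
  + by exists 1%N; right; rewrite oppr0 add0r.
  + by exists n; left; rewrite -natr1 addrK.
  + by exists n.+2; right; rewrite -[n.+2%:R]natr1 opprD.
- move=> m [n mn]; have : outer_coef m = 0.
    by case: mn => ->; [case: n => [|n]; [exact: c0|exact: outer_coef_pos]|exact: cn].
  by rewrite outer_coefE => -[].
- by exists 0%N; left.
Qed.
End outer_symbol.

(** * Partial sums of the binomial coefficients and their asymptotics *)

Section binomial_sequence.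
Context (R : realType) (a : R) (g : nat -> R[i]).
Hypothesis g_rec : forall n, n.+1%:R * g n.+1 = (n%:R -i* a) * g n.
Hypothesis g0 : g 0%N != 0.

Definition harm (n : nat) : R := \sum_(i < n) i.+1%:R^-1.

Lemma harmS n : harm n.+1 = harm n + n.+1%:R^-1.
Proof. by rewrite /harm big_ord_recr. Qed.

Lemma harm_diff j k : (k <= j)%N -> 0 <= harm j - harm k <= (j - k)%:R / k.+1%:R.
Proof.
move=> kj; rewrite -(subnKC kj); elim: (j - k)%N => [|d IH].
  by rewrite addn0 subrr subnn mul0r lexx.
move: IH; rewrite !addKn addnS harmS addrAC => /andP[h0 h1].
have p : 0 <= (k + d).+1%:R^-1 :> R by rewrite invr_ge0.
rewrite addr_ge0//= -[d.+1%:R]natr1 mulrDl mul1r; apply: lerD => //.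
by rewrite lef_pV2 ?posrE ?ltr0n// ler_nat ltnS leq_addr.
Qed.

Let w (n : nat) : R[i] := \sum_(i < n) g i.

Let wS n : w n.+1 = w n + g n.
Proof. by rewrite /w big_ord_recr. Qed.

(** Coefficient form of [z d/dz (1 - z)^(i a) = - i a z (1 - z)^(i a - 1)]: up to the factor [g 0],
    [w n.+1] is the n-th coefficient of [(1 - z)^(i a - 1)]. *)
Let ng n : n%:R * g n = (0 -i* a) * w n.
Proof.
elim: n => [|n IH]; first by rewrite mul0r /w big_ord0 mulr0.
rewrite g_rec wS mulrDr -IH -mulrDl; congr (_ * _).
rewrite -(rmorph_nat (real_complex R)).
by apply/eqP; rewrite eq_complex /= addr0 add0r !eqxx.
Qed.

Let conj_ia : Num.conj (0 -i* a) = 0 +i* a :> R[i].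
Proof. by apply/eqP; rewrite eq_complex /= opprK !eqxx. Qed.

(** A discrete product rule: [ng] replaces [p g_p] and [q g_q] by multiples of [w p] and [w q], and
    the summand [- i a] supplies the product of the two increments. *)
Lemma binomial_telescope p q :
  ((p%:R - q%:R) -i* a) * (g p * Num.conj (g q)) =
  (0 -i* a) * (w p.+1 * Num.conj (w q.+1) - w p * Num.conj (w q)).
Proof.
have hq : q%:R * Num.conj (g q) = (0 +i* a) * Num.conj (w q).
  by rewrite -conj_ia -rmorphM -ng rmorphM rmorph_nat.
have -> : (p%:R - q%:R) -i* a = p%:R - q%:R + (0 -i* a) :> R[i].
  rewrite -!(rmorph_nat (real_complex R)) -rmorphB.
  by apply/eqP; rewrite eq_complex /= addr0 add0r !eqxx.
have -> : (p%:R - q%:R + (0 -i* a)) * (g p * Num.conj (g q)) =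
    (p%:R * g p) * Num.conj (g q) - g p * (q%:R * Num.conj (g q)) +
    (0 -i* a) * (g p * Num.conj (g q)) by ring.
rewrite ng hq !wS !rmorphD /=.
have -> : 0 +i* a = - (0 -i* a) :> R[i].
  by apply/eqP; rewrite eq_complex /= oppr0 opprK !eqxx.
by ring.
Qed.

(** The phase correction makes this converge: by [wrec] consecutive terms differ by the factor (1 -
    i x) exp (i x) = 1 + O(x^2), with x = a / (n + 1). *)
Let q (n : nat) : R[i] := w n.+1 * expi (a * harm n).

Let wrec n : w n.+2 = w n.+1 * (1 -i* (a / n.+1%:R)).
Proof.
have n0 : n.+1%:R != 0 :> R[i] by rewrite pnatr_eq0.
rewrite wS; have := ng n.+1 => h.
have -> : g n.+1 = (0 -i* a) * w n.+1 / n.+1%:R by rewrite -h [n.+1%:R * _]mulrC mulfK.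
rewrite -(rmorph_nat (real_complex R)) -fmorphV mulrAC.
rewrite (_ : (0 -i* a) * _ = 0 -i* (a / n.+1%:R)); last first.
  by apply/eqP; rewrite eq_complex /= !(mul0r, mulr0) subr0 add0r mulNr !eqxx.
rewrite -[X in X + _]mulr1 [_ * w _]mulrC -mulrDr; congr (_ * _).
by apply/eqP; rewrite eq_complex /= addr0 add0r !eqxx.
Qed.

Let w_sqr n : rnorm (w n.+2) ^+ 2 = rnorm (w n.+1) ^+ 2 * (1 + (a / n.+1%:R) ^+ 2).
Proof. by rewrite wrec cnormM exprMn [in X in _ * X]cnormE2 /= expr1n sqrrN. Qed.

(** By [w_sqr] the squared moduli grow by the factors 1 + a^2 / (n + 1)^2, whose product is at most
    exp (2 a^2) since the inverse squares sum to at most 2. *)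
Let M := rnorm (g 0%N) * expR (a ^+ 2).

Let w1 : w 1 = g 0%N. Proof. by rewrite /w big_ord1. Qed.

Let w_lower n : rnorm (g 0%N) <= rnorm (w n.+1).
Proof.
elim: n => [|n IH]; first by rewrite w1.
apply: le_trans IH _; rewrite -(@ler_pXn2r _ 2) ?nnegrE ?rnorm_ge0//.
by rewrite w_sqr ler_peMr ?sqr_ge0// lerDl sqr_ge0.
Qed.

Let w_upper n : rnorm (w n.+1) <= M.
Proof.
have h : rnorm (w n.+1) ^+ 2 <= rnorm (g 0%N) ^+ 2 * expR (a ^+ 2 * \sum_(i < n) i.+1%:R^-1 ^+ 2).
  elim: n => [|n IH]; first by rewrite w1 big_ord0 mulr0 expR0 mulr1.
  rewrite w_sqr big_ord_recr /= [a ^+ 2 * (_ + _)]mulrDr expRD mulrA.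
  apply: ler_pM => //; rewrite ?sqr_ge0 ?addr_ge0 ?sqr_ge0//.
  by rewrite exprMn; exact: expR_ge1Dx.
rewrite -(@ler_pXn2r _ 2) ?nnegrE ?rnorm_ge0 ?mulr_ge0 ?rnorm_ge0 ?expR_ge0//.
apply: le_trans h _; rewrite exprMn ler_wpM2l ?sqr_ge0//.
rewrite -expRM_natl ler_expR mulr_natl -mulr_natr ler_wpM2l ?sqr_ge0//.
exact: sum_inv_sqr.
Qed.

Let q_norm n : rnorm (q n) = rnorm (w n.+1).
Proof. by rewrite cnormM expi_norm mulr1. Qed.

Let q_step n : rnorm (q n.+1 - q n) <= 2 * M * a ^+ 2 * n.+1%:R^-1 ^+ 2.
Proof.
set x := a / n.+1%:R.
have -> : q n.+1 - q n = - (w n.+1 * expi (a * harm n.+1) * (expi (- x) - (1 +i* (- x)))).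
  rewrite /q wrec harmS mulrDr -/x !expiD mulrBr !mulrA opprB; congr (_ - _).
    by ring.
  by rewrite -[RHS]mulrA -expiD subrr expi0 mulr1.
rewrite rnormN !cnormM expi_norm mulr1.
apply: le_trans (ler_pM _ _ (w_upper n) (rnorm_expi_sub_linear (- x))) _; rewrite ?rnorm_ge0//.
by rewrite sqrrN /x exprMn le_eqVlt; apply/orP; left; apply/eqP; ring.
Qed.

(** Twice the constant of [q_step]: 1 / x^2 <= 2 (1 / x - 1 / (x + 1)) for x >= 1, which lets the
    steps telescope. *)
Let C := 4 * M * a ^+ 2.

Let M0 : 0 <= M. Proof. by rewrite mulr_ge0 ?rnorm_ge0 ?expR_ge0. Qed.

Let C0 : 0 <= C. Proof. by apply: mulr_ge0; [exact: mulr_ge0|exact: sqr_ge0]. Qed.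

Let q_cauchy m n : (n <= m)%N -> rnorm (q m - q n) <= C / n.+1%:R.
Proof.
move=> nm.
suff: rnorm (q m - q n) <= C / n.+1%:R - C / m.+1%:R.
  by move=> h; apply: le_trans h _; rewrite gerBl divr_ge0.
rewrite -(subnKC nm); elim: (m - n)%N => [|d IH].
  by rewrite addn0 !subrr rnorm0.
rewrite addnS -(subrK (q (n + d)) (q (n + d).+1)) -addrA.
apply: le_trans (rnormD _ _) _; apply: le_trans (lerD (q_step _) IH) _.
set k := (n + d)%N.
have p1 : 1 <= (k.+1%:R : R) by rewrite ler1n.
have p2 : (k.+2%:R : R) = k.+1%:R + 1 by rewrite -natr1.
rewrite addrCA lerD2l -subr_ge0 p2 /C; move: (k.+1%:R) p1 => x p1.
rewrite (_ : _ - _ = 2 * M * a ^+ 2 * (x - 1) / (x ^+ 2 * (x + 1))); last first.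
  by field; rewrite !gt_eqF//; lra.
apply: divr_ge0; apply: mulr_ge0; rewrite ?sqr_ge0//; try lra.
by apply: mulr_ge0; [exact: mulr_ge0|exact: sqr_ge0].
Qed.

Let q_limit : exists l, forall n, rnorm (q n - l) <= 2 * C / n.+1%:R.
Proof.
(* The intervals [u n - e n, u n + e n] meet pairwise, so the supremum of their left ends lies in
   all of them. *)
have real_limit (u : nat -> R) (e : nat -> R) : (forall k, 0 <= e k) ->
    (forall m n, (n <= m)%N -> `|u m - u n| <= e n) -> exists l, forall n, `|u n - l| <= e n.
  move=> p uC; pose S := range (fun n => u n - e n).
  have ub m n : u m - e m <= u n + e n.
    have [nm|/ltnW mn] := leqP n m.
      have := uC m n nm; rewrite ler_norml => /andP[_]; have := p m; lra.
    have := uC n m mn; rewrite ler_norml => /andP[h _]; have := p n; lra.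
  have hs : has_sup S.
    split; first by exists (u 0%N - e 0%N), 0%N.
    by exists (u 0%N + e 0%N) => _ [m _ <-]; exact: ub.
  exists (sup S) => n; rewrite ler_norml; apply/andP; split.
    rewrite lerNl opprB lerBlDr addrC; apply: ge_sup; first exact: hs.1.
    by move=> _ [m _ <-]; exact: ub.
  rewrite lerBlDr -lerBlDl; apply: ub_le_sup; [exact: hs.2|by exists n].
have e0 k : 0 <= C / k.+1%:R by rewrite divr_ge0.
have [l1 l1P] : exists l, forall n, `|complex.Re (q n) - l| <= C / n.+1%:R.
  apply: (real_limit _ (fun n => C / n.+1%:R)) => // m n nm; apply: le_trans (q_cauchy nm).
  by rewrite -raddfB; exact: cRe_le.
have [l2 l2P] : exists l, forall n, `|complex.Im (q n) - l| <= C / n.+1%:R.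
  apply: (real_limit _ (fun n => C / n.+1%:R)) => // m n nm; apply: le_trans (q_cauchy nm).
  by rewrite -raddfB; exact: cIm_le.
exists (l1 +i* l2) => n; apply: le_trans (rnorm_le_abs _) _.
have := l1P n; have := l2P n; case: (q n) => x y /= h1 h2.
by rewrite -mulrA mulr_natl mulr2n lerD.
Qed.

(** [kappa] is the squared modulus of the limit of [q]. It is positive because |1 - i x| >= 1 keeps
    the moduli of [w 1], [w 2], ... above that of [g 0]. *)
Lemma binomial_asymptotics : exists (kappa K : R), [/\ 0 < kappa, 0 <= K,
  (forall j k, rnorm (w j.+1 * Num.conj (w k.+1) -
     kappa%:C * expi (- (a * (harm j - harm k)))) <= K * (j.+1%:R^-1 + k.+1%:R^-1)) &
  (forall n, rnorm (w n) <= K)].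
Proof.
have [l lP] := q_limit.
have lM : rnorm l <= M.
  apply/ler_addgt0Pl => r r0.
  have [n nP] : exists n : nat, 2 * C / n.+1%:R <= r.
    exists (Num.truncn (2 * C / r)); rewrite ler_pdivrMr// [r * _]mulrC -ler_pdivrMr// ltW//.
    exact: truncnS_gt.
  rewrite -(subrK (q n) l); apply: le_trans (rnormD _ _) _; apply: lerD.
    by rewrite rnormBC (le_trans (lP n)).
  by rewrite q_norm.
have ll : rnorm (g 0%N) <= rnorm l.
  apply/ler_addgt0Pl => r r0.
  have [n nP] : exists n : nat, 2 * C / n.+1%:R <= r.
    exists (Num.truncn (2 * C / r)); rewrite ler_pdivrMr// [r * _]mulrC -ler_pdivrMr// ltW//.
    exact: truncnS_gt.
  apply: le_trans (w_lower n) _; rewrite -q_norm -(subrK l (q n)).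
  by apply: le_trans (rnormD _ _) _; rewrite lerD2r (le_trans (lP n)).
have gp : 0 < rnorm (g 0%N).
  rewrite lt_def rnorm_ge0 andbT; apply: contra g0 => /eqP h.
  by apply/eqP; exact: rnorm_eq0.
exists (rnorm l ^+ 2), (M * (2 * C) + M); split.
- by rewrite exprn_gt0// (lt_le_trans gp).
- by rewrite addr_ge0// mulr_ge0// mulr_ge0.
- move=> j k.
  have wE n : w n.+1 = q n * expi (- (a * harm n)).
    by rewrite /q -mulrA -expiD subrr expi0 mulr1.
  have -> : w j.+1 * Num.conj (w k.+1) - (rnorm l ^+ 2)%:C * expi (- (a * (harm j - harm k))) =
      (q j * Num.conj (q k) - l * Num.conj l) * expi (- (a * (harm j - harm k))).
    rewrite !wE rmorphM /= -expiN opprK mulrACA -expiD.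
    rewrite (_ : - (a * harm j) + a * harm k = - (a * (harm j - harm k))); last by ring.
    by rewrite mulrBl; congr (_ - _ * _); rewrite rmorphXn /= -rnormE normCK.
  rewrite cnormM expi_norm mulr1.
  rewrite (_ : _ - _ = (q j - l) * Num.conj (q k) + l * Num.conj (q k - l)); last first.
    by rewrite rmorphB; ring.
  apply: le_trans (rnormD _ _) _; rewrite !cnormM !cnorm_conj.
  apply: le_trans (_ : M * (2 * C) * (j.+1%:R^-1 + k.+1%:R^-1) <= _); last first.
    by rewrite ler_wpM2r ?addr_ge0 ?invr_ge0// lerDl.
  rewrite mulrDr; apply: lerD.
    rewrite mulrC -mulrA; apply: ler_pM; rewrite ?rnorm_ge0// q_norm.
    exact: w_upper.
  by rewrite -mulrA; apply: ler_pM; rewrite ?rnorm_ge0.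
- move=> n; apply: le_trans (_ : M <= _); last by rewrite lerDr mulr_ge0// mulr_ge0.
  by case: n => [|n]; [rewrite /w big_ord0 rnorm0|exact: w_upper].
Qed.
End binomial_sequence.

(** * The self-commutator of a Toeplitz operator *)

Section parseval.
Context (R : realType).
Local Notation e := (H2monomial R).
Implicit Types u v : H2 R.

Lemma H2dot_hsum N (x : nat -> R[i]) m :
  H2dot (hsum N x) (e m) = if (m < N)%N then x m else 0.
Proof. by rewrite /H2dot /= val_hsum L2dot_suml. Qed.

Lemma dot_hsum_eq0 u N (x : nat -> R[i]) : (forall m, (m < N)%N -> H2dot u (e m) = 0) ->
  H2dot u (hsum N x) = 0.
Proof.
move=> ue; rewrite /hsum linear_sumr big1// => k _.
by rewrite linearZr_LR /= ue ?mulr0.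
Qed.

(** By Pythagoras the Fourier partial sum is the best approximation among combinations of the first
    monomials, so density is enough. *)
Lemma hsum_coef_cvg u (r : R) : 0 < r -> exists N0, forall N, (N0 <= N)%N ->
  rnorm (u - hsum N (fun m => H2dot u (e m))) <= r.
Proof.
move=> r0; have [N0 [x ux]] := hsum_dense u r0; exists N0 => N NN.
set uN := hsum N _; set p := hsum N0 x in ux.
have orth : H2dot (u - uN) (uN - p) = 0.
  have oe m : (m < N)%N -> H2dot (u - uN) (e m) = 0.
    by move=> mN; rewrite linearBl /= H2dot_hsum mN subrr.
  rewrite linearBr /= !dot_hsum_eq0 ?subrr// => m mN; apply: oe => //.
  exact: leq_trans mN NN.
apply: le_trans ux; rewrite -(@ler_pXn2r _ 2) ?nnegrE ?rnorm_ge0//.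
have -> : u - p = (u - uN) + (uN - p) by rewrite addrA subrK.
have -> : rnorm (u - uN + (uN - p)) ^+ 2 = rnorm (u - uN) ^+ 2 + rnorm (uN - p) ^+ 2.
  by apply/complexI; rewrite rmorphD/= !rnorm_sqr_H2 hnormDd.
by rewrite lerDl sqr_ge0.
Qed.

Lemma parseval u v (r : R) : 0 < r -> exists N0, forall N, (N0 <= N)%N ->
  rnorm (H2dot u v - \sum_(m < N) H2dot u (e m) * Num.conj (H2dot v (e m))) <= r.
Proof.
move=> r0; have V0 := rnorm_ge0 v; have v1 : 0 < rnorm v + 1 by rewrite ltr_wpDl.
have [N0 N0P] := hsum_coef_cvg u (divr_gt0 r0 v1).
exists N0 => N NN.
have -> : \sum_(m < N) H2dot u (e m) * Num.conj (H2dot v (e m)) =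
    H2dot (hsum N (fun m => H2dot u (e m))) v.
  rewrite /hsum linear_sumlz; apply: eq_bigr => m _.
  by rewrite linearZl_LR /= [H2dot (e m) v]H2dot_conj mul1r.
rewrite -linearBl; apply: le_trans (rnorm_H2dot _ _) _.
apply: le_trans (_ : r / (rnorm v + 1) * (rnorm v + 1) <= _); last by rewrite divfK ?gt_eqF.
by apply: ler_pM; [exact: rnorm_ge0|exact: rnorm_ge0|exact: N0P|rewrite lerDl].
Qed.
End parseval.

Section symbol_commutator.
Context (R : realType) (a : R).
Local Notation e := (H2monomial R).

Let g (n : nat) : R[i] := outer_coef a (- n%:R).

Lemma outer_toeplitz_pair : exists G G' : H2 R -> H2 R,
  [/\ toeplitz_algebra R G, toeplitz_algebra R G', bounded_operator G, bounded_operator G' &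
   [/\ forall u v, H2dot (G u) v = H2dot u (G' v),
       forall u v, H2dot (G' u) v = H2dot u (G v) &
       forall k m, H2dot (G (e k)) (e m) = if (k <= m)%N then g (m - k) else 0]].
Proof.
pose b := Build_Linfty (outer_sym_Linfty a).
exists (toeplitz b), (toeplitz (Linfty_conj b)); split.
- exact: toeplitz_in_algebra.
- exact: toeplitz_in_algebra.
- exact: toeplitz_bounded.
- exact: toeplitz_bounded.
split=> [u v|u v|k m]; first exact: toeplitz_adj.
  by rewrite H2dot_conj mul1r -toeplitz_adj [RHS]H2dot_conj mul1r.
rewrite toeplitz_entry -/(outer_coef a _); case: leqP => km.
  by rewrite /g natrB// opprB.
have -> : k%:R - m%:R = (k - m).-1.+1%:R :> R.
  by rewrite prednK ?subn_gt0// natrB// ltnW.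
exact: outer_coef_pos.
Qed.

Let gE n : n.+1%:R * g n.+1 = (n%:R -i* a) * g n.
Proof. exact: outer_coef_neg. Qed.

Let g00 : g 0%N != 0.
Proof. by rewrite /g oppr0 outer_coef0_neq0. Qed.

Let w (n : nat) : R[i] := \sum_(i < n) g i.

Let w0 : w 0 = 0. Proof. by rewrite /w big_ord0. Qed.

Let delta (j k : nat) : R[i] := (j%:R - k%:R) -i* a.

(** Truncation of the inner product of [G e_k] and [G e_j]. Truncated subtraction is harmless: for N
    up to the larger of j and k all terms vanish, and so does [w 0] on the right. *)
Let upper_sum (j k N : nat) :
  delta j k * (\sum_(m < N) (if (k <= m)%N then g (m - k) else 0) *
    Num.conj (if (j <= m)%N then g (m - j) else 0)) =
  (0 -i* a) * (w (N - k) * Num.conj (w (N - j))).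
Proof.
elim: N => [|N IH]; first by rewrite big_ord0 !sub0n w0 mul0r !mulr0.
rewrite big_ord_recr /= mulrDr IH.
case: (leqP k N) => kN; last first.
  have /eqP -> : (N.+1 - k == 0)%N by rewrite subn_eq0.
  have /eqP -> : (N - k == 0)%N by rewrite subn_eq0 ltnW.
  by rewrite w0 !mul0r !mulr0 addr0.
case: (leqP j N) => jN; last first.
  have /eqP -> : (N.+1 - j == 0)%N by rewrite subn_eq0.
  have /eqP -> : (N - j == 0)%N by rewrite subn_eq0 ltnW.
  by rewrite w0 conjC0 !mulr0 addr0.
rewrite !subSn// (_ : delta j k = ((N - k)%:R - (N - j)%:R) -i* a); last first.
  by rewrite /delta !natrB//; congr (_ -i* _); ring.
by rewrite (binomial_telescope gE) -mulrDr addrC subrK.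
Qed.

(** The same for [G' e_k] and [G' e_j]. The terms stop at the smaller of j and k, after which one of
    the truncated differences is 0 and only the product at [j.+1], [k.+1] is left. *)
Let lower_sum (j k N : nat) :
  delta j k * (\sum_(m < N) Num.conj (if (m <= k)%N then g (k - m) else 0) *
    Num.conj (Num.conj (if (m <= j)%N then g (j - m) else 0))) =
  (0 -i* a) * (w j.+1 * Num.conj (w k.+1) - w (j.+1 - N) * Num.conj (w (k.+1 - N))).
Proof.
elim: N => [|N IH]; first by rewrite big_ord0 !subn0 subrr !mulr0.
rewrite big_ord_recr /= mulrDr IH !subSS.
case: (leqP N k) => kN; last first.
  have /eqP -> : (k.+1 - N == 0)%N by rewrite subn_eq0.
  have /eqP -> : (k - N == 0)%N by rewrite subn_eq0 ltnW.
  by rewrite w0 conjC0 mul0r !mulr0 addr0.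
case: (leqP N j) => jN; last first.
  have /eqP -> : (j.+1 - N == 0)%N by rewrite subn_eq0.
  have /eqP -> : (j - N == 0)%N by rewrite subn_eq0 ltnW.
  by rewrite w0 !conjC0 !mul0r !mulr0 addr0.
rewrite !subSn// (_ : delta j k = ((j - N)%:R - (k - N)%:R) -i* a); last first.
  by rewrite /delta !natrB//; congr (_ -i* _); ring.
rewrite conjCK [Num.conj _ * _]mulrC (binomial_telescope gE) -mulrDr.
by rewrite addrA subrK.
Qed.

Let pred_subn n0 q N m : (n0 + q.+1 <= N)%N -> (m <= q)%N ->
  (N - m = (N - m).-1.+1)%N /\ (n0 <= (N - m).-1)%N.
Proof. by move=> *; split; lia. Qed.

Let pred_subn_dist j k N :
  ((N - k).-1 - (N - j).-1 <= j + k)%N /\ ((N - j).-1 - (N - k).-1 <= j + k)%N.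
Proof. by split; lia. Qed.

(** The inner product of [G e_k] and [G e_j] is a limit by Parseval, and in [upper_sum] the boundary
    term tends to [kappa], because its two indices go to infinity at a fixed distance. The other
    inner product is a finite sum, given by [lower_sum]. *)
Lemma commutator_entry (G G' : H2 R -> H2 R) (kappa K : R) (j k : nat) :
  (forall u v, H2dot (G u) v = H2dot u (G' v)) ->
  (forall u v, H2dot (G' u) v = H2dot u (G v)) ->
  (forall k m, H2dot (G (e k)) (e m) = if (k <= m)%N then g (m - k) else 0) ->
  0 < kappa -> 0 <= K ->
  (forall j k, rnorm (w j.+1 * Num.conj (w k.+1) -
     kappa%:C * expi (- (a * (harm R j - harm R k)))) <= K * (j.+1%:R^-1 + k.+1%:R^-1)) ->
  delta j k * entry ((G' \o G) \- (G \o G')) j k =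
  (0 -i* a) * (kappa%:C - w j.+1 * Num.conj (w k.+1)).
Proof.
move=> adj adj' GE kap K0 wP.
have G'E i m : H2dot (G' (e i)) (e m) = Num.conj (if (m <= i)%N then g (i - m) else 0).
  by rewrite adj' H2dot_conj mul1r GE.
have -> : entry ((G' \o G) \- (G \o G')) j k =
    H2dot (G (e k)) (G (e j)) - H2dot (G' (e k)) (G' (e j)).
  have -> : entry ((G' \o G) \- (G \o G')) j k =
      H2dot (G' (G (e k))) (e j) - H2dot (G (G' (e k))) (e j) by rewrite -linearBl.
  by rewrite adj' (adj (G' _)).
apply/eqP; rewrite -subr_eq0; apply/eqP/rnorm_le0/ler_addgt0Pl => r r0; rewrite addr0.
pose c := rnorm (delta j k); have c0 : 0 <= c by exact: rnorm_ge0.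
have rc : 0 < r / (4 * (c + 1)) by rewrite divr_gt0// mulr_gt0// ltr_wpDl.
have [N1 N1P] := parseval (G (e k)) (G (e j)) rc.
have [N2 N2P] := parseval (G' (e k)) (G' (e j)) rc.
(* [L / n0.+1] bounds the error from the boundary term: 2 K comes from the asymptotics of [w], the
   rest from the phase, since harmonic numbers with indices at least n0 and at distance at most j +
   k differ by at most (j + k) / (n0 + 1). *)
pose L := (`|a| * (2 * K + kappa * `|a| * (j + k)%:R)).
have L0 : 0 <= L by rewrite mulr_ge0// addr_ge0 ?mulr_ge0// ltW.
pose n0 := Num.truncn (2 * L / r).
pose N := (maxn (maxn N1 N2) n0 + (j + k).+1)%N.
have NN1 : (N1 <= N)%N by rewrite (leq_trans _ (leq_addr _ _))// -maxnA leq_maxl.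
have NN2 : (N2 <= N)%N by rewrite (leq_trans _ (leq_addr _ _))// maxnAC leq_maxr.
have Nn0 : (n0 + (j + k).+1 <= N)%N by rewrite leq_add2r leq_maxr.
have := N1P N NN1; have := N2P N NN2.
under eq_bigr do rewrite !G'E; under [in X in _ -> X -> _]eq_bigr do rewrite !GE.
set S1 := \sum_(m < N) _; set S2 := \sum_(m < N) _ => h2 h1.
have e1 := upper_sum j k N; have e2 := lower_sum j k N.
rewrite -/S1 in e2; rewrite -/S2 in e1.
have Nle m : (m <= j + k)%N -> (m.+1 - N == 0)%N.
  by move=> mjk; rewrite subn_eq0 (leq_trans _ Nn0)// (leq_trans _ (leq_addl _ _)).
rewrite (eqP (Nle j (leq_addr _ _))) (eqP (Nle k (leq_addl _ _))) w0 mul0r subr0 in e2.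
have Njk m : (m <= j + k)%N -> (N - m = (N - m).-1.+1)%N /\ (n0 <= (N - m).-1)%N.
  by move=> mjk; exact: pred_subn Nn0 mjk.
have [Nk k0] := Njk k (leq_addl _ _); have [Nj j0] := Njk j (leq_addr _ _).
rewrite Nk Nj in e1.
set X := w _ * _ in e1.
have hh p q : (n0 <= p)%N -> (n0 <= q)%N -> (p - q <= j + k)%N -> (q - p <= j + k)%N ->
    `|harm R p - harm R q| <= (j + k)%:R / n0.+1%:R.
  have main p' q' : (n0 <= q')%N -> (q' <= p')%N -> (p' - q' <= j + k)%N ->
      `|harm R p' - harm R q'| <= (j + k)%:R / n0.+1%:R.
    move=> nq qp pq; have /andP[h0 hd] := harm_diff R qp.
    rewrite ger0_norm//; apply: le_trans hd _.
    by apply: ler_pM; rewrite ?invr_ge0 ?ler_nat// lef_pV2 ?posrE// ler_nat.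
  move=> np nq pq qp; have [qp'|/ltnW pq'] := leqP q p; first exact: main.
  by rewrite distrC; exact: main.
have Xk : rnorm (X - kappa%:C) <= (2 * K + kappa * `|a| * (j + k)%:R) / n0.+1%:R.
  have := wP (N - k).-1 (N - j).-1; rewrite -/X.
  set t := a * _; move=> Xw.
  have -> : X - kappa%:C = (X - kappa%:C * expi (- t)) + kappa%:C * (expi (- t) - 1) by ring.
  apply: le_trans (rnormD _ _) _; rewrite mulrDl; apply: lerD.
    apply: le_trans Xw _; rewrite [2 * K]mulrC -mulrA ler_wpM2l// [2 * _]mulr_natl mulr2n.
    by apply: lerD; rewrite lef_pV2 ?posrE// ler_nat.
  rewrite cnormM cnorm_real (gtr0_norm kap) -!mulrA ler_wpM2l//; first exact: ltW.
  apply: le_trans (rnorm_expi_sub1 _) _; rewrite normrN normrM ler_wpM2l//.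
  have [jk kj] := pred_subn_dist j k N; exact: hh.
have n0r : L / n0.+1%:R <= r / 2.
  rewrite ler_pdivrMr// -ler_pdivrMl ?divr_gt0// invf_div mulrAC mulrC.
  by apply: ltW; rewrite [X in X < _](_ : _ = 2 * L / r); [exact: truncnS_gt|ring].
set HG := H2dot (G _) _ in h1 *; set HG' := H2dot (G' _) _ in h2 *.
have -> : delta j k * (HG - HG') - (0 -i* a) * (kappa%:C - w j.+1 * Num.conj (w k.+1)) =
    delta j k * (HG - S2) - delta j k * (HG' - S1) + (0 -i* a) * (X - kappa%:C).
  by rewrite [delta j k * (HG - S2)]mulrBr [delta j k * (HG' - S1)]mulrBr e1 e2; ring.
apply: le_trans (rnormD _ _) _.
have cr : c * (r / (4 * (c + 1))) <= r / 4.
  move: c c0 {h1 h2 rc N1P N2P} => c' c0; have c1 : 0 < c' + 1 by rewrite ltr_wpDl.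
  rewrite mulrA ler_pdivrMr ?mulr_gt0//.
  rewrite [leRHS](_ : _ = r * (c' + 1)); last by field.
  by rewrite mulrC; apply: ler_wpM2l; [exact: ltW|rewrite lerDl].
have -> : r = (r / 4 + r / 4) + r / 2 by field.
apply: lerD.
  apply: le_trans (rnormD _ _) _; rewrite rnormN !cnormM; apply: lerD; apply: le_trans cr.
    by rewrite ler_wpM2l.
  by rewrite ler_wpM2l.
apply: le_trans n0r; rewrite cnormM (_ : rnorm (0 -i* a) = `|a|); last first.
  apply/eqP; rewrite -(@eqrXn2 _ 2) ?rnorm_ge0// cnormE2 /= expr0n add0r sqrrN.
  by rewrite real_normK ?num_real.
by rewrite /L -mulrA ler_wpM2l.
Qed.

Lemma symbol_commutator : exists (G G' : H2 R -> H2 R) (w : nat -> R[i]) (kappa K : R),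
  [/\ toeplitz_algebra R G, toeplitz_algebra R G', bounded_operator G, bounded_operator G' &
   [/\ 0 < kappa, 0 <= K,
     forall j k, rnorm (w j * Num.conj (w k) -
       kappa%:C * expi (- (a * (harm R j - harm R k)))) <= K * (j.+1%:R^-1 + k.+1%:R^-1) &
     forall j k, ((j%:R - k%:R) -i* a) * entry ((G' \o G) \- (G \o G')) j k =
       (0 -i* a) * (kappa%:C - w j * Num.conj (w k))]].
Proof.
have [G [G' [TG TG' bG bG' [adj adj' GE]]]] := outer_toeplitz_pair.
have [kappa [K [kap K0 wP _]]] := binomial_asymptotics gE g00.
exists G, G', (fun n => w n.+1), kappa, K; split => //; split => // j k.
exact: (commutator_entry j k adj adj' GE kap K0 wP).
Qed.
End symbol_commutator.

(** * Kernels in the ideal up to Hilbert-Schmidt errors *)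

Section model_kernels.
Context (R : realType) (J : set (H2 R -> H2 R)).
Hypothesis J_ideal : closed_ideal (toeplitz_algebra R) J.
Hypothesis J_comm : forall A B, toeplitz_algebra R A -> toeplitz_algebra R B ->
  J ((A \o B) \- (B \o A)).

Lemma rhoE j k : rho R j k = ((`|j%:R - k%:R| + 1) * (minn j k).+1%:R)^-1.
Proof.
rewrite /rho -natr1; congr ((_ + 1) * _)^-1.
have [jk|/ltnW kj] := leqP j k.
  by rewrite distrC ger0_norm ?subr_ge0 ?ler_nat// natrB.
by rewrite ger0_norm ?subr_ge0 ?ler_nat// natrB.
Qed.

Lemma natr_dist_ge1 (j k : nat) : j%:R - k%:R != 0 :> R -> 1 <= `|j%:R - k%:R| :> R.
Proof.
rewrite subr_eq0 eqr_nat neq_ltn => /orP[jk|kj].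
  by rewrite distrC ger0_norm ?subr_ge0 ?ler_nat ?(ltnW jk)// -natrB ?(ltnW jk)// ler1n subn_gt0.
by rewrite ger0_norm ?subr_ge0 ?ler_nat ?(ltnW kj)// -natrB ?(ltnW kj)// ler1n subn_gt0.
Qed.

Lemma harm_dist j k : `|harm R j - harm R k| <= `|j%:R - k%:R| / (minn j k).+1%:R.
Proof.
have main j' k' : (k' <= j')%N ->
    `|harm R j' - harm R k'| <= `|j'%:R - k'%:R| / k'.+1%:R.
  move=> kj; have /andP[h0 h1] := harm_diff R kj.
  by rewrite (ger0_norm h0) ger0_norm ?subr_ge0 ?ler_nat// -natrB.
have [jk|/ltnW kj] := leqP j k; last exact: main.
by rewrite distrC [`|j%:R - _|]distrC; exact: main.
Qed.

(* It vanishes on the diagonal, where the denominator is 0. *)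
Definition model_kernel (p : R -> R[i]) j k : R[i] :=
  (p (harm R j - harm R k) - p 0) / (j%:R - k%:R).

Definition realizable (p : R -> R[i]) := exists (B : H2 R -> H2 R) (K : R),
  [/\ J B, bounded_operator B &
   forall j k, rnorm (entry B j k - model_kernel p j k) <= K * rho R j k].

Lemma realizable_cst (c : R[i]) : realizable (fun=> c).
Proof.
exists (fun=> 0), 0; split; first exact: ideal0 J_ideal.
  apply/boundedP; first by move=> d f g; rewrite scaler0 addr0.
  by exists 0 => // f; rewrite rnorm0 mul0r.
by move=> j k; rewrite /model_kernel /entry linear0l subrr mul0r subr0 rnorm0 mul0r.
Qed.

Lemma realizableD p q : realizable p -> realizable q -> realizable (fun s => p s + q s).
Proof.
move=> [A [K [JA bA AP]]] [B [M [JB bB BP]]].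
exists (A \+ B), (K + M); split; first exact: idealD J_ideal _ _ JA JB.
  exact: bounded_operatorD.
move=> j k; have -> : entry (A \+ B) j k = entry A j k + entry B j k by rewrite /entry linearDl.
rewrite (_ : _ - _ = (entry A j k - model_kernel p j k) + (entry B j k - model_kernel q j k)).
  by rewrite mulrDl; apply: le_trans (rnormD _ _) _; exact: lerD.
by rewrite /model_kernel; ring.
Qed.

Lemma realizableZ (c : R[i]) p : realizable p -> realizable (fun s => c * p s).
Proof.
move=> [A [K [JA bA AP]]]; exists (fun f => c *: A f), (rnorm c * K); split.
- exact: idealZ J_ideal _ _ JA.
- exact: bounded_operatorZ.
- move=> j k; have -> : entry (fun f => c *: A f) j k = c * entry A j k by rewrite /entry linearZl_LR.
  rewrite (_ : _ - _ = c * (entry A j k - model_kernel p j k)).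
    by rewrite cnormM -mulrA; apply: ler_wpM2l; [exact: rnorm_ge0|].
  by rewrite /model_kernel; ring.
Qed.

(** Up to a scalar the commutator for the exponent - a has entries (x - kappa) / (d + i a), with d =
    j - k and x close to kappa e. Replacing x by kappa e costs O(1 / m) / |d + i a|, where m is min
    j k + 1. Replacing d + i a by d off the diagonal costs |e - 1| |a| / (|d| |d + i a|), which is
    small enough because |e - 1| <= |a| |d| / m. *)
Lemma realizable_expi (a : R) : realizable (fun s => expi (a * s)).
Proof.
have [->|a0] := eqVneq a 0.
  rewrite (_ : (fun _ => _) = fun=> 1); first exact: realizable_cst.
  by apply/funext => s; rewrite mul0r expi0.
have [G [G' [w [kappa [K [TG TG' bG bG' [kap K0 wP ent]]]]]]] := symbol_commutator (- a).
pose z : R[i] := 0 +i* (- (a * kappa)).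
(* 2 a^2 pays for the change of denominator, by 1 / |d| <= 2 / (|d| + 1); in the other summand 2 + 1
   / |a| bounds (|d| + 1) / |d + i a| both off and on the diagonal. *)
exists (fun f => z^-1 *: ((G' \o G) \- (G \o G')) f),
  (2 * a ^+ 2 + (kappa^-1 * 2 * K) * (2 + `|a|^-1)); split.
- exact: idealZ J_ideal _ _ (J_comm TG' TG).
- by apply/bounded_operatorZ/bounded_operatorB; exact: bounded_operatorM.
move=> j k; set B := _ \- _ in ent *.
have -> : entry (fun f => z^-1 *: B f) j k = z^-1 * entry B j k by rewrite /entry linearZl_LR.
have := ent j k; have := wP j k; rewrite !mulNr !opprK => E ejk.
set d : R := j%:R - k%:R in ejk.
set s := harm R j - harm R k in E *.
pose m : R := (minn j k).+1%:R; have m0 : 0 < m by rewrite ltr0n.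
have rE : rho R j k = ((`|d| + 1) * m)^-1 by rewrite rhoE.
pose dl : R[i] := d +i* a.
have dl_d : `|d| <= rnorm dl by have := cRe_le dl.
have dl_a : `|a| <= rnorm dl by have := cIm_le dl.
have dl_0 : 0 < rnorm dl by apply: lt_le_trans dl_a; rewrite normr_gt0.
have dl0 : dl != 0 by apply: contraTneq dl_0 => ->; rewrite rnorm0 ltxx.
have z0 : z != 0 by rewrite eq_complex /= negb_and oppr_eq0 mulf_neq0 ?orbT// gt_eqF.
have kC0 : kappa%:C != 0 :> R[i] by rewrite eq_complex /= negb_and gt_eqF.
set x := w j * _ in E ejk.
have Bjk : z^-1 * entry B j k = (kappa%:C)^-1 * (x - kappa%:C) / dl.
  apply: (mulfI z0); rewrite mulVKf//; apply: (mulfI dl0); rewrite ejk.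
  rewrite [RHS](_ : _ = z / kappa%:C * (x - kappa%:C)); last by field; rewrite dl0 kC0.
  have -> : z / kappa%:C = 0 +i* - a.
    apply: (mulIf kC0); rewrite divfK//; apply/eqP; rewrite eq_complex /=.
    by apply/andP; split; apply/eqP; ring.
  by rewrite -[x - _]opprB mulrN -mulNr; congr (_ * _); apply/eqP; rewrite eq_complex /=;
    apply/andP; split; apply/eqP; ring.
set e := expi (a * s) in E.
have [e1 ds] : rnorm (e - 1) <= `|a| * (`|d| / m) /\ (d = 0 -> s = 0).
  split; last by move=> d0; apply/eqP; rewrite -normr_le0; have := harm_dist j k;
    rewrite -/d d0 normr0 mul0r.
  by apply: le_trans (rnorm_expi_sub1 _) _; rewrite normrM ler_wpM2l//; exact: harm_dist.
rewrite Bjk /model_kernel -/s mulr0 expi0 -/e.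
have -> : j%:R - k%:R = d%:C :> R[i] by rewrite rmorphB /= !rmorph_nat.
rewrite (_ : _ - _ = kappa%:C^-1 * (x - kappa%:C * e) / dl + (e - 1) * (dl^-1 - d%:C^-1)); last first.
  by move: (d%:C^-1) => t; field; rewrite dl0 kC0.
rewrite [leRHS]mulrDl [leRHS]addrC; apply: le_trans (rnormD _ _) _; apply: lerD; last first.
  have [d0|d0] := eqVneq d 0.
    rewrite /e ds// mulr0 expi0 subrr mul0r rnorm0.
    by rewrite mulr_ge0 ?rho_ge0// mulr_ge0// sqr_ge0.
  have dC0 : d%:C != 0 :> R[i] by rewrite eq_complex /= negb_and d0.
  have d1 : 1 <= `|d| by exact: natr_dist_ge1.
  have dp : 0 < `|d| by apply: lt_le_trans d1.
  have alg (p q : R[i]) : p != 0 -> q != 0 -> p^-1 - q^-1 = - (p - q) / (p * q).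
    by move=> p0 q0; field; rewrite p0 q0.
  rewrite (alg _ _ dl0 dC0) (_ : dl - d%:C = 0 +i* a); last first.
    by apply/eqP; rewrite eq_complex /=; apply/andP; split; apply/eqP; ring.
  rewrite !cnormM cnormV rnormN cnorm_i cnormM cnorm_real rE.
  apply: le_trans (_ : `|a| * (`|d| / m) * (`|a| / (`|d| * `|d|)) <= _).
    apply: ler_pM => //; rewrite ?rnorm_ge0 ?divr_ge0 ?mulr_ge0 ?rnorm_ge0//.
    rewrite ler_wpM2l// lef_pV2 ?posrE ?mulr_gt0//.
    by apply: ler_wpM2r.
  rewrite -(real_normK (num_real a)) (_ : _ * _ = `|a| ^+ 2 / m * `|d|^-1); last first.
    by field; rewrite !gt_eqF.
  rewrite [leRHS](_ : _ = `|a| ^+ 2 / m * (2 / (`|d| + 1))); last first.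
    by field; rewrite !gt_eqF// addr_gt0.
  rewrite ler_wpM2l// ?divr_ge0 ?sqr_ge0 ?(ltW m0)//.
  by rewrite ler_pdivlMr ?addr_gt0// mulrC ler_pdivrMr//; lra.
rewrite !cnormM !cnormV cnorm_real (gtr0_norm kap) rE -!mulrA ler_wpM2l ?invr_ge0 ?(ltW kap)//.
rewrite invfM.
have h1 : rnorm (x - kappa%:C * e) <= 2 * (K * m^-1).
  apply: le_trans E _; rewrite mulrCA ler_wpM2l// [2 * _]mulr_natl mulr2n.
  by apply: lerD; rewrite lef_pV2 ?posrE ?ltr0n// ler_nat ltnS ?geq_minl ?geq_minr.
have h2 : (rnorm dl)^-1 <= (2 + `|a|^-1) * (`|d| + 1)^-1.
  have [d0|d0] := eqVneq d 0.
    rewrite d0 normr0 add0r invr1 mulr1.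
    apply: le_trans (_ : `|a|^-1 <= _); last by rewrite lerDr.
    by rewrite lef_pV2 ?posrE ?normr_gt0.
  have dp : 0 < `|d| by rewrite normr_gt0.
  have d1 : 1 <= `|d| by exact: natr_dist_ge1.
  apply: le_trans (_ : `|d|^-1 <= _); first by rewrite lef_pV2 ?posrE.
  apply: le_trans (_ : 2 / (`|d| + 1) <= _); last first.
    by rewrite ler_wpM2r ?invr_ge0 ?addr_ge0// lerDl.
  by rewrite ler_pdivlMr ?addr_gt0// mulrC ler_pdivrMr//; lra.
apply: le_trans (ler_pM _ _ h1 h2) _; rewrite ?rnorm_ge0 ?invr_ge0 ?rnorm_ge0//.
by rewrite le_eqVlt; apply/orP; left; apply/eqP; ring.
Qed.

(** The frequencies are arbitrary real numbers, as in the theory of almost periodic functions: the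
    variable is a logarithm and not an angle. *)
Definition trig_poly (p : R -> R[i]) := exists l : seq (R[i] * R),
  forall s, p s = \sum_(x <- l) x.1 * expi (x.2 * s).

Lemma trig_cst c : trig_poly (fun=> c).
Proof. by exists [:: (c, 0)] => s; rewrite big_seq1 mul0r expi0 mulr1. Qed.

Lemma trigD p q : trig_poly p -> trig_poly q -> trig_poly (fun s => p s + q s).
Proof. by move=> [l lE] [m mE]; exists (l ++ m) => s; rewrite big_cat /= -lE -mE. Qed.

Lemma trigM p q : trig_poly p -> trig_poly q -> trig_poly (fun s => p s * q s).
Proof.
move=> [l lE] [m mE]; exists [seq (x.1 * y.1, x.2 + y.2) | x <- l, y <- m] => s.
rewrite big_allpairs_dep lE mE mulr_suml; apply: eq_bigr => x _.
rewrite mulr_sumr; apply: eq_bigr => y _ /=.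
by rewrite mulrDl expiD; ring.
Qed.

Lemma trigX p n : trig_poly p -> trig_poly (fun s => p s ^+ n).
Proof.
move=> tp; elim: n => [|n IH]; first exact: trig_cst.
rewrite (_ : (fun _ => _) = fun s => p s * p s ^+ n); first exact: trigM.
by apply/funext => s; rewrite exprS.
Qed.

Lemma trig_sin (a : R) : trig_poly (fun s => (sin (a * s))%:C).
Proof.
exists [:: (0 -i* 2^-1, a); (0 +i* 2^-1, - a)] => s.
rewrite !big_cons big_nil addr0 /= [- a * s]mulNr /expi cosN sinN.
by apply/eqP; rewrite eq_complex /=; apply/andP; split; apply/eqP; field.
Qed.

Lemma trig_realizable p : trig_poly p -> realizable p.
Proof.
move=> [l lE]; rewrite (_ : p = fun s => \sum_(x <- l) x.1 * expi (x.2 * s)); last exact/funext.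
elim: l {lE} => [|x l IH].
  by rewrite (_ : (fun _ => _) = fun=> 0); [exact: realizable_cst|apply/funext => s; rewrite big_nil].
rewrite (_ : (fun _ => _) = fun s => x.1 * expi (x.2 * s) + \sum_(x <- l) x.1 * expi (x.2 * s)).
  by apply: realizableD => //; apply: realizableZ; exact: realizable_expi.
by apply/funext => s; rewrite big_cons.
Qed.
End model_kernels.

(** * Trigonometric approximation of the profile *)

Section smoothed_step.
Context (R : realType).
Implicit Types (x y t : R) (n N : nat).

Lemma bernoulli_sub x n : 0 <= x <= 1 -> 1 - n%:R * x <= (1 - x) ^+ n.
Proof.
move=> /andP[x0 x1]; elim: n => [|n IH]; first by rewrite mul0r subr0 expr0.
rewrite exprS; apply: le_trans (_ : (1 - x) * (1 - n%:R * x) <= _).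
  rewrite -natr1; have : 0 <= n%:R * x ^+ 2 by rewrite mulr_ge0 ?sqr_ge0.
  by move: (n%:R) => m; nra.
by rewrite ler_wpM2l// subr_ge0.
Qed.

Lemma bernoulli_add x n : 0 <= x -> 1 + n%:R * x <= (1 + x) ^+ n.
Proof.
move=> x0; elim: n => [|n IH]; first by rewrite mul0r addr0 expr0.
rewrite exprS; apply: le_trans (_ : (1 + x) * (1 + n%:R * x) <= _).
  rewrite -natr1; have : 0 <= n%:R * x ^+ 2 by rewrite mulr_ge0 ?sqr_ge0.
  by move: (n%:R) => m; nra.
by rewrite ler_wpM2l// addr_ge0.
Qed.

Lemma exp_sub_le x n : 0 <= x <= 1 -> (1 - x) ^+ n <= (1 + n%:R * x)^-1.
Proof.
move=> /andP[x0 x1]; have nx : 0 < 1 + n%:R * x by rewrite ltr_pwDl// mulr_ge0.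
rewrite -[leRHS]mul1r ler_pdivlMr//.
apply: le_trans (_ : (1 - x) ^+ n * (1 + x) ^+ n <= _).
  by rewrite ler_wpM2l ?exprn_ge0 ?subr_ge0// bernoulli_add.
rewrite -exprMn -subr_sqr expr1n exprn_ile1 ?subr_ge0 ?expr_le1//.
by rewrite gerBl sqr_ge0.
Qed.

Lemma expr_unit x n : 0 <= x <= 1 -> 0 <= x ^+ n <= 1.
Proof. by move=> /andP[x0 x1]; rewrite exprn_ge0//= exprn_ile1. Qed.

(* A polynomial in y close to 1 for y > 0 and to 0 for y < 0, because
   (1 - v) ^ (2 ^ N) is about exp (- (1 + y) ^ N) for v = ((1 + y) / 2) ^ N. *)
Definition sigma N y : R := 1 - (1 - ((1 + y) / 2) ^+ N) ^+ (2 ^ N).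

Lemma sigma_bounds N y : -1 <= y <= 1 ->
  [/\ 0 <= sigma N y, sigma N y <= 1, sigma N y <= (1 + y) ^+ N &
      0 <= y -> 1 - sigma N y <= (1 + N%:R * y)^-1].
Proof.
move=> /andP[y0 y1]; have u01 : 0 <= (1 + y) / 2 <= 1 by apply/andP; split; lra.
have /andP[v0 v1] := expr_unit N u01; set v := _ ^+ N in v0 v1 *.
have v01 : 0 <= v <= 1 by rewrite v0.
have w01 : 0 <= 1 - v <= 1 by apply/andP; split; lra.
have /andP[w0 w1] := expr_unit (2 ^ N) w01.
have vE : (2 ^ N)%:R * v = (1 + y) ^+ N.
  by rewrite natrX -exprMn mulrCA divff ?mulr1// pnatr_eq0.
rewrite /sigma -/v; split; [lra|lra| |].
  by have := bernoulli_sub (2 ^ N) v01; rewrite vE; lra.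
move=> yp; rewrite opprB addrCA subrr addr0; apply: le_trans (exp_sub_le _ v01) _.
rewrite vE lef_pV2 ?posrE//.
- by apply: le_trans (bernoulli_add N yp) _; rewrite lerDr.
- by rewrite ltr_pwDl// exprn_ge0//; lra.
- by rewrite ltr_pwDl// mulr_ge0.
Qed.

(** At y = sin (s / n) the second factor is near 1 - exp (- s) for large n, and [sigma] switches it
    off for y < 0. *)
Definition step_poly n N y : R := sigma N y * (1 - (1 - y) ^+ n).

(** For y = - t < 0 the factor (1 + t)^n - 1 may be large. As n <= N, [sigma] is at most (1 - t)^n,
    and since (1 - t^2)^n <= 1 the product is at most 1 - (1 - t)^n. *)
Lemma step_poly_bound n N y : (n <= N)%N -> -1 <= y <= 1 ->
  `|step_poly n N y| <= Num.min 1 (n%:R * `|y|).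
Proof.
move=> nN y11; have [s0 s1 sy _] := sigma_bounds N y11; have /andP[y0 y1] := y11.
rewrite /step_poly normrM (ger0_norm s0).
have bnd t : 0 <= t <= 1 -> 1 - (1 - t) ^+ n <= Num.min 1 (n%:R * t).
  move=> t01; rewrite le_min; have := bernoulli_sub n t01.
  have /andP[] : 0 <= (1 - t) ^+ n <= 1 by apply: expr_unit; move: t01 => /andP[] *; apply/andP;
    split; lra.
  by move=> *; apply/andP; split; lra.
have [yp|yn] := lerP 0 y.
  have : 0 <= (1 - y) ^+ n <= 1 by apply: expr_unit; apply/andP; split; lra.
  move=> /andP[p0 p1]; rewrite (ger0_norm yp) ger0_norm; last by rewrite subr_ge0.
  apply: le_trans (bnd y _); last by rewrite yp.
  by rewrite ler_piMl// subr_ge0.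
rewrite (ltr0_norm yn); have [t yE] : exists t, y = - t by exists (- y); rewrite opprK.
have t01 : 0 <= t <= 1 by apply/andP; split; lra.
rewrite {}yE !opprK in s0 s1 sy *; apply: le_trans (bnd t t01).
move: t01 => /andP[t0 t1].
have p1 : 1 <= (1 + t) ^+ n by apply: exprn_ege1; lra.
rewrite distrC ger0_norm ?subr_ge0//.
apply: le_trans (_ : (1 - t) ^+ n * ((1 + t) ^+ n - 1) <= _).
  rewrite ler_wpM2r ?subr_ge0//; apply: le_trans sy _.
  by apply: ler_wiXn2l => //; lra.
rewrite mulrBr mulr1 -exprMn -subr_sqr expr1n lerD2r exprn_ile1//.
  by rewrite subr_ge0 expr_le1.
by rewrite gerBl sqr_ge0.
Qed.

Lemma step_poly_pos n N y : 0 <= y <= 1 ->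
  `|step_poly n N y - (1 - (1 - y) ^+ n)| <= (1 + N%:R * y)^-1.
Proof.
move=> /andP[y0 y1]; have y11 : -1 <= y <= 1 by apply/andP; split; lra.
have [s0 s1 _ /(_ y0) s2] := sigma_bounds N y11.
rewrite (_ : _ - _ = - ((1 - sigma N y) * (1 - (1 - y) ^+ n))); last by rewrite /step_poly; ring.
rewrite normrN normrM ger0_norm ?subr_ge0//; apply: le_trans s2; rewrite ler_piMr ?subr_ge0//.
have /andP[p0 p1] : 0 <= (1 - y) ^+ n <= 1 by apply: expr_unit; apply/andP; split; lra.
by rewrite ger0_norm ?subr_ge0// gerBl.
Qed.

Lemma step_poly_neg n N y : -1 <= y <= 0 ->
  `|step_poly n (n + N) y| <= (1 + N%:R * - y)^-1.
Proof.
move=> /andP[y0 y1]; have y11 : -1 <= y <= 1 by apply/andP; split; lra.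
have [s0 s1 sy _] := sigma_bounds (n + N) y11.
rewrite /step_poly normrM (ger0_norm s0).
have [t yE] : exists t, y = - t by exists (- y); rewrite opprK.
have t01 : 0 <= t <= 1 by apply/andP; split; lra.
rewrite {}yE !opprK in s0 s1 sy *; apply: le_trans (exp_sub_le N t01).
move: t01 => /andP[t0 t1].
have p1 : 1 <= (1 + t) ^+ n by apply: exprn_ege1; lra.
have q0 : 0 <= (1 - t) ^+ N by apply: exprn_ge0; lra.
rewrite distrC ger0_norm ?subr_ge0//.
apply: le_trans (_ : (1 - t) ^+ (n + N) * (1 + t) ^+ n <= _).
  by apply: ler_pM => //; rewrite ?subr_ge0// gerBl.
rewrite exprD mulrAC -exprMn -subr_sqr expr1n ler_piMl// exprn_ile1//.
  by rewrite subr_ge0 expr_le1.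
by rewrite gerBl sqr_ge0.
Qed.

Definition cesaro_profile (s : R) : R := if 0 < s then 1 - expR (- s) else 0.

Lemma abs_expRN_sub t : 0 <= t <= 1 -> `|expR (- t) - (1 - t)| <= t ^+ 2.
Proof.
move=> /andP[t0 t1]; have h := expR_ge1Dx (- t).
rewrite ger0_norm; last by rewrite subr_ge0.
have : expR (- t) <= (1 + t)^-1.
  by rewrite expRN lef_pV2 ?posrE ?expR_gt0 ?expR_ge1Dx// ltr_pwDl.
have : (1 + t)^-1 <= 1 - t + t ^+ 2.
  by rewrite -[leLHS]mul1r ler_pdivrMr ?ltr_pwDl//; nra.
lra.
Qed.

Lemma pow_dist x y n : 0 <= x <= 1 -> 0 <= y <= 1 -> `|x ^+ n - y ^+ n| <= n%:R * `|x - y|.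
Proof.
move=> x01 y01; elim: n => [|n IH]; first by rewrite !expr0 subrr normr0 mul0r.
rewrite !exprS (_ : _ - _ = x * (x ^+ n - y ^+ n) + (x - y) * y ^+ n); last by ring.
apply: le_trans (ler_normD _ _) _; rewrite -natr1 [leRHS]mulrDl mul1r !normrM.
have /andP[p0 p1] := expr_unit n y01; have /andP[x0 x1] := x01.
apply: lerD; last by rewrite ler_piMr// ger0_norm.
by apply: le_trans IH; rewrite ler_piMl// ger0_norm.
Qed.

Lemma profile_approx (d S eta : R) : 0 < d -> d <= S -> 0 < eta ->
  exists n N, forall s, let p := step_poly n N (sin (n%:R^-1 * s)) in
    `|p| <= Num.min 1 `|s| /\ (d <= `|s| <= S -> `|cesaro_profile s - p| <= eta).
Proof.
move=> d0 dS eta0; have S0 : 0 < S by apply: lt_le_trans dS.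
(* This makes |s| / n at most 1/2 in the range and the error 2 S^2 / n between the n-th powers at
   most eta / 2. *)
pose n := (Num.truncn (2 * S + 4 * S ^+ 2 / eta)).+1.
have nP : 2 * S + 4 * S ^+ 2 / eta < n%:R by exact: truncnS_gt.
have q0 : 0 <= 4 * S ^+ 2 / eta by rewrite divr_ge0 ?(ltW eta0)// mulr_ge0 ?sqr_ge0.
have n0 : 0 < n%:R :> R by rewrite ltr0n.
have n2S : 2 * S <= n%:R by lra.
have nS2 : 2 * S ^+ 2 / n%:R <= eta / 2.
  rewrite ler_pdivrMr//; have : 4 * S ^+ 2 / eta <= n%:R by lra.
  by rewrite ler_pdivrMr//; lra.
(* A lower bound for |sin (s / n)| when d <= |s| <= S, because sin t >= t - t^2 >= t / 2 for 0 <= t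
   <= 1/2. *)
have [y0 y0d] : exists y0, y0 = d / (2 * n%:R) by exists (d / (2 * n%:R)).
have y00 : 0 < y0 by rewrite y0d divr_gt0// mulr_gt0.
pose N := Num.truncn (2 / (eta * y0)).
have NP : (1 + N%:R * y0)^-1 <= eta / 2.
  have : 2 / (eta * y0) < N.+1%:R by exact: truncnS_gt.
  rewrite ltr_pdivrMr ?mulr_gt0// -[N.+1%:R]natr1 => h.
  rewrite -[leLHS]mul1r ler_pdivrMr ?ltr_pwDl ?mulr_ge0// ?(ltW y00)//.
  have y01 : y0 <= 1 by rewrite y0d ler_pdivrMr ?mulr_gt0//; lra.
  have : 0 <= eta * (1 - y0) by rewrite mulr_ge0 ?(ltW eta0)// subr_ge0.
  by move: (N%:R) h => m; nra.
have Ny y : y0 <= y -> (1 + N%:R * y)^-1 <= eta / 2.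
  move=> yy; apply: le_trans NP; rewrite lef_pV2 ?posrE ?ltr_pwDl ?mulr_ge0// ?(ltW y00)//; last first.
    by apply: le_trans yy; exact: ltW.
  by rewrite lerD2l ler_wpM2l.
exists n, (n + N)%N => s p.
have y11 (t : R) : -1 <= sin t <= 1 by rewrite sin_geN1 sin_le1.
split.
  apply: le_trans (step_poly_bound (leq_addr _ _) (y11 _)) _.
  rewrite le_min !ge_min lexx /=; apply/orP; right.
  apply: le_trans (_ : n%:R * `|n%:R^-1 * s| <= _).
    by rewrite ler_wpM2l// abs_sin_le.
  by rewrite normrM ger0_norm ?invr_ge0// mulVKf// gt_eqF.
move=> /andP[ds sS].
have tP t : `|t| = `|s| / n%:R -> 0 <= t -> [/\ t <= 1 / 2, y0 <= sin t & `|sin t - t| <= t ^+ 2].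
  move=> tE tp; rewrite ger0_norm// in tE.
  have t2 : t <= 1 / 2 by rewrite tE ler_pdivrMr//; lra.
  split=> //; last exact: abs_sin_sub_le.
  have td : d / n%:R <= t by rewrite tE ler_wpM2r// invr_ge0.
  have y0E : y0 = d / n%:R / 2 by rewrite y0d; field; rewrite gt_eqF.
  have := abs_sin_sub_le t; rewrite ler_norml => /andP[h _].
  by rewrite y0E; nra.
have [sp|sn] := ltrP 0 s; last first.
  rewrite /cesaro_profile ltNge sn /= sub0r normrN.
  have [||t2 yy _] := tP (- (n%:R^-1 * s)).
    by rewrite normrN normrM ger0_norm ?invr_ge0// mulrC.
    by rewrite oppr_ge0 mulr_ge0_le0// invr_ge0.
  rewrite sinN in yy.
  apply: le_trans (step_poly_neg n N _) _.
    by rewrite sin_geN1 -oppr_ge0 (le_trans (ltW y00) yy).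
  by apply: le_trans (Ny _ yy) _; lra.
have [||t2 yy yt] := tP (n%:R^-1 * s).
- by rewrite normrM ger0_norm ?invr_ge0// mulrC.
- by rewrite mulr_ge0 ?invr_ge0 ?(ltW sp).
rewrite /cesaro_profile sp.
set t := n%:R^-1 * s in t2 yy yt *.
have tE : t = s / n%:R by rewrite mulrC.
have t0 : 0 < t by rewrite tE divr_gt0.
have ypos : 0 <= sin t by apply: le_trans yy; exact: ltW.
have sty : sin t <= 1 by exact: sin_le1.
have -> : p = step_poly n (n + N) (sin t) by [].
set g := 1 - (1 - sin t) ^+ n.
rewrite (_ : _ - _ = (1 - expR (- s) - g) - (step_poly n (n + N) (sin t) - g)); last by ring.
apply: le_trans (ler_normB _ _) _; rewrite (_ : eta = eta / 2 + eta / 2); last by field.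
apply: lerD; last first.
  apply: le_trans (step_poly_pos _ _ _) _; first by rewrite ypos.
  apply: le_trans (Ny _ yy); rewrite lef_pV2 ?posrE ?ltr_pwDl ?mulr_ge0//.
  by rewrite lerD2l ler_wpM2r// ler_nat leq_addl.
have -> : expR (- s) = expR (- t) ^+ n.
  by rewrite -expRM_natl tE mulrN mulrCA divff ?mulr1// gt_eqF.
rewrite (_ : _ - _ = (1 - sin t) ^+ n - expR (- t) ^+ n); last by rewrite /g; ring.
apply: le_trans (pow_dist n _ _) _.
- by apply/andP; split; lra.
- by rewrite expR_ge0 -expR0 ler_expR oppr_le0 ltW.
apply: le_trans (_ : n%:R * (2 * t ^+ 2) <= _); last first.
  apply: le_trans nS2; rewrite (_ : n%:R * _ = 2 * s ^+ 2 / n%:R); last first.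
    by rewrite tE; field; rewrite gt_eqF.
  rewrite ler_wpM2r ?invr_ge0// ler_wpM2l// ler_pXn2r ?nnegrE ?(ltW sp) ?(ltW S0)//.
  by move: sS; rewrite ger0_norm// ltW.
rewrite ler_wpM2l//.
have te : `|expR (- t) - (1 - t)| <= t ^+ 2 by apply: abs_expRN_sub; rewrite ltW//=; lra.
rewrite (_ : _ - _ = - (sin t - t) - (expR (- t) - (1 - t))); last by ring.
by apply: le_trans (ler_normB _ _) _; rewrite normrN; lra.
Qed.
End smoothed_step.

(** * The Cesaro kernel *)

Section cesaro_kernel.
Context (R : realType).
Implicit Types (a b : nat -> nat -> R) (j k N : nat).

(** Stopping the inner sum at [j] keeps it inside every section that contains [j]. The vector [z]
    obtained from [b] has its norm bounded by testing the form of [b] against [z] itself. *)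
Lemma form_boundM a b (A B : R) : (forall j k, 0 <= a j k) -> (forall j k, 0 <= b j k) ->
  0 <= A -> 0 <= B -> form_bound a A -> form_bound b B ->
  form_bound (fun j k => \sum_(i < j.+1) a j i * b i k) (A * B).
Proof.
move=> a0 b0 A0 B0 aA bB N x y x0 y0.
pose z i := \sum_(k < N) b i k * x k.
have z0 i : 0 <= z i by apply: sumr_ge0 => k _; exact: mulr_ge0.
have zB : l2sum N z <= B * l2sum N x.
  have : l2sum N z * l2sum N z <= B * l2sum N x * l2sum N z.
    rewrite -expr2 sqr_l2sum -mulrA; apply: le_trans (bB N x z x0 z0).
    by apply: ler_sum => i _; rewrite expr2 {1}/z mulr_suml.
  have [->|zn] := eqVneq (l2sum N z) 0; first by rewrite mulr_ge0 ?l2sum_ge0.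
  by rewrite ler_pM2r// lt_neqAle eq_sym zn l2sum_ge0.
apply: le_trans (_ : \sum_(j < N) \sum_(i < N) a j i * z i * y j <= _).
  apply: ler_sum => j _; rewrite -!mulr_suml ler_wpM2r//.
  under eq_bigr do rewrite mulr_suml; rewrite exchange_big /=.
  have -> : \sum_(i < j.+1) \sum_(k < N) a j i * b i k * x k = \sum_(i < j.+1) a j i * z i.
    by apply: eq_bigr => i _; rewrite mulr_sumr; apply: eq_bigr => k _; rewrite mulrA.
  rewrite (big_ord_widen _ (fun i => a j i * z i) (ltn_ord j)) big_mkcond /=.
  by apply: ler_sum => i _; case: ifP => // _; exact: mulr_ge0.
apply: le_trans (aA N z y z0 y0) _; rewrite -mulrA ler_wpM2l// mulrA.
by rewrite ler_wpM2r ?l2sum_ge0.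
Qed.

Definition cesaro_entry j k : R := if (k <= j)%N then j.+1%:R^-1 else 0.
Local Notation c := cesaro_entry.

Definition max_kernel j k : R := (maxn j k).+1%:R^-1.
Local Notation L := max_kernel.
Local Notation s j k := (harm R j - harm R k).

Let c0 j k : 0 <= c j k. Proof. by rewrite /c; case: ifP. Qed.

Let L0 j k : 0 <= L j k. Proof. by rewrite invr_ge0. Qed.

(** exp (- 1 / m) lies between (m - 1) / m and m / (m + 1), and the products of these bounds over m
    from k + 1 to j telescope. *)
Lemma expR_harm j k : (k <= j)%N ->
  k%:R <= j%:R * expR (- s j k) /\ j.+1%:R * expR (- s j k) <= k.+1%:R.
Proof.
move=> kj; rewrite -(subnKC kj); elim: (j - k)%N => [|d [IH1 IH2]].
  by rewrite addn0 subrr oppr0 expR0 !mulr1.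
rewrite addnS harmS; set m := (k + d)%N in IH1 IH2 *.
set E := expR _ in IH1 IH2.
have -> : expR (- (harm R m + m.+1%:R^-1 - harm R k)) = E * expR (- m.+1%:R^-1).
  by rewrite -expRD; congr expR; ring.
have m0 : 0 < m.+1%:R :> R by rewrite ltr0n.
have E0 : 0 <= E by exact: expR_ge0.
split.
  apply: le_trans IH1 _; rewrite mulrCA [m%:R * _]mulrC ler_wpM2l//.
  have := ler_wpM2l (ltW m0) (expR_ge1Dx (- m.+1%:R^-1 : R)); rewrite mulrDr mulr1 mulrN divff ?gt_eqF//.
  by rewrite -natr1 addrK.
apply: le_trans IH2; rewrite mulrCA [m.+1%:R * E]mulrC ler_wpM2l//.
have := ler_wpM2l (ltW m0) (expR_ge1Dx (m.+1%:R^-1 : R)); rewrite mulrDr mulr1 divff ?gt_eqF// => h.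
by rewrite expRN ler_pdivrMr ?expR_gt0// -natr1.
Qed.

Lemma harm_le j k : (k <= j)%N -> 0 <= s j k.
Proof. by move=> kj; have /andP[] := harm_diff R kj. Qed.

Lemma harm_lt j k : (k < j)%N -> 0 < s j k.
Proof.
move=> kj; apply: lt_le_trans (_ : s k.+1 k <= _).
  by rewrite harmS addrAC subrr add0r invr_gt0 ltr0n.
by rewrite lerD2r -subr_ge0 harm_le.
Qed.

(** For k < j the difference has numerator (k + 1) - (j + 1) exp (- s), which lies between 0 and 1
    by [expR_harm]. For j < k both terms vanish; on the diagonal the quotient is 0 and the entry
    equals [rho]. *)
Lemma cesaro_entry_profile j k :
  `|c j k - cesaro_profile (s j k) / (j%:R - k%:R)| <= 2 * rho R j k.
Proof.
have r0 := rho_ge0 R j k; rewrite /c /cesaro_profile.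
have [jk|kj|<-] := ltngtP j k.
- rewrite ltNge -oppr_ge0 opprB (harm_le (ltnW jk)) /= mul0r subr0 normr0.
  by rewrite mulr_ge0.
- rewrite harm_lt//; have [h1 h2] := expR_harm (ltnW kj); set E := expR _ in h1 h2 *.
  have E0 : 0 <= E by exact: expR_ge0.
  pose x : R := j%:R - k%:R; rewrite -/x.
  have x1 : 1 <= x by rewrite /x -natrB ?(ltnW kj)// ler1n subn_gt0.
  rewrite rhoE -/x (minn_idPr (ltnW kj)) [`|x|]ger0_norm; last by lra.
  rewrite -[j.+1%:R]natr1 -[k.+1%:R]natr1 in h2 *; move: h1 h2; set q : R := k%:R;
    set p : R := j%:R => h1 h2.
  have pq : p = q + x by rewrite /x /p /q; ring.
  have q0 : 0 <= q by exact: ler0n.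
  have p1 : 0 < p + 1 by lra.
  have -> : (p + 1)^-1 - (1 - E) / x = - ((q + 1 - (p + 1) * E) / (x * (p + 1))).
    by rewrite pq in p1 *; field; rewrite !gt_eqF//; lra.
  rewrite normrN normrM ger0_norm; last by lra.
  rewrite ger0_norm ?invr_ge0 ?mulr_ge0//; [|lra|exact: ltW].
  rewrite ler_pdivrMr ?mulr_gt0//; last by lra.
  rewrite [leRHS]mulrAC ler_pdivlMr ?mulr_gt0//; [|lra|lra].
  have : q + 1 - (p + 1) * E <= 1 by nra.
  have : 0 <= q + 1 - (p + 1) * E by lra.
  move: (_ - _) => t t0 t1.
  apply: le_trans (_ : (x + 1) * (q + 1) <= _).
    by rewrite ler_piMl// mulr_ge0//; lra.
  by rewrite pq; nra.
- rewrite subrr ltxx mul0r subr0 rhoE subrr normr0 add0r mul1r minnn ger0_norm ?invr_ge0//.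
  by rewrite ler_peMl ?invr_ge0//; lra.
Qed.

(** If the distance of the indices is at least min j k + 1, the value 1 of the minimum is used,
    otherwise |s| <= |j - k| / (min j k + 1). Either way the denominator left over is at least half
    of max j k + 1. *)
Lemma min_harm_ratio j k :
  Num.min 1 `|s j k| / `|j%:R - k%:R| <= 2 * L j k.
Proof.
have main j' k' : (k' < j')%N -> Num.min 1 `|s j' k'| / `|j'%:R - k'%:R| <= 2 * j'.+1%:R^-1.
  move=> kj; have := harm_dist R j' k'; rewrite (minn_idPr (ltnW kj)).
  rewrite [`|j'%:R - _|]ger0_norm ?subr_ge0 ?ler_nat ?(ltnW kj)//.
  have x1 : 1 <= j'%:R - k'%:R :> R by rewrite -natrB ?(ltnW kj)// ler1n subn_gt0.
  have k0 : 0 <= k'%:R :> R by exact: ler0n.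
  have := normr_ge0 (s j' k'); move: x1 k0; rewrite -[j'.+1%:R]natr1; rewrite -[k'.+1%:R]natr1;
    move: (k'%:R) (j'%:R) => q p; move: `|_| => t x1 q0 t0 ht.
  have x0 : 0 < p - q by lra.
  rewrite ler_pdivrMr// mulrAC ler_pdivlMr; last by lra.
  have [h|h] := lerP (q + 1) (p - q).
    apply: le_trans (_ : 1 * (p + 1) <= _); last by lra.
    by rewrite ler_wpM2r ?ge_min ?lexx//; lra.
  rewrite ler_pdivlMr in ht; last by lra.
  apply: le_trans (_ : t * (p + 1) <= _); first by rewrite ler_wpM2r ?ge_min ?lexx ?orbT//; lra.
  by nra.
rewrite /L; have [jk|kj|<-] := ltngtP j k.
- by rewrite distrC [`|j%:R - _|]distrC; exact: main.
- exact: main.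
- by rewrite !subrr normr0 invr0 mulr0 mulr_ge0 ?invr_ge0.
Qed.

(** Schur's test: on the scale of harmonic numbers a row of the band is a window of length 2 d, and
    its entries are at most the gaps of that scale, towards the diagonal from either side. The
    diagonal has to be left out, since its first entry is 1 for every d. *)
Lemma form_bound_band (d : R) : 0 < d ->
  form_bound (fun j k => if 0 < `|s j k| < d then L j k else 0) (4 * d).
Proof.
move=> d0; pose a j k := if 0 < `|s j k| < d then L j k else 0.
have a0 j k : 0 <= a j k by rewrite /a; case: ifP.
have aC j k : a j k = a k j by rewrite /a distrC /L maxnC.
(* An entry of the band is at most an increment of the clamped function phi j. *)
pose phi j k := Num.max (- d) (Num.min d (s k j)).
have phi_d j k : - d <= phi j k <= d.
  by rewrite /phi le_max lexx /= ge_max ge_min lexx andbT; lra.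
have phi_mono j k : phi j k <= phi j k.+1.
  have h : s k j <= s k.+1 j by rewrite lerD2r -subr_ge0 harm_le.
  by rewrite /phi; apply: le_max2 => //; apply: le_min2.
have phiE j k : - d <= s k j <= d -> phi j k = s k j.
  by move=> /andP[h1 h2]; rewrite /phi min_r// max_r.
have aphi j k : a j k <= (phi j k.+1 - phi j k) + (phi j k - phi j k.-1).
  have p1 : 0 <= phi j k.+1 - phi j k by rewrite subr_ge0.
  have p2 : 0 <= phi j k - phi j k.-1 by rewrite subr_ge0; case: (k).
  rewrite /a; case: ifPn => [/andP[s0 sd]|_]; last exact: addr_ge0.
  have [jk|kj|jk] := ltngtP j k; last by move: s0; rewrite jk subrr normr0 ltxx.
    apply: le_trans (_ : phi j k - phi j k.-1 <= _); last by rewrite lerDr.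
    case: k jk {p1 p2} s0 sd => // k jk s0 sd /=.
    have sk : `|s j k.+1| = s k.+1 j by rewrite distrC ger0_norm// harm_le// ltnW.
    have sk' : 0 <= s k j by rewrite harm_le.
    have hS : k.+1%:R^-1 = s k.+1 k by rewrite harmS addrAC subrr add0r.
    have hk := harm_le (leqnSn k).
    rewrite sk in sd; rewrite !phiE; [|apply/andP; split; lra..].
    rewrite /L (maxn_idPr (ltnW jk)).
    apply: le_trans (_ : k.+1%:R^-1 <= _); last by rewrite hS; lra.
    by rewrite lef_pV2 ?posrE ?ltr0n// ler_nat.
  apply: le_trans (_ : phi j k.+1 - phi j k <= _); last by rewrite lerDl.
  have sk : `|s j k| = s j k by rewrite ger0_norm// harm_le// ltnW.
  have sk' : 0 <= s j k.+1 by rewrite harm_le.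
  have hS : k.+1%:R^-1 = s k.+1 k by rewrite harmS addrAC subrr add0r.
  have hk := harm_le (leqnSn k).
  rewrite sk in sd; rewrite !phiE; [|apply/andP; split; lra..].
  rewrite /L (maxn_idPl (ltnW kj)).
  apply: le_trans (_ : k.+1%:R^-1 <= _); last by rewrite hS; lra.
  by rewrite lef_pV2 ?posrE ?ltr0n// ler_nat ltnS ltnW.
have rows N j : \sum_(k < N) a j k <= 4 * d.
  apply: le_trans (_ : (phi j N - phi j 0) + (phi j N.-1 - phi j 0) <= _); last first.
    have := phi_d j N; have := phi_d j 0%N; have := phi_d j N.-1.
    by move=> /andP[? ?] /andP[? ?] /andP[? ?]; lra.
  elim: N => [|N IH]; first by rewrite big_ord0 !subrr addr0.
  rewrite big_ord_recr /=; apply: le_trans (lerD IH (aphi j N)) _.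
  by rewrite le_eqVlt; apply/orP; left; apply/eqP; ring.
suff : form_bound a (4 * d) by [].
apply: (form_bound_schur a0 rows) => N k.
rewrite (eq_bigr (fun j : 'I_N => a k j)); first exact: rows.
by move=> j _; exact: aC.
Qed.

Lemma max_kernel_le j k : L j k <= c j k + c k j.
Proof.
rewrite /L /c; have [jk|kj|<-] := ltngtP j k; rewrite ?add0r ?addr0//.
by rewrite lerDl.
Qed.

(* The right-hand side is the kernel of C ^ 2 plus its transpose. *)
Lemma harm_max_kernel_le j k : `|s j k| * L j k <=
  (\sum_(i < j.+1) c j i * c i k) + (\sum_(i < k.+1) c k i * c i j).
Proof.
have p j' k' : 0 <= \sum_(i < j'.+1) c j' i * c i k' by apply: sumr_ge0 => i _; exact: mulr_ge0.
have main j' k' : (k' <= j')%N -> s j' k' / j'.+1%:R <= \sum_(i < j'.+1) c j' i * c i k'.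
  move=> kj; apply: le_trans (_ : s j'.+1 k' / j'.+1%:R <= _).
    by rewrite ler_wpM2r// lerD2r -subr_ge0 harm_le.
  have -> : s j'.+1 k' = \sum_(i < j'.+1) if (k' <= i)%N then i.+1%:R^-1 else 0.
    rewrite {p}; have : (k' <= j'.+1)%N by apply: leqW.
    elim: j'.+1 => [|m IH] /=; first by rewrite leqn0 => /eqP ->; rewrite subrr big_ord0.
    rewrite leq_eqVlt => /predU1P[->|].
      by rewrite subrr big1// => i _; rewrite leqNgt ltn_ord.
    by rewrite ltnS => km; rewrite big_ord_recr /= -IH// km harmS addrAC.
  rewrite mulr_suml; apply: ler_sum => i _.
  have ij : (i <= j')%N by rewrite -ltnS.
  rewrite /c ij mulrC.
  by case: ifP; rewrite ?mulr0.
rewrite /L; have [jk|/ltnW kj] := leqP j k.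
  by rewrite distrC ger0_norm ?harm_le//; apply: le_trans (main _ _ jk) _; rewrite lerDr.
by rewrite ger0_norm ?harm_le//; apply: le_trans (main _ _ kj) _; rewrite lerDl.
Qed.

Lemma cesaro_kernel_approx (M d : R) : 0 <= M -> form_bound c M -> 0 < d ->
  exists (p : R -> R) (a : nat -> nat -> R),
  [/\ trig_poly (fun x => (p x)%:C), p 0 = 0, forall j k, 0 <= a j k, form_bound a d &
    forall j k, `|c j k - p (s j k) / (j%:R - k%:R)| <= a j k + 2 * rho R j k].
Proof.
move=> M0 cM d0.
(* Each of the three error terms gets a third of d: the band costs 4 * 4 e, the far part (4 / S) * 2
   M^2, and the middle range 2 (eta / e) * 2 M. *)
pose e : R := Num.min 1 (d / 48); have e0 : 0 < e by rewrite lt_min ltr01 divr_gt0.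
have e1 : e <= 1 by rewrite ge_min lexx.
have ed : 16 * e <= d / 3.
  apply: le_trans (_ : 16 * (d / 48) <= _); last by lra.
  by rewrite ler_wpM2l// ge_min lexx orbT.
pose S : R := 1 + 24 * M ^+ 2 / d.
have q0 : 0 <= 24 * M ^+ 2 / d by rewrite divr_ge0 ?(ltW d0)// mulr_ge0 ?sqr_ge0.
have S1 : 1 <= S by rewrite lerDl.
have S0 : 0 < S by apply: lt_le_trans S1.
have SM : 4 / S * (M * M + M * M) <= d / 3.
  rewrite mulrAC ler_pdivrMr//; have : 24 * M ^+ 2 / d <= S by rewrite lerDr.
  by rewrite ler_pdivrMr// expr2; nra.
pose eta : R := e * (d / (12 * (M + 1))).
have M1 : 0 < M + 1 by rewrite ltr_wpDl.
have eta0 : 0 < eta by rewrite mulr_gt0// divr_gt0// mulr_gt0.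
have eM : 2 * (eta / e) * (M + M) <= d / 3.
  have -> : eta / e = d / (12 * (M + 1)) by rewrite /eta mulrC mulKf ?gt_eqF.
  rewrite (_ : _ * _ = d * M / (3 * (M + 1))); last by field; rewrite gt_eqF.
  by rewrite ler_pdivrMr ?mulr_gt0//; nra.
have [n [N pP]] := profile_approx e0 (le_trans e1 S1) eta0.
pose p (x : R) := step_poly n N (sin (n%:R^-1 * x)).
(* The three terms control |s| < e, |s| > S and the range in between. *)
pose a j k := 4 * (if 0 < `|s j k| < e then L j k else 0) +
  4 / S * (`|s j k| * L j k) + 2 * (eta / e) * L j k.
have ee0 : 0 <= eta / e by rewrite divr_ge0 ?(ltW e0) ?(ltW eta0).
have S40 : 0 <= 4 / S by rewrite divr_ge0 ?(ltW S0).
have sL0 j k : 0 <= 4 / S * (`|s j k| * L j k) by rewrite mulr_ge0// mulr_ge0.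
have eL0 j k : 0 <= 2 * (eta / e) * L j k by rewrite mulr_ge0// mulr_ge0.
have a0 j k : 0 <= a j k.
  by rewrite /a; apply: addr_ge0 => //; apply: addr_ge0 => //; rewrite mulr_ge0//; case: ifP.
have p0 : p 0 = 0.
  have [h _] := pP 0; apply/eqP; rewrite -normr_le0; apply: le_trans h _.
  by rewrite ge_min normr0 lexx orbT.
exists p, a; split => //.
- pose tr (f : R -> R) := trig_poly (fun x => (f x)%:C).
  have trc r : tr (fun=> r) by exact: trig_cst.
  have trD f g : tr f -> tr g -> tr (fun x => f x + g x).
    move=> tf tg; rewrite /tr (_ : (fun _ => _) = fun x => (f x)%:C + (g x)%:C); first exact: trigD.
    by apply/funext => x; rewrite rmorphD.
  have trM f g : tr f -> tr g -> tr (fun x => f x * g x).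
    move=> tf tg; rewrite /tr (_ : (fun _ => _) = fun x => (f x)%:C * (g x)%:C); first exact: trigM.
    by apply/funext => x; rewrite rmorphM.
  have trX f m : tr f -> tr (fun x => f x ^+ m).
    move=> tf; rewrite /tr (_ : (fun _ => _) = fun x => (f x)%:C ^+ m); first exact: trigX.
    by apply/funext => x; rewrite rmorphXn.
  have tr1B f : tr f -> tr (fun x => 1 - f x).
    move=> tf; rewrite (_ : (fun _ => _) = fun x => 1 + (-1) * f x).
      by apply: trD => //; exact: trM.
    by apply/funext => x; rewrite mulN1r.
  have trs : tr (fun x => sin (n%:R^-1 * x)) by exact: trig_sin.
  rewrite -/(tr p) /p /step_poly /sigma.
  have tu : tr (fun x => ((1 + sin (n%:R^-1 * x)) / 2) ^+ N).
    by apply: trX; apply: (trM) (trc _); exact: trD.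
  have t1 := trX _ (2 ^ N)%N (tr1B _ tu); have t2 := trX _ n (tr1B _ trs).
  exact: trM _ _ (tr1B _ t1) (tr1B _ t2).
- have LB : form_bound L (M + M).
    by apply: form_bound_le max_kernel_le (lexx _) _; apply: form_boundD => //; exact: form_boundT.
  have sLB : form_bound (fun j k => `|s j k| * L j k) (M * M + M * M).
    apply: form_bound_le harm_max_kernel_le (lexx _) _; apply: form_boundD.
      exact: form_boundM.
    by apply: form_boundT (form_boundM _ _ _ _ _ _).
  apply: form_bound_le (fun j k => lexx (a j k)) _ _; last first.
    apply: form_boundD; first apply: form_boundD.
    + by apply: form_boundZ => //; exact: (form_bound_band e0).
    + by apply: form_boundZ => //; exact: sLB.
    + by apply: form_boundZ => //; [exact: mulr_ge0|exact: LB].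
  by rewrite mulrA; lra.
move=> j k; set x := s j k; set v : R := j%:R - k%:R.
have h := cesaro_entry_profile j k; rewrite -/x -/v in h.
rewrite (_ : _ - _ = (cesaro_profile x - p x) / v + (c j k - cesaro_profile x / v)); last by ring.
apply: le_trans (ler_normD _ _) (lerD _ h).
have [jk|jk] := eqVneq j k; first by rewrite /v jk subrr invr0 mulr0 normr0 -{2}jk.
have x0 : 0 < `|x|.
  rewrite normr_gt0 /x; have [jk'|kj'|] := ltngtP j k; last by move=> jk'; move: jk; rewrite jk' eqxx.
    by rewrite -opprB oppr_eq0 gt_eqF// harm_lt.
  by rewrite gt_eqF// harm_lt.
have [pm papp] := pP x; rewrite -/(p x) in pm papp.
have fm : `|cesaro_profile x| <= Num.min 1 `|x|.
  rewrite /cesaro_profile; case: ifPn => xp; last by rewrite normr0 le_min ler01 normr_ge0.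
  have h1 := expR_ge1Dx (- x); have h2 : 0 <= expR (- x) by exact: expR_ge0.
  have h3 : expR (- x) <= 1 by rewrite -expR0 ler_expR oppr_le0 ltW.
  by rewrite (gtr0_norm xp) ger0_norm ?subr_ge0// le_min; apply/andP; split; lra.
have ratio := min_harm_ratio j k; rewrite -/x -/v in ratio.
have L0' := L0 j k; have xL := sL0 j k; rewrite -/x in xL; have eL := eL0 j k.
have crude : `|(cesaro_profile x - p x) / v| <= 4 * L j k.
  rewrite normrM normfV; apply: le_trans (_ : 2 * (Num.min 1 `|x| / `|v|) <= _); last by lra.
  rewrite mulrA ler_wpM2r ?invr_ge0//; apply: le_trans (ler_normB _ _) _; lra.
rewrite /a -/x; have [xe|xe] := ltrP `|x| e.
  by apply: le_trans crude _; rewrite x0 /=; lra.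
rewrite andbF mulr0 add0r; have [xS|xS] := lerP `|x| S; last first.
  apply: le_trans crude _; apply: le_trans (_ : 4 / S * (`|x| * L j k) <= _); last by lra.
  rewrite (_ : 4 / S * _ = 4 * L j k * (`|x| / S)); last by ring.
  by rewrite ler_peMr ?mulr_ge0// ler_pdivlMr// mul1r ltW.
(* In the middle range e <= min 1 |x|, so eta is at most (eta / e) times this minimum and
   [min_harm_ratio] applies again. *)
apply: le_trans (_ : 2 * (eta / e) * L j k <= _); last by lra.
have dist := papp _; rewrite xe xS in dist; have {}dist := dist isT.
rewrite normrM normfV; apply: le_trans (_ : eta / e * (Num.min 1 `|x| / `|v|) <= _).
  rewrite mulrA ler_wpM2r ?invr_ge0//; apply: le_trans dist _.
  apply: le_trans (_ : eta / e * e <= _); first by rewrite divfK// gt_eqF.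
  by rewrite ler_wpM2l// le_min e1.
by rewrite [leRHS]mulrAC [leRHS]mulrC ler_wpM2l.
Qed.
End cesaro_kernel.

(** * The Cesaro operator *)

Section cesaro.
Context (R : realType) (C : H2 R -> H2 R).
Hypothesis hC : is_cesaro C.
Local Notation e := (H2monomial R).

Lemma cesaro_entryE j k : entry C j k = (cesaro_entry R j k)%:C.
Proof.
have [_ /(_ k) Ck] := hC.
apply/eqP; rewrite -subr_eq0; apply/eqP/rnorm_le0/ler_addgt0Pl => r r0; rewrite addr0.
(* Past j the j-th coefficient of the partial sums no longer changes, so one partial sum close
   enough to [C (e k)] determines the entry up to r. *)
have r0C : 0 < r%:C :> R[i] by rewrite ltcR.
move/cvgr_dist_lt: Ck => /(_ _ r0C) [n0 _ nP].
pose n := (maxn n0 j.+1)%N.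
have := nP n (leq_maxl _ _); set u := \sum_(k <= i < n) _ => un.
have uj : H2dot u (e j) = (cesaro_entry R j k)%:C.
  rewrite /cesaro_entry.
  have E i : H2dot (i.+1%:R^-1 *: e i) (e j) = i.+1%:R^-1 * (i == j)%:R.
    by rewrite linearZl_LR /= H2dot_monomial.
  have -> : H2dot u (e j) = \sum_(k <= i < n) i.+1%:R^-1 * (i == j)%:R.
    by rewrite /u linear_sumlz; apply: eq_bigr => i _; exact: E.
  have [kj|jk] := leqP k j; last first.
    rewrite big_nat big1// => i /andP[ki _]; rewrite gtn_eqF ?mulr0//.
    exact: leq_trans ki.
  rewrite (big_rem j) /=; last by rewrite mem_index_iota kj leq_max ltnSn orbT.
  rewrite eqxx mulr1 big_seq big1 ?addr0; last first.
    move=> i; rewrite mem_rem_uniq ?iota_uniq// inE => /andP[/negbTE -> _].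
    by rewrite mulr0.
  by rewrite fmorphV rmorph_nat.
have -> : entry C j k - (cesaro_entry R j k)%:C = H2dot (C (e k) - u) (e j).
  by rewrite linearBl /= uj.
apply: le_trans (rnorm_H2dot _ _) _.
have -> : rnorm (e j) = 1.
  apply/eqP; rewrite -(@eqrXn2 _ 2) ?rnorm_ge0// expr1n -(inj_eq (@complexI _)).
  by rewrite rnorm_sqr_H2 H2dot_monomial eqxx.
rewrite mulr1; apply: ltW; rewrite -ltcR -rnormE; exact: un.
Qed.

(** Entries and test vectors are nonnegative, so the form is an inner product of [C] applied to a
    finite sum; the boundedness contained in [is_cesaro] takes the place of Hardy's inequality. *)
Lemma cesaro_form_bound : exists2 M, 0 <= M & form_bound (cesaro_entry R) M.
Proof.
have bC := hC.1; have lC := bC.1; have [M M0 CM] := (boundedP lC).2 bC.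
exists M => // N x y x0 y0.
have E z : (forall k, 0 <= z k) -> l2sum N z = rnorm (hsum N (fun k => (z k)%:C)).
  move=> z0; rewrite rnorm_hsum; congr Num.sqrt; apply: eq_bigr => k _.
  by rewrite cnorm_real ger0_norm.
rewrite !E// mulrA; apply: le_trans (ler_wpM2r (rnorm_ge0 _) (CM _)).
apply: le_trans (rnorm_H2dot _ _).
rewrite dot_hsum//.
set S := \sum_(j < N) _.
suff -> : \sum_(j < N) \sum_(k < N) entry C j k * (x k)%:C * ((y j)%:C)^* = S%:C.
  by rewrite cnorm_real ler_norm.
rewrite /S rmorph_sum; apply: eq_bigr => j _; rewrite rmorph_sum; apply: eq_bigr => k _.
rewrite cesaro_entryE !rmorphM /=; congr (_ * _).
by apply/eqP; rewrite eq_complex /= oppr0 !eqxx.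
Qed.

Lemma cesaro_in_ideal (J : set (H2 R -> H2 R)) : closed_ideal (toeplitz_algebra R) J ->
  (forall A B, toeplitz_algebra R A -> toeplitz_algebra R B -> J ((A \o B) \- (B \o A))) ->
  J C.
Proof.
move=> J_ideal J_comm; apply: (ideal_approx J_ideal J_comm hC.1) => d d0.
have [M M0 CM] := cesaro_form_bound.
have [p [a [tp p0 a0 ad pP]]] := cesaro_kernel_approx M0 CM d0.
have [B [K [JB bB BP]]] := trig_realizable J_ideal J_comm tp.
exists B, a, (2 + K); split => // j k.
have := BP j k; have := pP j k; rewrite /model_kernel p0 subr0 cesaro_entryE => h1 h2.
set q : R[i] := (p _)%:C / _ in h2.
rewrite (_ : _ - _ = ((cesaro_entry R j k)%:C - q) - (entry B j k - q)); last by ring.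
apply: le_trans (rnormD _ _) _; rewrite rnormN mulrDl addrA; apply: lerD h2.
apply: le_trans h1; rewrite -cnorm_real rmorphB rmorphM fmorphV rmorphB /= !rmorph_nat.
exact: lexx.
Qed.
End cesaro.

Theorem theorem1p1 (R : realType) (C : H2 R -> H2 R) (hC : is_cesaro C) :
  toeplitz_commutator_ideal R C /\
  toeplitz_commutator_ideal R `<=` toeplitz_algebra R.
Proof.
split; last exact: commutator_ideal_sub.
by move=> J [J_ideal J_comm]; exact: cesaro_in_ideal.
Qed.
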